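(* Let $u_0,v_0>0$ and let $\phi_+:[0,u_0]\to\mathbb S^d$, $\phi_-:[0,v_0]\to\mathbb S^d$ be absolutely continuous (so $\phi_+'\in L^1([0,u_0])$, $\phi_-'\in L^1([0,v_0])$) with $\phi_+(0)=\phi_-(0)$. Then: (i) There exists a unique wave map $\phi=\Phi(\phi_+,\phi_-)$ on $[0,u_0]\times[0,v_0]$ with boundary data $\phi_\pm$. (ii) If $\phi_\pm^{(n)}$ is a sequence of absolutely continuous $\mathbb S^d$-valued boundary data (on $[0,u_0]$ and $[0,v_0]$ respectively) such that $\phi_+^{(n)}(0)=\phi_-^{(n)}(0)$ and $$\lim_{n\to\infty}\max\big(|\phi_+^{(n)}(0)-\phi_+(0)|,\ \|(\phi_+^{(n)})'-\phi_+'\|_{L^1},\ \|(\phi_-^{(n)})'-\phi_-'\|_{L^1}\big)=0,$$ and $\phi^{(n)}$ are the corresponding wave maps, then $$\lim_{n\to\infty}\|\partial_u\partial_v(\phi^{(n)}-\phi)\|_{L^1([0,u_0]\times[0,v_0])}=0.$$ (iii) The following conservation laws hold: $$\int_0^{u_0}|\partial_u\phi(u,v_0)|\,du=\int_0^{u_0}|\phi_+'(u)|\,du,\qquad \int_0^{v_0}|\partial_v\phi(u_0,v)|\,dv=\int_0^{v_0}|\phi_-'(v)|\,dv.$$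
   Context: $d\ge1$ is an integer, $\mathbb S^d\subset\mathbb R^{d+1}$ is the unit sphere, $|\cdot|$ and $\cdot$ are the Euclidean norm and inner product. Wave map: for continuous $\phi_+:[0,u_0]\to\mathbb S^d$, $\phi_-:[0,v_0]\to\mathbb S^d$ with $\phi_+(0)=\phi_-(0)$, a wave map on $[0,u_0]\times[0,v_0]$ with boundary data $\phi_\pm$ is a function $\phi:[0,u_0]\times[0,v_0]\to\mathbb S^d$ such that $\partial_u\phi,\partial_v\phi$ exist almost everywhere, $\partial_u\phi\cdot\partial_v\phi\in L^1([0,u_0]\times[0,v_0])$, and for all $(u,v)\in[0,u_0]\times[0,v_0]$ $$\phi(u,v)=\phi_+(u)+\phi_-(v)-\phi_+(0)-\int_0^u\int_0^v[(\partial_u\phi\cdot\partial_v\phi)\phi](w,z)\,dz\,dw.$$ For a wave map with such data, $\partial_u\partial_v\phi=-(\partial_u\phi\cdot\partial_v\phi)\phi$ almost everywhere and in the sense of distributions. *)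

(* Defs.v *)
From HB Require Import structures.
From mathcomp Require Import all_boot all_order all_algebra.
From mathcomp Require Import all_classical all_reals all_analysis.
Set Implicit Arguments.
Unset Strict Implicit.
Unset Printing Implicit Defensive.
Import Order.TTheory GRing.Theory Num.Theory.
Import numFieldNormedType.Exports.
Local Open Scope classical_set_scope.
Local Open Scope ring_scope.

(* The library norm on ['rV_n] is the sup norm, hence [enorm] below; the
   topology, and so [derivable] and [derive1], are the same for both norms. *)
Definition dot (R : realType) (n : nat) (x y : 'rV[R]_n) : R :=
  (x *m y^T) ord0 ord0.

Definition enorm (R : realType) (n : nat) (x : 'rV[R]_n) : R :=
  Num.sqrt (dot x x).

Definition sphere (R : realType) (d : nat) : set 'rV[R]_d.+1 :=
  [set x | enorm x = 1].

Definition absolutely_continuous (R : realType) (n : nat) (a b : R)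
    (f : R -> 'rV[R]_n) : Prop :=
  forall e : R, 0 < e -> exists2 delta : R, 0 < delta &
    forall (m : nat) (s t : 'I_m -> R),
      (forall i, a <= s i /\ s i <= t i /\ t i <= b) ->
      trivIset [set: 'I_m] (fun i => [set` `]s i, t i[]) ->
      \sum_(i < m) (t i - s i) < delta ->
      \sum_(i < m) enorm (f (t i) - f (s i)) < e.

Definition leb (R : realType) : {measure set (measurableTypeR R) -> \bar R} :=
  @lebesgue_measure R.

Definition leb2 (R : realType) : {measure set (measurableTypeR R * measurableTypeR R)%type -> \bar R} :=
  (@lebesgue_measure R \x @lebesgue_measure R)%E.

Definition rect (R : realType) (u v : R) : set (R * R) :=
  `[0, u]%classic `*` `[0, v]%classic.

(* [integrable] asks for Borel measurability; L^1 functions are only determined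
   almost everywhere, and may be junk where a derivative fails to exist. *)
Definition in_L1 (R : realType) (D : set (R * R)) (f : R -> R -> R) : Prop :=
  exists2 g : R * R -> R, (leb2 R).-integrable D (EFin \o g) &
    {ae leb2 R, forall p, D p -> f p.1 p.2 = g p}.

Definition vec_in_L1 (R : realType) (n : nat) (D : set (R * R))
    (f : R -> R -> 'rV[R]_n) : Prop :=
  forall i : 'I_n, in_L1 D (fun u v => f u v ord0 i).

(* Functions on intervals and rectangles are total functions of which only the
   values there matter; derivatives are used up to null sets, so their values
   at boundary points are irrelevant. *)
Definition d_u (R : realType) (d : nat) (phi : R -> R -> 'rV[R]_d.+1) (u v : R) :
  'rV[R]_d.+1 := derive1 (fun w => phi w v) u.

Definition d_v (R : realType) (d : nat) (phi : R -> R -> 'rV[R]_d.+1) (u v : R) :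
  'rV[R]_d.+1 := derive1 (fun z => phi u z) v.

Definition has_d_u (R : realType) (d : nat) (phi : R -> R -> 'rV[R]_d.+1)
  (u v : R) : Prop := derivable (fun w => phi w v) u 1.

Definition has_d_v (R : realType) (d : nat) (phi : R -> R -> 'rV[R]_d.+1)
  (u v : R) : Prop := derivable (fun z => phi u z) v 1.

Definition has_d_u_d_v (R : realType) (d : nat) (psi : R -> R -> 'rV[R]_d.+1)
    (u v : R) : Prop :=
  (\forall w \near u, has_d_v psi w v) /\ has_d_u (d_v psi) u v.

Definition vec_double_integral (R : realType) (n : nat) (u v : R)
    (f : R -> R -> 'rV[R]_n) : 'rV[R]_n :=
  \row_(i < n) \int[leb R]_(w in `[0, u]) \int[leb R]_(z in `[0, v])
    f w z ord0 i.

Definition boundary_data (R : realType) (d : nat) (u0 v0 : R)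
    (phip phim : R -> 'rV[R]_d.+1) : Prop :=
  [/\ (forall u, 0 <= u <= u0 -> sphere (phip u)),
      (forall v, 0 <= v <= v0 -> sphere (phim v)),
      absolutely_continuous 0 u0 phip,
      absolutely_continuous 0 v0 phim
    & phip 0 = phim 0].

Definition nonlinearity (R : realType) (d : nat) (phi : R -> R -> 'rV[R]_d.+1)
    (u v : R) : 'rV[R]_d.+1 :=
  dot (d_u phi u v) (d_v phi u v) *: phi u v.

(* [vec_in_L1 (nonlinearity phi)] is what it takes for the double integral to
   make sense; [phi] being bounded, it only concerns measurability. *)
Record wave_map (R : realType) (d : nat) (u0 v0 : R)
    (phip phim : R -> 'rV[R]_d.+1) (phi : R -> R -> 'rV[R]_d.+1) : Prop := {
  wave_map_sphere : forall u v, 0 <= u <= u0 -> 0 <= v <= v0 ->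
    sphere (phi u v);
  wave_map_d_u : {ae leb2 R, forall p, rect u0 v0 p -> has_d_u phi p.1 p.2};
  wave_map_d_v : {ae leb2 R, forall p, rect u0 v0 p -> has_d_v phi p.1 p.2};
  wave_map_dot_L1 :
    in_L1 (rect u0 v0) (fun u v => dot (d_u phi u v) (d_v phi u v));
  wave_map_nonlinearity_L1 : vec_in_L1 (rect u0 v0) (nonlinearity phi);
  wave_map_eq : forall u v, 0 <= u <= u0 -> 0 <= v <= v0 ->
    phi u v = phip u + phim v - phip 0
              - vec_double_integral u v (nonlinearity phi)
}.

Definition L1norm (R : realType) (n : nat) (a : R) (f : R -> 'rV[R]_n) : \bar R :=
  (\int[leb R]_(t in `[0%R, a]) (enorm (f t))%:E)%E.

Definition L1norm2 (R : realType) (n : nat) (u0 v0 : R)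
    (f : R -> R -> 'rV[R]_n) : \bar R :=
  (\int[leb2 R]_(p in rect u0 v0) (enorm (f p.1 p.2))%:E)%E.

(* Main.v *)
Require Import Defs.
From HB Require Import structures.
From mathcomp Require Import all_boot all_order all_algebra.
From mathcomp Require Import all_classical all_reals all_analysis.
From mathcomp Require Import measurable_realfun ring lra.
Import Order.TTheory GRing.Theory Num.Theory.
Import numFieldNormedType.Exports.

(** In the characteristic coordinates the equation says that
    [d_v (d_u phi) = - G] and [d_u (d_v phi) = - G], where
    [G = (d_u phi . d_v phi) phi] is the nonlinearity. Integrating once,
    [d_u phi = a - int_0^v G] and [d_v phi = b - int_0^u G], where [a] and [b] are
    the derivatives of the two boundary curves. A wave map is therefore the same
    thing as an integrable kernel [G] with [G = (char_u . char_v) phi] almost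
    everywhere, where [char_u] and [char_v] are these two right-hand sides and
    [phi] is recovered by integrating twice: this is [mild_wave], in which no
    derivative of [phi] is left.

    Conservation. Since [phi . phi = 1], the vector [char_u] is orthogonal to
    [phi], hence to its own [v]-derivative [- G], which is a multiple of [phi].
    So the length of [char_u] does not depend on [v]
    ([mild_wave_conservation]); at [v = v0] this is (iii). It is also the
    a priori bound for the rest: [char_u] and [char_v] are dominated by the
    integrable functions [|a (u)|] and [|b (v)|].

    Stability. For two solutions, [h = |G1 - G2|] is bounded, almost everywhere,
    by a sum of integrals of [h] with integrable weights in [u] and in [v], plus
    terms measuring the distance of the data. Integrating against
    [exp (- 4 (M (u) + N (v)))], with [M] and [N] primitives of the weights,
    absorbs the integrals of [h] ([goursat_L1_bound]). This gives uniqueness,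
    and (ii), where [- (G1 - G2)] is [d_u d_v] of the difference of the maps.

    Existence. Write [phi_+' = m A] and [phi_-' = k B] with [m], [k] the speeds
    and [A], [B] of length at most one. Then [A], [B] and [phi] satisfy the
    system [A_v = k F], [B_u = m F], [phi_v = k B] with [F = - (A . B) phi], in
    which the unbounded factors depend on one variable only. Truncating [F] to
    make it Lipschitz, Picard iteration in a weighted sup norm solves the system
    ([goursat_solution]). The constraints [phi . A = 0], [phi . B = 0],
    [|phi| = 1], and that [|A|] and [|B|] keep their initial values, hold on
    the two initial segments, and their defects obey a homogeneous Gronwall inequality, because the error made
    by truncating is itself linear in the defects; so they persist and the
    truncation never acts ([cutoff_solution_mild_wave]).

    The measure theory behind this consists of three facts: an absolutely
    continuous curve is a primitive ([AC_is_primitive]), which is where the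
    derivatives of the data come from; the map [phi] is differentiable in [u] for
    almost every [u] and every [v] simultaneously ([primitive2_derive]); and
    integrals do not see null sets, even for functions that are not measurable
    ([integral_ae_congr]). *)

Set Implicit Arguments.
Unset Strict Implicit.
Unset Printing Implicit Defensive.
Local Open Scope classical_set_scope.
Local Open Scope ring_scope.

(** * Absolutely continuous functions are primitives *)

Section abs_cont.
Context {R : realType}.
Implicit Types (f g : R -> R) (p q : seq (R * R)).

Definition apart (p q : R * R) := (p.2 <= q.1) || (q.2 <= p.1).

Definition nonoverlapping p := all (fun x : R * R => x.1 <= x.2) p && pairwise apart p.

(** Finite lists of pairs make subdividing an interval and concatenating
    families plain list operations; the weak inequality in the conclusion
    survives suprema over subdivisions. *)
Definition abs_cont f := forall e : R, 0 < e -> exists2 dl : R, 0 < dl &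
  forall p, nonoverlapping p -> \sum_(x <- p) (x.2 - x.1) < dl ->
    \sum_(x <- p) `|f x.2 - f x.1| <= e.

Lemma apartC x y : apart x y = apart y x.
Proof. by rewrite /apart orbC. Qed.

Lemma itv_partition_zip (s t : R) l : itv_partition s t l ->
  [/\ all (fun x : R * R => x.1 <= x.2) (zip (s :: l) l),
      all (fun x : R * R => (s <= x.1) && (x.2 <= t)) (zip (s :: l) l),
      pairwise apart (zip (s :: l) l),
      \sum_(x <- zip (s :: l) l) (x.2 - x.1) = t - s &
      forall f, \sum_(x <- zip (s :: l) l) `|f x.2 - f x.1| = variation s t f l].
Proof.
move=> stl; have vE f : \sum_(x <- zip (s :: l) l) `|f x.2 - f x.1| = variation s t f l.
  rewrite (variation_zip f stl).
  have -> : zip l (s :: l) = map (fun x => (x.2, x.1)) (zip (s :: l) l).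
    elim: l {stl} s => //= y l IH s; congr cons; first exact: IH.
  by rewrite big_map.
split=> //; move: stl {vE}.
- elim: l s => //= y l IH s [] /= /andP[sy yl lt].
  by rewrite (ltW sy) /=; apply: IH.
- elim: l s => //= y l IH s [] /= /andP[sy yl lt].
  rewrite lexx/=; apply/andP; split.
    exact: (itv_partition_le (conj yl lt)).
  apply/allP => x xl; have /allP/(_ x xl)/andP[yx ->] := IH y (conj yl lt).
  by rewrite (le_trans (ltW sy) yx).
- elim: l s => //= y l IH s [] /= /andP[sy yl lt].
  rewrite (IH y (conj yl lt)) andbT.
  elim: l y yl lt {IH sy} => //= z l IH y /andP[yz zl] lt.
  rewrite /apart/= lexx/=.
  have := IH z zl lt; apply: sub_all => x /=; rewrite /apart/= => /orP[zx|xs].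
    by rewrite (le_trans (ltW yz) zx).
  by rewrite xs orbT.
- elim: l s => [s [_ /= /eqP <-]|y l IH s [] /= /andP[sy yl] lt].
    by rewrite big_nil subrr.
  rewrite big_cons /= (IH y (conj yl lt)); lra.
Qed.

Lemma nonoverlapping_sym p q : nonoverlapping (p ++ q) = nonoverlapping (q ++ p).
Proof.
rewrite /nonoverlapping !all_cat !pairwise_cat [allrel _ q p]allrelC.
rewrite (eq_allrel (r' := apart)); last by move=> x y; rewrite apartC.
by rewrite [pairwise _ q && _]andbC [all _ q && _]andbC.
Qed.

(** Any subdivision of an interval of total length below [dl] is again such
    a family, so the modulus of continuity of [f] bounds variations as well.
    The induction moves the intervals one by one from [p], where the
    variation is counted, to [q], where they are already subdivided. *)
Lemma AC_total_variation f (e dl : R) :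
  (forall p, nonoverlapping p -> \sum_(x <- p) (x.2 - x.1) < dl ->
    \sum_(x <- p) `|f x.2 - f x.1| <= e) ->
  forall p q, nonoverlapping (q ++ p) -> \sum_(x <- q ++ p) (x.2 - x.1) < dl ->
    ((\sum_(x <- q) `|f x.2 - f x.1|)%:E +
     \sum_(x <- p) total_variation x.1 x.2 f <= e%:E)%E.
Proof.
move=> H; elim=> [|[s t] p IH] q.
  by rewrite cats0 big_nil adde0 lee_fin; exact: H.
move=> sep len; rewrite big_cons /=.
have st : s <= t.
  by move: sep; rewrite nonoverlapping_sym /= => /andP[/= /andP[]].
have: ((\sum_(x <- q) `|f x.2 - f x.1|)%:E +
     \sum_(x <- p) total_variation x.1 x.2 f <= e%:E)%E.
  apply: IH.
    move: sep; rewrite /nonoverlapping !all_cat !pairwise_cat/= allrel_consr.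
    by move=> /andP[/and3P[-> _ ->] /and3P[/andP[_ ->] -> /andP[_ ->]]].
  apply: le_lt_trans len; rewrite !big_cat big_cons/=; lra.
move=> H0.
have ge0 : (0 <= \sum_(x <- p) total_variation x.1 x.2 f)%E.
  have : all (fun x : R * R => x.1 <= x.2) p.
    by move: sep; rewrite /nonoverlapping !all_cat/= => /andP[/and3P[]].
  elim: p {IH sep len H0} => [|x p IH /= /andP[x12 xp]]; rewrite ?big_nil// big_cons.
  by rewrite adde_ge0// ?IH// total_variation_ge0.
have fin : (\sum_(x <- p) total_variation x.1 x.2 f \is a fin_num)%E.
  rewrite ge0_fin_numE//; apply: le_lt_trans (ltry e); apply: le_trans H0.
  by rewrite leeDr// lee_fin sumr_ge0.
rewrite addeCA -leeBrDr ?fin_numD ?fin//.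
apply: ub_ereal_sup => _ [_ [l stl <-] <-].
rewrite leeBrDr ?fin_numD ?fin// addeA -EFinD.
have [l1 l2 l3 l4 l5] := itv_partition_zip stl.
have -> : variation s t f l + \sum_(x <- q) `|f x.2 - f x.1| =
    \sum_(x <- zip (s :: l) l ++ q) `|f x.2 - f x.1| by rewrite big_cat l5.
apply: IH; last first.
  apply: le_lt_trans len; rewrite !big_cat big_cons/= l4; lra.
move: sep; rewrite /nonoverlapping !all_cat !pairwise_cat/= allrel_consr l1/=.
move=> /andP[/and3P[q12 _ p12] /and3P[/andP[qst qp] qq /andP[stp pp]]].
rewrite q12 p12 l3 qq pp/= allrel_catl qp !andbT.
have sub (x y : R * R) : y \in zip (s :: l) l -> apart x (s, t) -> apart y x.
  move=> /(allP l2)/andP[sy yt] /orP[]/= h.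
    by rewrite /apart (le_trans h sy) orbT.
  by rewrite /apart (le_trans yt h).
apply/andP; split; apply/allrelP => y x yl xq; apply: sub => //.
  by rewrite apartC; move/allP: stp; apply.
by move/allP: qst; apply.
Qed.

(** An interval shorter than [dl] has variation at most [1], and finitely
    many of these cover [[s, t]]. *)
Lemma AC_total_variation_fin f s t : abs_cont f -> s <= t ->
  total_variation s t f \is a fin_num.
Proof.
move=> /(_ 1 ltr01)[dl dl0 H] st.
suff tv n : forall s t : R, s <= t -> t - s <= n%:R * (dl / 2) ->
    (total_variation s t f <= n%:R%:E)%E.
  have [n tn] : exists n : nat, (t - s) / (dl / 2) <= n%:R.
    exists (Num.bound ((t - s) / (dl / 2))); rewrite ltW// archi_boundP//.
    by rewrite divr_ge0 ?subr_ge0// ltW// divr_gt0.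
  rewrite ge0_fin_numE ?total_variation_ge0//; apply: le_lt_trans (ltry n%:R).
  by apply: tv => //; rewrite -ler_pdivrMr// divr_gt0.
elim: n {s t st} => [s t st|n IH s t st tsn].
  rewrite mul0r => ts; have -> : t = s by lra.
  by rewrite total_variationxx.
have small (a b : R) : a <= b -> b - a <= dl / 2 -> (total_variation a b f <= 1)%E.
  move=> ab abd; have := @AC_total_variation f 1 dl H [:: (a, b)] [::].
  rewrite !big_nil add0e !big_seq1/=; apply; last lra.
  by rewrite /nonoverlapping/= ab.
have [le|lt] := lerP (t - s) (dl / 2).
  apply: (le_trans (small s t st le)); rewrite lee_fin ler1n//.
have sc : s <= s + dl / 2 by lra.
have ct : s + dl / 2 <= t by lra.
rewrite (total_variationD f sc ct).
rewrite -[n.+1]add1n natrD EFinD; apply: leeD; first by apply: small; lra.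
apply: IH; first lra.
rewrite -[n.+1]add1n natrD in tsn; lra.
Qed.

Lemma nonoverlapping_clamp p (h : R -> R) : {homo h : x y / x <= y} ->
  (forall x y, x <= y -> h y - h x <= y - x) -> nonoverlapping p ->
  nonoverlapping (map (fun x => (h x.1, h x.2)) p) /\
  \sum_(x <- map (fun x => (h x.1, h x.2)) p) (x.2 - x.1)
    <= \sum_(x <- p) (x.2 - x.1).
Proof.
move=> hm hl /andP[p1 p2]; split.
  rewrite /nonoverlapping all_map pairwise_map; apply/andP; split.
    by apply: sub_all p1 => x/=; exact: hm.
  by apply: sub_pairwise p2 => x y /orP[] /hm xy; rewrite /apart/= xy ?orbT.
rewrite big_map /=; elim: p p1 {p2} => [|x p IH /= /andP[x12 px]].
  by rewrite !big_nil.
by rewrite !big_cons lerD ?IH//= hl.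
Qed.

Lemma AC_comp_clamp f (h : R -> R) : {homo h : x y / x <= y} ->
  (forall x y, x <= y -> h y - h x <= y - x) -> abs_cont f -> abs_cont (f \o h).
Proof.
move=> hm hl H e /H[dl dl0 {}H]; exists dl => // p /(nonoverlapping_clamp hm hl)[sp lp] pd.
by have := H _ sp (le_lt_trans lp pd); rewrite big_map.
Qed.

Lemma AC_sub f g : abs_cont f -> abs_cont g -> abs_cont (fun x => f x - g x).
Proof.
move=> F G e e0; have e2 : 0 < e / 2 by rewrite divr_gt0.
have [d d0 {}F] := F _ e2; have [d' d'0 {}G] := G _ e2.
exists (Num.min d d'); first by rewrite lt_min d0.
move=> p sp; rewrite lt_min => /andP[p1 p2].
rewrite (le_trans _ (_ : e / 2 + e / 2 <= _)) //; last lra.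
apply: le_trans (lerD (F _ sp p1) (G _ sp p2)); rewrite -big_split/=.
apply: ler_sum => x _; rewrite (_ : _ - _ = (f x.2 - f x.1) - (g x.2 - g x.1)); last ring.
exact: ler_normB.
Qed.

Lemma max0_homo : {homo Num.max (0 : R) : x y / x <= y}.
Proof. by move=> x y xy; rewrite ge_max !le_max lexx/= xy orbT. Qed.

Lemma max0_contract (x y : R) : x <= y -> Num.max 0 y - Num.max 0 x <= y - x.
Proof.
by move=> xy; rewrite /Num.max; case: ltP => ?; case: ltP => ?; lra.
Qed.

(** Clamping at [0] makes the variation a monotone function on the whole
    line, as Stieltjes measures require. *)
Definition tvar f x := fine (total_variation 0 (Num.max 0 x) f).

Lemma tvarB f x y : abs_cont f -> x <= y ->
  (tvar f y - tvar f x)%:E = total_variation (Num.max 0 x) (Num.max 0 y) f.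
Proof.
move=> acf xy; have m0 (z : R) : 0 <= Num.max 0 z by rewrite le_max lexx.
rewrite EFinB /tvar !fineK ?AC_total_variation_fin//.
rewrite (total_variationD f (m0 x) (max0_homo xy)) addeAC subee ?add0e//.
exact: AC_total_variation_fin.
Qed.

Lemma tvar_homo f : abs_cont f -> {homo tvar f : x y / x <= y}.
Proof.
move=> acf x y xy; rewrite -subr_ge0 -lee_fin tvarB//.
by rewrite total_variation_ge0// max0_homo.
Qed.

Lemma tvar_ge f x y : abs_cont f -> x <= y ->
  f (Num.max 0 y) - f (Num.max 0 x) <= tvar f y - tvar f x.
Proof.
move=> acf xy; rewrite -lee_fin tvarB//.
apply: le_trans (total_variation_ge _ (max0_homo xy)).
by rewrite lee_fin ler_norm.
Qed.

Lemma AC_tvar f : abs_cont f -> abs_cont (tvar f).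
Proof.
move=> acf e /acf[dl dl0 H]; exists dl => // p sp pd.
have [sq qp] := nonoverlapping_clamp max0_homo max0_contract sp.
set q := map _ p in sq qp.
have := AC_total_variation H (q := [::]) sq (le_lt_trans qp pd).
rewrite big_nil add0e /q big_map/= => le.
rewrite -lee_fin; apply: le_trans le.
rewrite le_eqVlt; apply/orP; left; apply/eqP.
rewrite -sumEFin; case/andP: sp => + _.
elim: p {pd sq qp q} => [|x p IH /= /andP[x12 px]]; first by rewrite !big_nil.
rewrite !big_cons IH//; congr (_ + _)%E; rewrite -tvarB//.
by rewrite ger0_norm// subr_ge0 tvar_homo.
Qed.

Lemma AC_continuous f : abs_cont f -> continuous f.
Proof.
move=> acf x; apply/cvgrPdist_le => e /acf[dl dl0 H].
exists dl => //= y /=; rewrite /ball_/= => xy.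
have [xley|yltx] := lerP x y.
  rewrite ler0_norm ?subr_le0// in xy.
  have := H [:: (x, y)]; rewrite !big_seq1/= => h; rewrite distrC; apply: h; last lra.
  by rewrite /nonoverlapping/= xley.
rewrite ger0_norm ?subr_ge0 ?(ltW yltx)// in xy.
have := H [:: (y, x)]; rewrite !big_seq1/= => h; apply: h; last lra.
by rewrite /nonoverlapping/= (ltW yltx).
Qed.

Section stieltjes.
Variables (G : cumulative R R) (acG : abs_cont G).
Local Notation nu := (lebesgue_stieltjes_measure G).

Lemma stieltjes_ocitv (x y : R) : x <= y ->
  nu (`]x, y]%classic : set (measurableTypeR R)) = (G y - G x)%:E.
Proof.
move=> xy; rewrite /lebesgue_stieltjes_measure.
have mo : measurable (`]x, y]%classic : set (ocitv_type R)) by exact: is_ocitv.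
rewrite [LHS](@measurable_mu_extE _ _ _ (wlength G))//.
exact: (wlength_itv_bnd G false false xy).
Qed.

Lemma stieltjes_itv_le (i : interval R) (s t : R) : s <= t ->
  [set` i] `<=` `[s, t]%classic ->
  (nu ([set` i] : set (measurableTypeR R)) <= (G t - G s)%:E)%E.
Proof.
move=> st ist; apply/lee_addgt0Pr => e e0.
have [h h0 hG] : exists2 h : R, 0 < h & G s - G (s - h) <= e.
  have /cvgrPdist_le/(_ _ e0) [d /= d0 H] := @AC_continuous _ acG s.
  exists (d / 2); first by rewrite divr_gt0.
  apply: le_trans (ler_norm _) _; apply: H; rewrite /ball_/= opprB addrC subrK.
  by rewrite ger0_norm ?divr_ge0 ?ltW// ltr_pdivrMr// ltr_pMr// ltr1n.
apply: (@le_trans _ _ (G t - G (s - h))%:E); last first.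
  by rewrite -EFinD lee_fin; lra.
rewrite -stieltjes_ocitv; last lra.
apply: le_measure; rewrite ?inE; [exact: measurable_itv|exact: measurable_itv|].
move=> x /ist; rewrite /= !in_itv/= => /andP[sx ->]; rewrite andbT; lra.
Qed.

(** A Lebesgue-null set lies in an open set of small measure, that is in
    disjoint intervals of small total length; absolute continuity of [G]
    makes their Stieltjes measure small. *)
Lemma stieltjes_dominates : nu `<< @lebesgue_measure R.
Proof.
apply/null_content_dominatesP => A mA A0.
apply/eqP; rewrite eq_le measure_ge0 andbT; apply/lee_addgt0Pr => e e0; rewrite add0e.
have [dl dl0 H] := acG e0.
(* outer regularity provides the small open set, here cut into its components [I] *)
have [|U [oU AU Udl]] := @lebesgue_regularity_outer R A dl mA _ dl0.
  by rewrite [X in (X < _)%E]A0.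
have mU : measurable U by exact: open_measurable.
have {}Udl : (lebesgue_measure U < dl%:E)%E.
  have UA : U = (U `\` A) `|` A by rewrite setUC setDUK.
  rewrite UA; apply: le_lt_trans (measureU2 _ _ _) _ => //; first exact: measurableD.
  by rewrite A0 adde0.
apply: (@le_trans _ _ (nu U)); first by apply: le_measure; rewrite ?inE.
pose I k := open_disjoint_itv oU k.
have tI : trivIset setT I by exact: open_disjoint_itv_trivIset.
have mI k : measurable (I k) by apply: open_measurable; exact: open_disjoint_itv_open.
have UI : U = \bigcup_k I k by exact: open_disjoint_itv_bigcup.
have IU k : I k `<=` U by rewrite UI; exact: bigcup_sup.
have st k : exists x : R * R, [/\ x.1 <= x.2, `]x.1, x.2[%classic `<=` I k,
    I k `<=` `[x.1, x.2]%classic & lebesgue_measure (I k) = (x.2 - x.1)%:E].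
  have := IU k; have /is_intervalP := @open_disjoint_itv_is_interval _ _ oU k.
  rewrite -/(I k) => ->; move: (Rhull (I k)) => [a b] IkU.
  have lt : (lebesgue_measure [set` Interval a b] < +oo)%E.
    apply: le_lt_trans (lt_trans Udl (ltry _)).
    by apply: le_measure; rewrite ?inE//; exact: measurable_itv.
  have [I0|/set0P[z /= zab]] := eqVneq [set` Interval a b] set0.
    exists (0, 0) => /=; rewrite I0 measure0 subrr set_itvoo0//; split => //; exact: sub0set.
  rewrite lebesgue_measure_itv/= in lt *.
  case: a b zab lt {IkU} => [ba x|[]] [bb y|[]] //= zab;
    rewrite ?ltxx ?ltNyr ?ltry ?ltNyy//=; try by move: zab; rewrite in_itv/= ?andbF.
  have xy : x <= y by case: ba bb zab => [] [] h; rewrite (itvP h).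
  move=> _.
  exists (x, y) => /=; split => //.
  - exact: subset_itvW.
  - move=> w; rewrite /= !in_itv/= => /andP[xw wy].
    by rewrite (lteifW xw) (lteifW wy).
  - rewrite lte_fin lt_neqAle xy andbT; case: eqVneq => [->|_] /=; first by rewrite subrr.
    by rewrite EFinB.
have {st} [s Hs] := choice st.
rewrite UI measure_semi_bigcup//; last by rewrite -UI.
apply: lime_le; first exact: is_cvg_nneseries.
near=> n.
(* degenerate intervals are dropped: they carry no mass, and repeated ones
   would overlap *)
pose p := [seq s k | k <- iota 0 n & (s k).1 < (s k).2].
have sumE (F : R * R -> R) : (forall k, (s k).1 = (s k).2 -> F (s k) = 0) ->
    \sum_(x <- p) F x = \sum_(0 <= k < n) F (s k).
  move=> F0; rewrite big_map big_filter /index_iota subn0.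
  rewrite [RHS](bigID (fun k => (s k).1 < (s k).2))/= [X in _ + X]big1 ?addr0//.
  move=> k; rewrite -leNgt => sk; apply: F0; have [? _ _ _] := Hs k.
  by apply/eqP; rewrite eq_le sk andbT.
apply: (@le_trans _ _ (\sum_(x <- p) `|G x.2 - G x.1|)%:E).
  rewrite sumE; last by move=> k ->; rewrite subrr normr0.
  rewrite -sumEFin; apply: lee_sum => k _; have [sk _ Is _] := Hs k.
  have /is_intervalP Ik := @open_disjoint_itv_is_interval _ _ oU k.
  rewrite -/(I k) in Ik; rewrite Ik in Is *.
  by apply: le_trans (stieltjes_itv_le sk Is) _; rewrite lee_fin ler_norm.
rewrite lee_fin; apply: H.
  rewrite /nonoverlapping all_map; apply/andP; split.
    by apply/allP => k; rewrite mem_filter => /andP[/ltW].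
  rewrite pairwise_map.
  pose P := [pred k | (s k).1 < (s k).2].
  apply: (@sub_in_pairwise _ P [rel i j | i != j]); last first.
  - by rewrite -uniq_pairwise filter_uniq// iota_uniq.
  - by apply/allP => k; rewrite mem_filter => /andP[].
  move=> i j; rewrite !inE /= => si sj ij; rewrite /apart.
  apply: contraT; rewrite negb_or -!ltNge => /andP[h1 h2].
  (* two overlapping intervals would share the midpoint of their intersection *)
  pose z := (Num.max (s i).1 (s j).1 + Num.min (s i).2 (s j).2) / 2.
  have lt : Num.max (s i).1 (s j).1 < Num.min (s i).2 (s j).2.
    by rewrite gt_max !lt_min si sj h1 h2.
  have /andP[z1 z2] : Num.max (s i).1 (s j).1 < z < Num.min (s i).2 (s j).2.
    by have [? ?] := midf_lt lt; apply/andP.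
  move: z1 z2; rewrite gt_max lt_min => /andP[a1 a2] /andP[b1 b2].
  have [_ Ii _ _] := Hs i; have [_ Ij _ _] := Hs j.
  move/trivIsetP : tI => /(_ i j Logic.I Logic.I ij)/seteqP[/(_ z) + _].
  case; split; [apply: Ii|apply: Ij]; rewrite /= in_itv/=; exact/andP.
rewrite sumE; last by move=> k ->; rewrite subrr.
rewrite -lte_fin; apply: le_lt_trans Udl.
rewrite UI measure_semi_bigcup//; last by rewrite -UI.
rewrite -sumEFin (eq_bigr (fun k => lebesgue_measure (I k))).
  exact: nneseries_lim_ge.
by move=> k _; have [_ _ _] := Hs k.
Unshelve. all: by end_near. Qed.

End stieltjes.

Local Notation mu := (@lebesgue_measure R).

(** Integrability over the whole line: the derivatives of the data are
    extended by zero, so that no domain has to be carried around. *)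
Definition L1 (g : R -> R) := mu.-integrable [set: measurableTypeR R] (EFin \o g).

Definition primitive (g : R -> R) (x : R) : R := \int[mu]_(t in `[0, x]) g t.

Definition is_primitive (f g : R -> R) :=
  L1 g /\ forall x, f x = f 0 + primitive g x.

Lemma L1_measurable g : L1 g -> measurable_fun [set: measurableTypeR R] g.
Proof. by move=> /integrableP[/measurable_EFinP]. Qed.

Lemma L1S (D : set (measurableTypeR R)) g : measurable D -> L1 g -> mu.-integrable D (EFin \o g).
Proof. by move=> mD; apply: integrableS. Qed.

Lemma L1_itv (i : interval R) g : L1 g -> mu.-integrable [set` i] (EFin \o g).
Proof. by apply: L1S; exact: measurable_itv. Qed.

(** The density is the Radon-Nikodym derivative of the Stieltjes measure of
    [G], restricted to [[0, b]]. *)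
Lemma AC_nondecreasing_primitive (G : R -> R) (b : R) : 0 <= b ->
  {homo G : x y / x <= y} -> abs_cont G ->
  exists g, [/\ L1 g, (forall x, ~ (0 <= x <= b) -> g x = 0) &
    forall x, 0 <= x <= b -> G x = G 0 + primitive g x].
Proof.
move=> b0 hG acG.
have rcG : right_continuous G by exact/right_continuousW/AC_continuous.
pose Gc := HB.pack_for (cumulative R R) G (isCumulative.Build R _ R G hG rcG).
have acGc : abs_cont Gc by [].
have dom := @stieltjes_dominates Gc acGc.
set nu := lebesgue_stieltjes_measure Gc in dom.
pose D : set (measurableTypeR R) := `]0, b]%classic.
have mD : measurable D by exact: measurable_itv.
have nuD : (nu D < +oo)%E.
  by rewrite [X in (X < _)%E](stieltjes_ocitv Gc b0) ltry.
have [|f [f0 ffin intf fE]] := @radon_nikodym_sigma_finite _ _ _ mu (mfrestr mD nuD).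
  apply/null_content_dominatesP => A mA A0.
  move/null_content_dominatesP : dom => /(_ (A `&` D)); apply.
    exact: measurableI.
  by apply: subset_measure0 A0 => //; exact: measurableI.
pose g := (fine \o f) \_ D.
have L1g : L1 g.
  rewrite /L1 /g -restrict_EFin; apply/integrable_restrict => //=.
  rewrite setTI; apply: (@integrableS _ _ _ mu setT) => //.
  by apply: eq_integrable (intf) => // x _; rewrite /= fineK.
exists g; split => // [x xb|x /andP[x0 xb]].
  rewrite /g patchE ifF//; apply/negbTE/negP; rewrite inE /D/= in_itv/= => /andP[x0 xb'].
  by apply: xb; rewrite (ltW x0).
rewrite /primitive -Rintegral_itv_obnd_cbnd; last exact: L1_itv.
rewrite /Rintegral (eq_integral f); last first.
  move=> t; rewrite inE/= in_itv/= => /andP[t0 tx]; rewrite /g patchE ifT ?fineK//.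
  by rewrite inE /D/= in_itv/= t0 (le_trans tx).
rewrite -fE; last exact: measurable_itv.
rewrite /= /mfrestr /mrestr setIidl; last first.
  by move=> t; rewrite /D /= !in_itv/= => /andP[-> /le_trans]; apply.
by rewrite [X in fine X](stieltjes_ocitv Gc x0)/= addrC subrK.
Qed.

Lemma L1B (g h : R -> R) : L1 g -> L1 h -> L1 (fun x => g x - h x).
Proof. by move=> Lg Lh; exact: (integrableB _ Lg Lh). Qed.

Lemma primitiveB g h x : L1 g -> L1 h ->
  primitive (fun x => g x - h x) x = primitive g x - primitive h x.
Proof.
move=> Lg Lh; by rewrite /primitive RintegralB//; exact: L1_itv.
Qed.

(** Fundamental theorem of calculus for absolutely continuous functions:
    [tvar f] and [tvar f - f] are nondecreasing and absolutely continuous,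
    and [f] is their difference. *)
Theorem AC_is_primitive (f : R -> R) (b : R) : 0 <= b -> abs_cont f ->
  exists g, [/\ L1 g, (forall x, ~ (0 <= x <= b) -> g x = 0) &
    forall x, 0 <= x <= b -> f x = f 0 + primitive g x].
Proof.
move=> b0 acf.
have acm : abs_cont (fun x => f (Num.max 0 x)).
  by apply: (@AC_comp_clamp f (Num.max 0)) => //; [exact: max0_homo|exact: max0_contract].
have acT := AC_tvar acf.
have acD := AC_sub acT acm.
have [g1 [L1g1 g10 Hg1]] := AC_nondecreasing_primitive b0 (tvar_homo acf) acT.
have [|g2 [L1g2 g20 Hg2]] := AC_nondecreasing_primitive b0 _ acD.
  by move=> x y xy /=; have := tvar_ge acf xy; lra.
exists (fun x => g1 x - g2 x); split; first exact: L1B.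
  by move=> x xb; rewrite g10// g20// subrr.
move=> x xb; rewrite primitiveB//; have := Hg1 _ xb; have := Hg2 _ xb.
have [x0 _] := andP xb; rewrite maxxx (max_idPr x0); lra.
Qed.

Lemma primitive_lt0 g x : x <= 0 -> primitive g x = 0.
Proof.
rewrite /primitive le_eqVlt => /predU1P[->|x0].
  by rewrite set_itv1 Rintegral_set1.
by rewrite set_itv_ge ?Rintegral_set0// bnd_simp -ltNge.
Qed.

Lemma primitive0 g : primitive g 0 = 0.
Proof. exact: primitive_lt0. Qed.

Lemma primitiveBE g x y : L1 g -> 0 <= x -> x <= y ->
  primitive g y - primitive g x = \int[mu]_(t in `]x, y]) g t.
Proof. by move=> Lg x0 xy; rewrite /primitive Rintegral_itvB//; exact: L1_itv. Qed.

Lemma primitive_const g x y : 0 <= x -> x <= y -> L1 g ->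
  (forall z, x < z -> g z = 0) -> primitive g y = primitive g x.
Proof.
move=> x0 xy Lg g0; apply/eqP; rewrite -subr_eq0 primitiveBE//.
apply/eqP; rewrite /Rintegral integral0_eq// => z.
by rewrite /= in_itv/= => /andP[/g0 ->].
Qed.

Theorem AC_clamp_is_primitive (f : R -> R) (b : R) : 0 <= b -> abs_cont f ->
  (forall x, f x = f (Num.min b (Num.max 0 x))) ->
  exists2 g, is_primitive f g & (forall x, ~ (0 <= x <= b) -> g x = 0).
Proof.
move=> b0 acf fc; have [g [Lg g0 Hg]] := AC_is_primitive b0 acf.
exists g => //; split=> // x.
have [x0|/ltW x0] := lerP 0 x; last first.
  by rewrite fc (max_idPl x0) (min_idPr b0) primitive_lt0// addr0.
have [xb|/ltW bx] := lerP x b; first by apply: Hg; rewrite x0.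
rewrite fc (max_idPr x0) (min_idPl bx) Hg ?b0 ?lexx//.
congr (_ + _); apply/esym/primitive_const => // z bz.
by apply: g0 => /andP[_]; rewrite leNgt bz.
Qed.

End abs_cont.

(** * Calculus of primitives of integrable functions *)

Section almost_everywhere.
Context d (T : measurableType d) (R : realType) (m : {measure set T -> \bar R}).
Implicit Types P Q S : T -> Prop.

Lemma aeS P Q : (forall x, P x -> Q x) ->
  {ae m, forall x, P x} -> {ae m, forall x, Q x}.
Proof. by move=> PQ; apply: filterS => //; exact: (ae_filter_ringOfSetsType m). Qed.

Lemma aeS2 P Q S : (forall x, P x -> Q x -> S x) ->
  {ae m, forall x, P x} -> {ae m, forall x, Q x} -> {ae m, forall x, S x}.
Proof. by move=> PQS; apply: filterS2 => //; exact: (ae_filter_ringOfSetsType m). Qed.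

Lemma aeS3 P Q S U : (forall x, P x -> Q x -> S x -> U x) ->
  {ae m, forall x, P x} -> {ae m, forall x, Q x} -> {ae m, forall x, S x} ->
  {ae m, forall x, U x}.
Proof. by move=> PQS; apply: filterS3 => //; exact: (ae_filter_ringOfSetsType m). Qed.

End almost_everywhere.

Section primitives.
Context {R : realType}.
Implicit Types (f g h : R -> R).
Local Notation mu := (@lebesgue_measure R).

Lemma mitv (i : interval R) : measurable ([set` i] : set (measurableTypeR R)).
Proof. exact: measurable_itv. Qed.

(** Half-open intervals are used so that intervals sharing an endpoint stay
    disjoint. *)
Fixpoint interval_union (p : seq (R * R)) : set (measurableTypeR R) :=
  if p is x :: p' then `]x.1, x.2]%classic `|` interval_union p' else set0.

Lemma measurable_interval_union p : measurable (interval_union p).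
Proof.
by elim: p => [|x p IH] //=; apply: measurableU => //; exact: measurable_itv.
Qed.

Lemma measure_interval_union p : all (fun x : R * R => x.1 <= x.2) p ->
  (mu (interval_union p) <= (\sum_(x <- p) (x.2 - x.1))%:E)%E.
Proof.
elim: p => [|x p IH] /=; first by rewrite measure0 big_nil.
move=> /andP[x12 /IH {}IH]; rewrite big_cons EFinD.
have mx : measurable (`]x.1, x.2]%classic : set (measurableTypeR R)).
  exact: measurable_itv.
apply: le_trans (measureU2 _ mx (measurable_interval_union p)) _.
apply: leeD => //; rewrite [leLHS](lebesgue_measure_itv `]x.1, x.2])/= lte_fin.
by case: ifP => // _; rewrite lee_fin subr_ge0.
Qed.

Lemma L1_norm g : L1 g -> L1 (fun x => `|g x|).
Proof. by move=> Lg; exact: integrable_norm Lg. Qed.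

Lemma primitive_ge0 g x : (forall z, 0 <= g z) -> 0 <= primitive g x.
Proof. by move=> g0; apply: Rintegral_ge0 => z _; exact: g0. Qed.

Lemma le_primitive g h x : L1 g -> L1 h -> (forall z, 0 <= z -> z <= x -> g z <= h z) ->
  primitive g x <= primitive h x.
Proof.
move=> Lg Lh gh; apply: le_Rintegral; [exact: measurable_itv|exact: L1_itv|exact: L1_itv|].
by move=> z; rewrite /= in_itv/= => /andP[]; exact: gh.
Qed.

Lemma primitive_nd g x y : L1 g -> (forall z, 0 <= g z) -> x <= y ->
  primitive g x <= primitive g y.
Proof.
move=> Lg g0 xy; have [x0|/ltW x0] := lerP 0 x; last first.
  by rewrite primitive_lt0// primitive_ge0.
rewrite -subr_ge0 primitiveBE//; exact: Rintegral_ge0.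
Qed.

Lemma norm_primitive g x : L1 g -> `|primitive g x| <= primitive (fun z => `|g z|) x.
Proof.
move=> Lg; apply: le_normr_Rintegral; [exact: measurable_itv|exact: L1_itv].
Qed.

Lemma norm_primitiveB g x y : L1 g -> x <= y ->
  `|primitive g y - primitive g x| <=
  primitive (fun z => `|g z|) y - primitive (fun z => `|g z|) x.
Proof.
move=> Lg xy; have Ln := L1_norm Lg.
have [x0|/ltW x0] := lerP 0 x; last first.
  by rewrite (primitive_lt0 _ x0) (primitive_lt0 _ x0) !subr0; exact: norm_primitive.
rewrite !primitiveBE//; apply: le_normr_Rintegral; [exact: measurable_itv|exact: L1_itv].
Qed.

Lemma nonoverlapping_interval_union p (h : R -> R) : L1 h -> (forall z, 0 <= h z) ->
  nonoverlapping p -> \sum_(x <- p) (primitive h x.2 - primitive h x.1) <=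
    \int[mu]_(t in interval_union p) h t.
Proof.
move=> Lh h0; elim: p => [|x p IH] /=; first by rewrite big_nil Rintegral_set0.
rewrite /nonoverlapping/= => /andP[/andP[x12 px] /andP[xp pp]].
have mp := measurable_interval_union p.
rewrite Rintegral_setU//; last 2 first.
  apply: L1S => //; apply: measurableU => //; exact: measurable_itv.
  apply/disj_setPS => z [] /=; rewrite in_itv/= => /andP[xz zx].
  elim: p xp {IH px pp mp} => //= y p IH /andP[xy xp] [|]; last exact: IH.
  move: xy; rewrite in_itv/= /apart => /orP[] le /andP[yz zy].
    by move: (lt_le_trans yz zx); rewrite ltNge le.
  by move: (lt_le_trans xz zy); rewrite ltNge le.
rewrite big_cons; apply: lerD; last by apply: IH; rewrite /nonoverlapping px pp.
have [x0|/ltW x0] := lerP 0 x.1; first by rewrite primitiveBE.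
have [x20|x20] := lerP x.2 0.
  by rewrite !primitive_lt0// subrr; apply: Rintegral_ge0.
rewrite [primitive h x.1]primitive_lt0// subr0.
rewrite -[leLHS]subr0 -[X in _ - X](primitive0 h) (primitiveBE _ _ (ltW x20))//.
rewrite -(Rintegral_itvB (a := BRight x.1)) ?bnd_simp ?(ltW x20)//; last exact: L1_itv.
by rewrite gerBl Rintegral_ge0.
Qed.

Lemma AC_dominated1 f g (C : R) : 0 <= C -> abs_cont g ->
  (forall x y, x <= y -> `|f y - f x| <= C * `|g y - g x|) -> abs_cont f.
Proof.
move=> C0 acg fg e e0; have [|dl dl0 H] := acg (e / (C + 1)).
  by rewrite divr_gt0//; lra.
exists dl => // p sp pd; apply: (@le_trans _ _ (C * \sum_(x <- p) `|g x.2 - g x.1|)).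
  rewrite mulr_sumr; case/andP: sp => sp _; elim: p sp {pd} => [|x p IH /= /andP[x12 xp]].
    by rewrite !big_nil.
  by rewrite !big_cons lerD ?IH// fg.
apply: (@le_trans _ _ (C * (e / (C + 1)))); first by rewrite ler_wpM2l ?H.
by rewrite mulrCA ler_piMr ?(ltW e0)// ler_pdivrMr; lra.
Qed.

(** Absolute continuity of the integral of [h] with respect to the measure
    of the domain. *)
Lemma AC_dominated f h : L1 h -> (forall z, 0 <= h z) ->
  (forall x y, x <= y -> `|f y - f x| <= primitive h y - primitive h x) -> abs_cont f.
Proof.
move=> Lh h0 fh e e0; have [dl [dl0 H]] := integral_normr_continuous Lh e0.
exists dl => // p sp pd; apply: (@le_trans _ _ (\sum_(x <- p) (primitive h x.2 - primitive h x.1))).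
  case/andP: sp => sp _; elim: p sp {pd} => [|x p IH /= /andP[x12 xp]].
    by rewrite !big_nil.
  by rewrite !big_cons lerD ?IH// fh.
apply: le_trans (nonoverlapping_interval_union Lh h0 sp) _.
have mp := measurable_interval_union p.
have := H _ mp; case/andP: (sp) => sp1 _ /(_ (le_lt_trans (measure_interval_union sp1) _)).
rewrite lte_fin => /(_ pd)/ltW; apply: le_trans; apply: le_Rintegral => //; first exact: L1S.
  by apply: L1S => //; exact: L1_norm.
by move=> z _; exact: ler_norm.
Qed.

Lemma AC_primitive g : L1 g -> abs_cont (primitive g).
Proof.
move=> Lg; apply: (AC_dominated (L1_norm Lg)) => // x y; exact: norm_primitiveB.
Qed.

Lemma is_primitive_AC f g : is_primitive f g -> abs_cont f.
Proof.
move=> [/AC_primitive acg fE]; apply: (AC_dominated1 ler01 acg) => x y _.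
by rewrite mul1r fE (fE x) opprD addrACA subrr add0r.
Qed.

Lemma is_primitive_continuous f g : is_primitive f g -> continuous f.
Proof. by move=> /is_primitive_AC; exact: AC_continuous. Qed.

Lemma AC_measurable f : abs_cont f -> measurable_fun [set: measurableTypeR R] f.
Proof. by move=> acf; apply: continuous_measurable_fun => x; exact: AC_continuous. Qed.

Lemma is_primitive_primitive g : L1 g -> is_primitive (primitive g) g.
Proof. by move=> Lg; split=> // x; rewrite primitive0 add0r. Qed.

Lemma is_primitive_bounded f g : is_primitive f g -> exists2 B : R, 0 <= B & forall x, `|f x| <= B.
Proof.
move=> [Lg fE]; exists (`|f 0| + \int[mu]_t `|g t|).
  by rewrite addr_ge0// Rintegral_ge0.
move=> x; rewrite fE; apply: le_trans (ler_normD _ _) _; rewrite lerD2l.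
apply: le_trans (norm_primitive _ Lg) _; rewrite /primitive /Rintegral fine_le//.
- by apply: integrable_fin_num => //; apply: L1_itv; exact: L1_norm.
- by apply: integrable_fin_num => //; exact: L1_norm.
- apply: (ge0_subset_integral _ (mitv _)) => //.
  by have /integrableP[] := L1_norm Lg.
Qed.

Lemma primitive_derive g : L1 g ->
  {ae mu, forall x : R, 0 < x -> is_derive x 1 (primitive g) (g x)}.
Proof.
move=> Lg; have := @FTC1 R g (BLeft 0) _ _.
have H1 y : mu.-integrable [set` Interval (BLeft 0) (BRight y)] (EFin \o g) by exact: L1_itv.
have H2 : locally_integrable setT g.
  by apply: open_integrable_locally => //; exact: openT.
move=> /(_ H1 H2); apply: aeS => x /= H x0.
have [|d1 d2] := H; first by rewrite lte_fin.
by split; [exact: d1|rewrite -derive1E].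
Qed.

Lemma is_primitive_derive f g : is_primitive f g ->
  {ae mu, forall x : R, 0 < x -> is_derive x 1 f (g x)}.
Proof.
move=> [Lg fE]; have := primitive_derive Lg; apply: aeS => x /= H x0.
have -> : f = cst (f 0) + primitive g by apply/funext => z; rewrite fE.
by rewrite -[g x]add0r; apply: is_deriveD; exact: H.
Qed.

Lemma primitive_ae g h x : L1 g -> L1 h ->
  {ae mu, forall z : R, 0 < z < x -> g z = h z} -> primitive g x = primitive h x.
Proof.
move=> Lg Lh gh; rewrite /primitive /Rintegral.
have mo k : L1 k -> measurable_fun (`]0%R, x[%classic : set (measurableTypeR R)) (EFin \o k).
  by move=> Lk; have /integrableP[] := L1_itv `]0, x[ Lk.
have oo k : L1 k -> (\int[mu]_(z in `[0%R, x]) (k z)%:E = \int[mu]_(z in `]0%R, x[) (k z)%:E)%E.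
  by move=> /mo mk; exact: (integral_itv_bndoo true false mk).
rewrite oo// oo//; congr fine; apply: ae_eq_integral; [exact: mitv|exact: mo|exact: mo|].
move: gh; apply: aeS => z /= + z0; rewrite in_itv/= in z0.
by move=> /(_ z0) ->.
Qed.

(** The criterion through which products and exponentials of primitives are
    primitives: check absolute continuity, then differentiate almost
    everywhere. *)
Lemma abs_cont_is_primitive f g : abs_cont f -> L1 g -> (forall x, x <= 0 -> f x = f 0) ->
  {ae mu, forall x : R, 0 < x -> is_derive x 1 f (g x)} -> is_primitive f g.
Proof.
move=> acf Lg f0 fg; split=> // b; have [b0|/ltW b0] := lerP 0 b; last first.
  by rewrite f0// primitive_lt0// addr0.
have [gb [Lgb _ Hgb]] := AC_is_primitive b0 acf.
rewrite Hgb ?b0 ?lexx//; congr (_ + _); apply: primitive_ae => //.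
move: fg (primitive_derive Lgb); apply: aeS2 => x fg gg /andP[x0 xb].
have d1 := fg x0; have d2 := gg x0.
have d3 : is_derive x 1 f (gb x).
  have d4 : is_derive x 1 (cst (f 0) + primitive gb) (gb x).
    by rewrite -[gb x]add0r; apply: is_deriveD.
  apply: near_eq_is_derive d4.
  near=> z; rewrite (Hgb z)//; apply/andP; split; apply/ltW; near: z.
  - exact: lt_nbhsr.
  - exact: lt_nbhsl.
by rewrite -(derive_val (f := f) (df := gb x)) -(derive_val (f := f) (df := g x)).
Unshelve. all: by end_near. Qed.

Lemma L1D g h : L1 g -> L1 h -> L1 (fun x => g x + h x).
Proof. by move=> Lg Lh; exact: (integrableD _ Lg Lh). Qed.

Lemma L1_0 : L1 (cst (0 : R)).
Proof. exact: integrable0. Qed.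

Lemma L1Mbounded g h (B : R) : L1 g -> measurable_fun [set: measurableTypeR R] h ->
  (forall x, `|h x| <= B) -> L1 (fun x => h x * g x).
Proof.
move=> Lg mh hB; have B0 : 0 <= B by apply: le_trans (hB 0).
have LB : mu.-integrable setT (fun x => B%:E * (EFin \o g) x)%E by exact: integrableZl.
apply: (le_integrable _ _ _ LB) => //.
  by apply/measurable_EFinP; apply: measurable_funM => //; exact: L1_measurable.
move=> x _; rewrite -EFinM lee_fin !normrM [`|B|]ger0_norm//.
by rewrite ler_wpM2r.
Qed.

Lemma L1Z g (c : R) : L1 g -> L1 (fun x => c * g x).
Proof.
by move=> Lg; apply: (@L1Mbounded g (cst c) `|c|).
Qed.

Lemma le_L1 g h : measurable_fun [set: measurableTypeR R] g -> L1 h ->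
  (forall x, `|g x| <= h x) -> L1 g.
Proof.
move=> mg Lh gh; apply: (le_integrable _ _ _ Lh) => //; first exact/measurable_EFinP.
by move=> x _; rewrite lee_fin; apply: le_trans (gh x) _; exact: ler_norm.
Qed.

Lemma primitiveD g h x : L1 g -> L1 h ->
  primitive (fun x => g x + h x) x = primitive g x + primitive h x.
Proof. by move=> Lg Lh; rewrite /primitive RintegralD//; exact: L1_itv. Qed.

Lemma primitiveZ g (c x : R) : L1 g -> primitive (fun x => c * g x) x = c * primitive g x.
Proof. by move=> Lg; rewrite /primitive RintegralZl//; exact: L1_itv. Qed.

Lemma is_primitive_cst (c : R) : is_primitive (cst c) (cst 0).
Proof.
split; first exact: L1_0.
by move=> x; rewrite /primitive /Rintegral integral0 addr0.
Qed.

Lemma is_primitiveD f1 g1 f2 g2 : is_primitive f1 g1 -> is_primitive f2 g2 ->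
  is_primitive (fun x => f1 x + f2 x) (fun x => g1 x + g2 x).
Proof.
move=> [L1g f1E] [L2g f2E]; split; first exact: L1D.
move=> x; rewrite primitiveD// f1E f2E; ring.
Qed.

Lemma is_primitiveZ f g (c : R) : is_primitive f g ->
  is_primitive (fun x => c * f x) (fun x => c * g x).
Proof.
move=> [Lg fE]; split; first exact: L1Z.
by move=> x; rewrite primitiveZ// fE mulrDr.
Qed.

Lemma is_primitiveB f1 g1 f2 g2 : is_primitive f1 g1 -> is_primitive f2 g2 ->
  is_primitive (fun x => f1 x - f2 x) (fun x => g1 x - g2 x).
Proof.
move=> [L1g f1E] [L2g f2E]; split; first exact: L1B.
move=> x; rewrite primitiveB// f1E f2E; ring.
Qed.

Lemma is_primitive_sum (I : finType) (f g : I -> R -> R) :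
  (forall i, is_primitive (f i) (g i)) ->
  is_primitive (fun x => \sum_i f i x) (fun x => \sum_i g i x).
Proof.
move=> H; suff S (s : seq I) : is_primitive (fun x => \sum_(i <- s) f i x) (fun x => \sum_(i <- s) g i x).
  by have := S (index_enum I).
elim: s => [|i s IH].
  have -> : (fun x => \sum_(i <- [::]) f i x) = cst 0 by apply/funext => x; rewrite big_nil.
  have -> : (fun x => \sum_(i <- [::]) g i x) = cst 0 by apply/funext => x; rewrite big_nil.
  exact: is_primitive_cst.
have -> : (fun x => \sum_(i <- i :: s) f i x) = (fun x => f i x + \sum_(i <- s) f i x).
  by apply/funext => x; rewrite big_cons.
have -> : (fun x => \sum_(i <- i :: s) g i x) = (fun x => g i x + \sum_(i <- s) g i x).
  by apply/funext => x; rewrite big_cons.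
exact: is_primitiveD.
Qed.

Lemma is_primitive_measurable f g : is_primitive f g -> measurable_fun [set: measurableTypeR R] f.
Proof. by move/is_primitive_AC/AC_measurable. Qed.

Lemma is_primitive_le0 f g x : is_primitive f g -> x <= 0 -> f x = f 0.
Proof. by move=> [_ fE] x0; rewrite fE primitive_lt0// addr0. Qed.

Lemma AC_dominatedD f f1 f2 (C : R) : 0 <= C -> abs_cont f1 -> abs_cont f2 ->
  (forall x y, x <= y -> `|f y - f x| <= C * (`|f1 y - f1 x| + `|f2 y - f2 x|)) -> abs_cont f.
Proof.
move=> C0 ac1 ac2 fC e e0; have e1 : 0 < e / (2 * (C + 1)).
  by rewrite divr_gt0//; lra.
have [d1 d10 H1] := ac1 _ e1; have [d2 d20 H2] := ac2 _ e1.
exists (Num.min d1 d2); first by rewrite lt_min d10.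
move=> p sp; rewrite lt_min => /andP[p1 p2].
have {}H1 := H1 _ sp p1; have {}H2 := H2 _ sp p2.
apply: (@le_trans _ _ (C * (e / (2 * (C + 1)) + e / (2 * (C + 1))))).
  apply: le_trans (ler_wpM2l C0 (lerD H1 H2)); rewrite -big_split mulr_sumr/=.
  case/andP: sp => sp _; elim: p sp {p1 p2 H1 H2} => [|x p IH /= /andP[x12 xp]].
    by rewrite !big_nil.
  by rewrite !big_cons lerD ?IH// fC.
have -> : C * (e / (2 * (C + 1)) + e / (2 * (C + 1))) = e * (C / (C + 1)).
  by field; lra.
by rewrite ler_piMr ?(ltW e0)// ler_pdivrMr; lra.
Qed.

Lemma is_primitiveM f1 g1 f2 g2 : is_primitive f1 g1 -> is_primitive f2 g2 ->
  is_primitive (fun x => f1 x * f2 x) (fun x => f1 x * g2 x + f2 x * g1 x).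
Proof.
move=> p1 p2; have [B1 B10 fB1] := is_primitive_bounded p1.
have [B2 B20 fB2] := is_primitive_bounded p2.
apply: abs_cont_is_primitive.
- apply: (AC_dominatedD (C := B1 + B2) _ (is_primitive_AC p1) (is_primitive_AC p2)).
    by rewrite addr_ge0.
  move=> x y _.
  have -> : f1 y * f2 y - f1 x * f2 x = (f1 y - f1 x) * f2 y + f1 x * (f2 y - f2 x) by ring.
  apply: le_trans (ler_normD _ _) _; rewrite !normrM mulrDr; apply: lerD.
    by rewrite mulrC ler_wpM2r//; apply: le_trans (fB2 y) _; lra.
  by rewrite ler_wpM2r//; apply: le_trans (fB1 x) _; lra.
- apply: L1D; first exact: (L1Mbounded p2.1 (is_primitive_measurable p1) fB1).
  exact: (L1Mbounded p1.1 (is_primitive_measurable p2) fB2).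
- by move=> x x0; rewrite (is_primitive_le0 p1 x0) (is_primitive_le0 p2 x0).
- move: (is_primitive_derive p1) (is_primitive_derive p2); apply: aeS2 => x h1 h2 x0.
  have {}h1 := h1 x0; have {}h2 := h2 x0; exact: is_deriveM.
Qed.

Lemma expR_lip (B x y : R) : `|x| <= B -> `|y| <= B ->
  `|expR y - expR x| <= expR B * `|y - x|.
Proof.
suff H (a b : R) : `|a| <= B -> `|b| <= B -> expR b - expR a <= expR B * `|b - a|.
  move=> xB yB; rewrite ler_norml lerNl opprB H//= distrC H//.
move=> aB bB; have [ab|ba] := lerP b a.
  by apply: (@le_trans _ _ 0); rewrite ?subr_le0 ?ler_expR// mulr_ge0 ?expR_ge0 ?subr_ge0.
have -> : expR b - expR a = expR b * (1 - expR (a - b)).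
  by rewrite mulrBr mulr1 -expRD [b + _]addrC subrK.
apply: (@le_trans _ _ (expR b * (b - a))).
  by rewrite ler_wpM2l ?expR_ge0//; have := expR_ge1Dx (a - b); lra.
rewrite ler_wpM2r ?subr_ge0 ?(ltW ba)// ler_expR.
by apply: le_trans bB; exact: ler_norm.
Qed.

Lemma is_primitive_expR f g : is_primitive f g ->
  is_primitive (fun x => expR (f x)) (fun x => expR (f x) * g x).
Proof.
move=> p; have [B B0 fB] := is_primitive_bounded p.
have acE : abs_cont (fun x => expR (f x)).
  apply: (AC_dominated1 (C := expR B) _ (is_primitive_AC p)); first exact: expR_ge0.
  by move=> x y _; exact: expR_lip.
apply: abs_cont_is_primitive => //.
- apply: (L1Mbounded (B := expR B) p.1); first exact: AC_measurable.
  move=> x; rewrite ger0_norm ?expR_ge0// ler_expR; apply: le_trans (fB x); exact: ler_norm.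
- by move=> x x0; rewrite (is_primitive_le0 p x0).
- move: (is_primitive_derive p); apply: aeS => x h1 x0; have {}h1 := h1 x0.
  exact: (@is_derive1_comp _ expR f x _ _ (is_derive_expR _) h1).
Qed.

Lemma is_primitive_unique f g h : is_primitive f g -> is_primitive f h ->
  {ae mu, forall x : R, 0 < x -> g x = h x}.
Proof.
move=> p q; move: (is_primitive_derive p) (is_primitive_derive q).
apply: aeS2 => x h1 h2 x0; have d1 := h1 x0; have d2 := h2 x0.
by rewrite -(derive_val (f := f) (df := g x)) -(derive_val (f := f) (df := h x)).
Qed.

Lemma is_primitive_const f g : is_primitive f g ->
  {ae mu, forall x : R, 0 < x -> g x = 0} -> forall x, f x = f 0.
Proof.
move=> [Lg fE] g0 x; rewrite fE (primitive_ae (h := cst 0)) ?L1_0//.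
  by rewrite /primitive /Rintegral integral0 addr0.
by move: g0; apply: aeS => z H /andP[/H].
Qed.

Section weights.
Variables (n : R -> R) (lam : R).
Hypotheses (Ln : L1 n) (n0 : forall z, 0 <= n z) (lam0 : 0 < lam).
Local Notation N := (primitive n).

(** The integrand is the derivative of [expR (lam * N)] up to the factor
    [lam]. The gain [1 / lam] is what makes Picard iteration a contraction. *)
Lemma primitive_weight x :
  primitive (fun z => expR (lam * N z) * n z) x <= expR (lam * N x) / lam.
Proof.
have p := is_primitive_expR (is_primitiveZ lam (is_primitive_primitive Ln)).
have [Lp pE] := p; have := pE x; rewrite primitive0 mulr0 expR0.
have -> : (fun x => expR (lam * N x) * (lam * n x)) =
          (fun x => lam * (expR (lam * N x) * n x)) by apply/funext => z; ring.
rewrite primitiveZ; last first.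
  have := L1Z lam^-1 Lp; congr (L1 _); apply/funext => z; field; exact: lt0r_neq0.
move=> ->; rewrite ler_pdivlMr// mulrC; lra.
Qed.

(** Integration by parts: differentiating the weight multiplies it by
    [- lam * n]. A Volterra operator with weight [n] thus has norm at most
    [1 / lam] on the weighted [L1] space. *)
Lemma primitive_decay k x : L1 k -> (forall z, 0 <= k z) ->
  primitive (fun z => expR (- (lam * N z)) * (n z * primitive k z)) x <=
  lam^-1 * primitive (fun z => expR (- (lam * N z)) * k z) x.
Proof.
move=> Lk k0.
have pn := is_primitiveZ (- lam) (is_primitive_primitive Ln).
have pe := is_primitive_expR pn; have pk := is_primitive_primitive Lk.
have pp := is_primitiveM pk pe.
have [B B0 HB] := is_primitive_bounded pe; have [K K0 HK] := is_primitive_bounded pk.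
have E z : expR (- (lam * N z)) = expR (- lam * N z) by rewrite mulNr.
have La : L1 (fun z => expR (- (lam * N z)) * (n z * primitive k z)).
  have := L1Mbounded (L1Mbounded Ln (is_primitive_measurable pk) HK) (is_primitive_measurable pe) HB.
  by congr (L1 _); apply/funext => z; rewrite E; ring.
have Lb : L1 (fun z => expR (- (lam * N z)) * k z).
  have := L1Mbounded Lk (is_primitive_measurable pe) HB.
  by congr (L1 _); apply/funext => z; rewrite E.
have [_ /(_ x)] := pp; rewrite primitive0 mul0r add0r.
have -> : (fun x0 : R => primitive k x0 * (expR (- lam * N x0) * (- lam * n x0)) +
      expR (- lam * N x0) * k x0) = (fun z => expR (- (lam * N z)) * k z -
      lam * (expR (- (lam * N z)) * (n z * primitive k z))).
  by apply/funext => z; rewrite E; ring.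
rewrite primitiveB//; last exact: L1Z.
rewrite primitiveZ// => eq.
have : 0 <= primitive k x * expR (- lam * N x) by rewrite mulr_ge0 ?primitive_ge0 ?expR_ge0.
rewrite eq subr_ge0 => le; rewrite -(ler_pM2l lam0) mulVKf//; exact: lt0r_neq0.
Qed.

End weights.

End primitives.

(** * Integrable kernels on the plane *)

Section kernels.
Context {R : realType}.
Implicit Types (G : R -> R -> R).
Local Notation mu := (@lebesgue_measure R).
Local Notation T := (measurableTypeR R).

Definition measurable2 G := measurable_fun [set: (T * T)%type] (fun p => G p.1 p.2).

(** Being integrable on the plane leaves a null set of bad sections; asking
    integrability of every section frees the calculus of sections from
    exceptional sets. Each integrable function agrees almost everywhere with
    such a kernel (see [kernel2_of_integrable]). *)
Record kernel2 G : Prop := {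
  kernel2_measurable : measurable2 G ;
  kernel2_integrable : (leb2 R).-integrable [set: (T * T)%type] (fun p => (G p.1 p.2)%:E) ;
  kernel2_L1r : forall u, L1 (G u) ;
  kernel2_L1l : forall v, L1 (fun u => G u v) }.

Lemma measurable2_comp d (X : measurableType d) G (f g : X -> T) :
  measurable2 G -> measurable_fun setT f -> measurable_fun setT g ->
  measurable_fun setT (fun x => G (f x) (g x)).
Proof.
move=> mG mf mg.
exact: (measurableT_comp mG (measurable_fun_pair mf mg)).
Qed.

Lemma measurable2_section1 G v : measurable2 G -> measurable_fun [set: T] (fun u => G u v).
Proof. by move=> mG; apply: (measurable2_comp mG). Qed.

Lemma measurable2_section2 G u : measurable2 G -> measurable_fun [set: T] (G u).
Proof. by move=> mG; apply: (measurable2_comp mG). Qed.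

Lemma measurable2_swap G : measurable2 G -> measurable2 (fun v u => G u v).
Proof.
move=> mG; apply: (measurable2_comp mG); [exact: measurable_snd|exact: measurable_fst].
Qed.

(** With an indicator in the integrand, a primitive becomes an integral over
    a fixed domain, to which the theorems of Fubini and Tonelli apply. *)
Definition itv_ind (v z : R) : R := if (0 <= z) && (z <= v) then 1 else 0.

Lemma primitive_itv_ind g v : primitive g v = \int[mu]_z (g z * itv_ind v z).
Proof.
rewrite /primitive Rintegral_mkcond; congr (fine _); apply: eq_integral => z _.
rewrite /itv_ind patchE; congr (_%:E).
have -> : (z \in (`[0, v]%classic : set T)) = (0 <= z) && (z <= v).
  by apply/idP/idP; rewrite inE/= in_itv.
by case: ifP; rewrite ?mulr1 ?mulr0.
Qed.

Lemma measurable_itv_ind d (X : measurableType d) (f g : X -> T) :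
  measurable_fun setT f -> measurable_fun setT g ->
  measurable_fun setT (fun x => itv_ind (f x) (g x)).
Proof.
move=> mf mg; apply: measurable_fun_ifT => //.
by apply: measurable_and; apply: measurable_fun_ler.
Qed.

Lemma measurable_primitive d (X : measurableType d) (H : X -> T -> R) (f : X -> T) :
  measurable_fun [set: (X * T)%type] (fun q => H q.1 q.2) -> measurable_fun setT f ->
  measurable_fun setT (fun x => primitive (H x) (f x)).
Proof.
move=> mH mf; pose k (q : X * T) : \bar R := (H q.1 q.2 * itv_ind (f q.1) q.2)%:E.
have mk : measurable_fun setT k.
  apply/measurable_EFinP; apply: measurable_funM => //; apply: measurable_itv_ind => //.
  by apply: measurableT_comp.
have -> : (fun x => primitive (H x) (f x)) =
    fine \o (fun x => \int[mu]_z k^\+ (x, z) - \int[mu]_z k^\- (x, z))%E.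
  apply/funext => x; rewrite primitive_itv_ind /Rintegral integralE/=; congr (fine (_ - _)%E);
    by apply: eq_integral => z _; rewrite ?funeposE ?funenegE.
apply: measurableT_comp => //; apply: emeasurable_funB.
- apply: (measurable_fun_fubini_tonelli_F (m2 := mu) (k^\+)%E) => //.
  exact: measurable_funepos.
- apply: (measurable_fun_fubini_tonelli_F (m2 := mu) (k^\-)%E) => //.
  exact: measurable_funeneg.
Qed.

Lemma measurable2_primitive G : measurable2 G -> measurable2 (fun u v => primitive (G u) v).
Proof.
move=> mG; apply: (@measurable_primitive _ (T * T)%type (fun p => G p.1)) => //.
apply: (measurable2_comp mG) => //.
exact: (measurableT_comp measurable_fst measurable_fst).
Qed.

Lemma kernel2_Mbounded G (h : R -> R -> R) (B : R) : kernel2 G -> measurable2 h ->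
  (forall u v, `|h u v| <= B) -> kernel2 (fun u v => h u v * G u v).
Proof.
move=> [mG iG rG lG] mh hB; have B0 : 0 <= B by apply: le_trans (hB 0 0).
have mhG : measurable2 (fun u v => h u v * G u v) by apply: measurable_funM.
split => //.
- have iB : (leb2 R).-integrable setT (fun p => B%:E * (G p.1 p.2)%:E)%E by exact: integrableZl.
  apply: (le_integrable _ _ _ iB) => //; first exact/measurable_EFinP.
  move=> p _; rewrite -EFinM lee_fin !normrM [`|B|]ger0_norm// ler_wpM2r//.
- move=> u; apply: (L1Mbounded (B := B)) => //; exact: measurable2_section2.
- move=> v; apply: (L1Mbounded (g := G^~ v) (h := h^~ v) (B := B)) => //.
  exact: measurable2_section1.
Qed.

Lemma L1_fin g : L1 g -> (\int[mu]_z (g z)%:E \is a fin_num)%E.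
Proof. by move=> Lg; exact: integrable_fin_num Lg. Qed.

Lemma kernel2_L1_int G : kernel2 G -> L1 (fun u => \int[mu]_z G u z).
Proof.
move=> kG; have := integrable_fubini_F (kernel2_integrable kG).
apply: eq_integrable => // u _; rewrite /= /fubini_F/= /Rintegral fineK//.
exact: L1_fin (kernel2_L1r kG u).
Qed.

Lemma kernel2_Fubini G : kernel2 G ->
  \int[mu]_u \int[mu]_v G u v = \int[mu]_v \int[mu]_u G u v.
Proof.
move=> kG; have FE := Fubini (kernel2_integrable kG); rewrite {1 3}/Rintegral; congr fine.
transitivity (\int[mu]_u \int[mu]_v (G u v)%:E)%E.
  apply: eq_integral => u _; rewrite /Rintegral fineK//.
  exact: L1_fin (kernel2_L1r kG u).
rewrite [LHS]FE; apply: eq_integral => v _; rewrite /Rintegral fineK//.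
exact: L1_fin (kernel2_L1l kG v).
Qed.

Lemma norm_itv_ind v z : `|itv_ind v z| <= 1.
Proof. by rewrite /itv_ind; case: ifP; rewrite ?normr1 ?normr0. Qed.

Lemma measurable2_itv_ind1 u : measurable2 (fun w _ => itv_ind u w).
Proof. by apply: measurable_itv_ind => //; exact: measurable_fst. Qed.

Lemma measurable2_itv_ind2 v : measurable2 (fun _ z => itv_ind v z).
Proof. by apply: measurable_itv_ind => //; exact: measurable_snd. Qed.

Lemma kernel2_primitive_L1 G v : kernel2 G -> L1 (fun u => primitive (G u) v).
Proof.
move=> kG.
have := kernel2_L1_int (kernel2_Mbounded kG (measurable2_itv_ind2 v) (fun _ => norm_itv_ind v)).
congr (L1 _); apply/funext => u; rewrite primitive_itv_ind; congr (fine _).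
by apply: eq_integral => z _; rewrite mulrC.
Qed.

Lemma kernel2_swap G : kernel2 G -> kernel2 (fun v u => G u v).
Proof.
move=> [mG iG rG lG]; have mS := measurable2_swap mG; split => //.
apply/integrable21ltyP => /=; first exact/measurable_EFinP.
have mE : measurable_fun setT (fun p : T * T => (G p.1 p.2)%:E) by exact/measurable_EFinP.
by have [/(_ iG)] := @integrable12ltyP _ _ _ _ _ mu mu _ mE.
Qed.

Lemma kernel2_primitive_L1' G u : kernel2 G -> L1 (fun v => primitive (fun w => G w v) u).
Proof. by move=> kG; exact: kernel2_primitive_L1 (kernel2_swap kG). Qed.

Definition primitive2 G u v := primitive (fun w => primitive (G w) v) u.

Lemma primitive2_swap G u v : kernel2 G ->
  primitive2 G u v = primitive2 (fun z w => G w z) v u.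
Proof.
move=> kG; rewrite /primitive2 !primitive_itv_ind.
have := kernel2_Fubini (kernel2_Mbounded (kernel2_Mbounded kG (measurable2_itv_ind2 v)
  (fun _ => norm_itv_ind v)) (measurable2_itv_ind1 u) (fun w _ => norm_itv_ind u w)).
move=> H; transitivity (\int[mu]_u0 \int[mu]_v0 (itv_ind u u0 * (itv_ind v v0 * G u0 v0))).
  congr (fine _); apply: eq_integral => w _; congr (_%:E).
  rewrite primitive_itv_ind RintegralZl//; last first.
    apply: (L1Mbounded (B := 1) (h := itv_ind v) (kernel2_L1r kG w)); last exact: norm_itv_ind.
    exact: measurable_itv_ind.
  by rewrite mulrC; congr (_ * _); congr (fine _); apply: eq_integral => z _; rewrite mulrC.
rewrite H; congr (fine _); apply: eq_integral => z _; congr (_%:E).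
rewrite primitive_itv_ind -RintegralZr//; last first.
  under eq_fun do rewrite mulrC.
  apply: (L1Mbounded (B := 1) (h := itv_ind u) (kernel2_L1l kG z)); last exact: norm_itv_ind.
  exact: measurable_itv_ind.
by congr (fine _); apply: eq_integral => w _; congr (_%:E); ring.
Qed.

End kernels.

(** * Differentiating iterated primitives *)

Section derivatives.
Context {R : realType}.
Implicit Types (f g k : R -> R).

Lemma is_deriveP f (x l : R) : is_derive x 1 f l <->
  forall e : R, 0 < e -> exists2 dl : R, 0 < dl &
    forall h, `|h| < dl -> `|f (x + h) - f x - h * l| <= e * `|h|.
Proof.
pose q h := h^-1 *: ((f \o shift x) (h *: 1) - f x).
have qE h : h != 0 -> l - q h = - h^-1 * (f (x + h) - f x - h * l).
  by move=> h0; rewrite /q /= [h *: 1]mulr1 /GRing.scale/= [h + x]addrC; field.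
split=> [[df dl] e e0|H].
  have : q h @[h --> 0^'] --> l by rewrite -dl.
  move=> /cvgrPdist_le/(_ _ e0)[d /= d0 H]; exists d => // h hd.
  have [->|h0] := eqVneq h 0; first by rewrite addr0 mul0r !subrr normr0 mulr0.
  have := H h; rewrite /= sub0r normrN => /(_ hd h0); rewrite qE//.
  by rewrite normrM normrN normfV mulrC ler_pdivrMr// normr_gt0.
have cv : q h @[h --> 0^'] --> l.
  apply/cvgrPdist_le => e /H[d d0 {}H]; exists d => // h /=.
  rewrite sub0r normrN => hd h0; rewrite qE//.
  by rewrite normrM normrN normfV mulrC ler_pdivrMr ?normr_gt0// H.
split; first by apply/cvg_ex; exists l.
exact/cvg_lim.
Qed.

(** A function squeezed between approximants with nearly the right
    derivative has that derivative: [g] approximates [f], and [k] bounds the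
    increments of the error. *)
Lemma is_derive_approx f (x l : R) :
  (forall e, 0 < e -> exists g k a b, [/\ is_derive x 1 g a, is_derive x 1 k b,
    `|a - l| <= e, `|b| <= e &
    forall y, `|(f y - g y) - (f x - g x)| <= `|k y - k x|]) -> is_derive x 1 f l.
Proof.
move=> H; apply/is_deriveP => e e0.
have e4 : 0 < e / 4 by rewrite divr_gt0.
have [g [k [a [b [/is_deriveP dg /is_deriveP dk al be fg]]]]] := H _ e4.
have [d1 d10 {}dg] := dg _ e4; have [d2 d20 {}dk] := dk _ e4.
exists (Num.min d1 d2); first by rewrite lt_min d10.
move=> h; rewrite lt_min => /andP[h1 h2].
have {}dg := dg _ h1; have {}dk := dk _ h2; have {}fg := fg (x + h).
have kk : `|k (x + h) - k x| <= 2 * (e / 4) * `|h|.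
  have -> : k (x + h) - k x = (k (x + h) - k x - h * b) + h * b by ring.
  apply: le_trans (ler_normD _ _) _; rewrite normrM.
  have : `|h| * `|b| <= `|h| * (e / 4) by rewrite ler_wpM2l.
  lra.
have -> : f (x + h) - f x - h * l = ((f (x + h) - g (x + h)) - (f x - g x))
    + (g (x + h) - g x - h * a) + h * (a - l) by ring.
apply: le_trans (ler_normD _ _) _; apply: le_trans (lerD (ler_normD _ _) (lexx _)) _.
rewrite normrM; have : `|h| * `|a - l| <= `|h| * (e / 4) by rewrite ler_wpM2l.
lra.
Qed.

End derivatives.

Section null_sets.
Context {R : realType}.
Local Notation mu := (@lebesgue_measure R).
Local Notation T := (measurableTypeR R).

Lemma leb2_xsection (S : set (T * T)) : measurable S ->
  leb2 R S = (\int[mu]_x mu (xsection S x))%E.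
Proof. by []. Qed.

Lemma leb2_ysection (S : set (T * T)) : measurable S ->
  leb2 R S = (\int[mu]_y mu (ysection S y))%E.
Proof.
move=> mS; have := indic_fubini_tonelli mu mu mS.
by rewrite indic_fubini_tonelli_FE// indic_fubini_tonelli_GE.
Qed.

Lemma leb2_null_xsection (S : set (T * T)) : measurable S ->
  (forall x, mu (xsection S x) = 0) -> leb2 R S = 0.
Proof.
by move=> mS S0; rewrite leb2_xsection// integral0_eq.
Qed.

Lemma leb2_null_ysection (S : set (T * T)) : measurable S ->
  (forall y, mu (ysection S y) = 0) -> leb2 R S = 0.
Proof.
by move=> mS S0; rewrite leb2_ysection// integral0_eq.
Qed.

Lemma ae_fst (P : T -> Prop) : {ae mu, forall x, P x} -> {ae leb2 R, forall p, P p.1}.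
Proof.
move=> [N [mN N0 PN]]; exists (fst @^-1` N); split.
- by rewrite -[X in measurable X]setTI; apply: measurable_fst.
- apply: leb2_null_ysection.
    by rewrite -[X in measurable X]setTI; apply: measurable_fst.
  move=> y; rewrite -[RHS]N0; congr (mu _); apply/seteqP; split => x.
    by rewrite /ysection/= inE.
  by rewrite /ysection/= inE.
- by move=> p /= /PN.
Qed.

Lemma ae_snd (P : T -> Prop) : {ae mu, forall x, P x} -> {ae leb2 R, forall p, P p.2}.
Proof.
move=> [N [mN N0 PN]]; exists (snd @^-1` N); split.
- by rewrite -[X in measurable X]setTI; apply: measurable_snd.
- apply: leb2_null_xsection.
    by rewrite -[X in measurable X]setTI; apply: measurable_snd.
  move=> y; rewrite -[RHS]N0; congr (mu _); apply/seteqP; split => x.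
    by rewrite /xsection/= inE.
  by rewrite /xsection/= inE.
- by move=> p /= /PN.
Qed.

Lemma ae_xsection (P : T * T -> Prop) : {ae leb2 R, forall p, P p} ->
  {ae mu, forall x, {ae mu, forall y, P (x, y)}}.
Proof.
move=> [N [mN N0 PN]].
have : ae_eq mu setT (fun x => mu (xsection N x)) (cst 0%E).
  apply/ae_eq_integral_abs => //; first exact: measurable_fun_xsection.
  under eq_integral do rewrite gee0_abs//.
  by rewrite -leb2_xsection.
apply: aeS => x /(_ Logic.I)/= Nx; exists (xsection N x); split => //.
  exact: measurable_xsection.
by move=> y /= /PN; rewrite /xsection/= inE.
Qed.

End null_sets.

Section differentiation.
Context {R : realType}.
Implicit Types (G : R -> R -> R).
Local Notation mu := (@lebesgue_measure R).
Local Notation T := (measurableTypeR R).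

Lemma kernel2_norm G : kernel2 G -> kernel2 (fun u v => `|G u v|).
Proof.
move=> [mG iG rG lG]; split.
- by apply: measurableT_comp.
- exact: (integrable_norm iG).
- by move=> u; exact: L1_norm.
- by move=> v; exact: (L1_norm (lG v)).
Qed.

Lemma primitive_incr_le (g k : R -> R) x y : L1 g -> L1 k -> (forall z, `|g z| <= k z) ->
  `|primitive g y - primitive g x| <= `|primitive k y - primitive k x|.
Proof.
move=> Lg Lk gk; have k0 z : 0 <= k z by apply: le_trans (gk z).
wlog xy : x y / x <= y.
  by move=> H; have [xy|/ltW yx] := lerP x y; [|rewrite distrC [leRHS]distrC]; exact: H.
rewrite [leRHS]ger0_norm ?subr_ge0 ?primitive_nd//.
apply: le_trans (norm_primitiveB Lg xy) _.
have Ln := L1_norm Lg; have [x0|/ltW x0] := lerP 0 x; last first.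
  by rewrite !(primitive_lt0 _ x0) !subr0 le_primitive.
rewrite !primitiveBE//; apply: le_Rintegral; [exact: mitv|exact: L1_itv|exact: L1_itv|].
by move=> z _.
Qed.

Lemma rat_between (a b : R) : a < b -> exists n : nat,
  a < ratr (odflt 0 (unpickle n) : rat) < b.
Proof.
move=> /rat_in_itvoo[q]; rewrite in_itv/= => qab.
by exists (pickle q); rewrite pickleK.
Qed.

Lemma natSinv_lt (e : R) : 0 < e -> exists i : nat, i.+1%:R^-1 < e.
Proof.
move=> e0; exists (Num.bound e^-1); rewrite invf_plt ?posrE//.
have := @archi_boundP _ e^-1; rewrite invr_ge0 (ltW e0) => /(_ isT)/lt_le_trans; apply.
by rewrite ler_nat.
Qed.

Lemma measurable_set_bool d (X : measurableType d) (b : X -> bool) :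
  measurable_fun setT b -> measurable [set x | b x].
Proof.
move=> mb; have := mb measurableT [set true] Logic.I.
by rewrite setTI.
Qed.

(** Almost every [u] is a point of differentiability for the countably many
    rational values of [v]. Between rationals [r] and [r'] surrounding [v]
    the error made in replacing [v] by [r] is the primitive of the section
    integrals of [`|G|] over [[r, r']], whose derivative at [u] is small.
    Hence one null set of [u] serves all [v] at once, in particular an upper
    boundary point. *)
Lemma primitive2_derive G : kernel2 G ->
  {ae mu, forall u : R, 0 < u -> forall v,
    is_derive u 1 (fun w => primitive2 G w v) (primitive (G u) v)}.
Proof.
move=> kG; have kn := kernel2_norm kG.
pose r n : R := ratr (odflt 0 (unpickle n) : rat).
have H1 n := primitive_derive (kernel2_primitive_L1 (r n) kG).
have H2 n := primitive_derive (kernel2_primitive_L1 (r n) kn).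
move: (ae_foralln H1) (ae_foralln H2); apply: aeS2 => u {H1}H1 {H2}H2 u0 v.
have {}H1 n := H1 n u0; have {}H2 n := H2 n u0.
have [v0|v0] := lerP v 0.
  rewrite (primitive_lt0 (G u) v0).
  have -> : (fun w => primitive2 G w v) = cst 0; last exact: is_derive_cst.
  apply/funext => w; rewrite /primitive2.
  have -> : (fun x => primitive (G x) v) = cst 0.
    by apply/funext => x; rewrite primitive_lt0.
  by rewrite /primitive /Rintegral integral0.
apply: is_derive_approx => e e0.
have Lu := kernel2_L1r kn u.
have /cvgrPdist_le/(_ (e / 2)) [|d /= d0 Hd] := @is_primitive_continuous _ _ _ (is_primitive_primitive Lu) v.
  by rewrite divr_gt0.
have [m /andP[m1 m2]] : exists m, Num.max 0 (v - d) < r m < v.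
  by apply: rat_between; rewrite gt_max v0/= ltrBlDr ltrDl.
have [n /andP[n1 n2]] : exists n, v < r n < v + d.
  by apply: rat_between; rewrite ltrDl.
rewrite gt_max in m1; case/andP: m1 => m0 m1.
have Km : primitive (fun z => `|G u z|) v - primitive (fun z => `|G u z|) (r m) <= e / 2.
  apply: le_trans (ler_norm _) _; apply: Hd; rewrite /ball_/= gtr0_norm ?subr_gt0//; lra.
have Kn : primitive (fun z => `|G u z|) (r n) - primitive (fun z => `|G u z|) v <= e / 2.
  apply: le_trans (ler_norm _) _; rewrite distrC; apply: Hd.
  rewrite /ball_/= ltr0_norm ?subr_lt0//; lra.
have mono x y : x <= y -> primitive (fun z => `|G u z|) x <= primitive (fun z => `|G u z|) y.
  by apply: primitive_nd.
exists (fun w => primitive2 G w (r m)), 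
  (fun w => primitive2 (fun u v => `|G u v|) w (r n) - primitive2 (fun u v => `|G u v|) w (r m)),
  (primitive (G u) (r m)),
  (primitive (fun z => `|G u z|) (r n) - primitive (fun z => `|G u z|) (r m)); split.
- exact: H1.
- by apply: is_deriveB; exact: H2.
- rewrite distrC; apply: le_trans (norm_primitiveB (kernel2_L1r kG u) (ltW m2)) _.
  have := mono _ _ (ltW n1); lra.
- rewrite ger0_norm; first lra.
  by rewrite subr_ge0 mono// ltW// (lt_trans m2).
- move=> y; rewrite /primitive2.
  have L w := kernel2_primitive_L1 w kG; have L' w := kernel2_primitive_L1 w kn.
  rewrite -(primitiveB y (L v) (L (r m))) -(primitiveB u (L v) (L (r m))).
  rewrite -(primitiveB y (L' (r n)) (L' (r m))) -(primitiveB u (L' (r n)) (L' (r m))).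
  apply: primitive_incr_le; [exact: L1B (L _) (L _)|exact: L1B (L' _) (L' _)|].
  move=> z; apply: le_trans (norm_primitiveB (kernel2_L1r kG z) (ltW m2)) _.
  by rewrite lerD2r primitive_nd// ?(ltW n1)//; exact: kernel2_L1r kn z.
Qed.

(** On each line this is Lebesgue differentiation; what has to be shown is
    that the exceptional set is measurable in the plane, so that Fubini
    makes it null. By continuity of the primitive, differentiability can be
    tested on rational increments only. *)
Lemma primitive_section_derive G : kernel2 G ->
  {ae leb2 R, forall p : R * R, 0 < p.1 ->
    is_derive p.1 1 (primitive (fun x => G x p.2)) (G p.1 p.2)}.
Proof.
move=> kG; have mG := kernel2_measurable kG.
pose F u v := primitive (fun x => G x v) u.
have mF : measurable2 F.
  exact: measurable2_swap (measurable2_primitive (measurable2_swap mG)).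
pose r n : R := ratr (odflt 0 (unpickle n) : rat).
pose A j i n : set (T * T) := [set p | `|r n| < i.+1%:R^-1 ->
  `|F (p.1 + r n) p.2 - F p.1 p.2 - r n * G p.1 p.2| <= j.+1%:R^-1 * `|r n|].
have mA j i n : measurable (A j i n).
  have [ri|ri] := ltP `|r n| i.+1%:R^-1; last first.
    have -> : A j i n = setT by apply/seteqP; split => // p _; rewrite /A/= ltNge ri.
    exact: measurableT.
  have -> : A j i n = [set p |
      `|F (p.1 + r n) p.2 - F p.1 p.2 - r n * G p.1 p.2| <= j.+1%:R^-1 * `|r n|].
    by apply/seteqP; split => p; rewrite /A/= ri => // /(_ isT).
  apply: measurable_set_bool; apply: measurable_fun_ler => //.
  apply: measurableT_comp => //; apply: measurable_funB; last first.
    by apply: measurable_funM.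
  apply: measurable_funB => //.
  apply: (measurable2_comp mF) => //; apply: measurable_funD => //.
pose S : set (T * T) := [set p | 0 < p.1] `&` ~` \bigcap_j \bigcup_i \bigcap_n A j i n.
have mS : measurable S.
  apply: measurableI.
    by apply: measurable_set_bool; apply: measurable_fun_ltr.
  by apply: measurableC; apply: bigcapT_measurable => j; apply: bigcupT_measurable => i; exact: bigcapT_measurable.
exists S; split => //.
  apply: leb2_null_ysection => // v; apply/negligibleP; first exact: measurable_ysection.
  have [N [mN N0 HN]] := primitive_derive (kernel2_L1l kG v).
  exists N; split => // u; rewrite /ysection/= inE => -[/= u0 nA]; apply: HN => /=.
  move=> /(_ u0) /is_deriveP H; apply: nA => j _.
  have [|d d0 {}H] := H j.+1%:R^-1; first by rewrite invr_gt0.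
  have [i di] := natSinv_lt d0.
  exists i => // n _ rn; apply: H; exact: lt_trans di.
move=> p; apply: contra_notP => pS p0; apply/is_deriveP => e e0.
have {pS} pA : (\bigcap_j \bigcup_i \bigcap_n A j i n) p.
  by apply: contra_notP pS.
have [j je] := natSinv_lt e0.
have [i _ Hi] := pA j Logic.I.
exists i.+1%:R^-1; first by rewrite invr_gt0.
move=> h hi; rewrite leNgt; apply/negP => hh.
(* the set of bad increments is open, so it contains a rational *)
have cF : continuous (F ^~ p.2).
  exact: is_primitive_continuous (is_primitive_primitive (kernel2_L1l kG p.2)).
pose ph z := `|F (p.1 + z) p.2 - F p.1 p.2 - z * G p.1 p.2| - e * `|z|.
have cph : continuous ph.
  move=> z; apply: cvgB; last by apply: cvgMr; exact: cvg_norm.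
  apply: cvg_norm; apply: cvgB; last by apply: cvgMl; exact: cvg_id.
  apply: cvgB; last exact: cvg_cst.
  apply: (@cvg_comp _ _ _ (fun z => p.1 + z) (F ^~ p.2) _ (nbhs (p.1 + z))); last exact: cF.
  by apply: cvgD; [exact: cvg_cst|exact: cvg_id].
have ph0 : 0 < ph h by rewrite subr_gt0.
have [d /= d0 Hd] : \forall z \near h, 0 < ph z /\ `|z| < i.+1%:R^-1.
  near=> z; split; near: z.
  - exact: (cvgr_gt (ph h)) (cph h) _ ph0.
  - exact: (cvgr_lt `|h|) (@norm_continuous _ _ h) _ hi.
have [n /andP[n1 n2]] : exists n, h - d < r n < h + d by apply: rat_between; lra.
have [|pn rn] := Hd (r n).
  by rewrite /ball_/= ltr_norml; apply/andP; split; lra.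
have := Hi n Logic.I rn; move: pn; rewrite /ph subr_gt0 => h1 h2.
have := lt_le_trans h1 h2; rewrite ltNge ler_wpM2r// ltW//.
Unshelve. all: by end_near. Qed.

End differentiation.

(** * Representatives of integrable functions *)

Section normalization.
Context {R : realType}.
Implicit Types (G : R -> R -> R).
Local Notation mu := (@lebesgue_measure R).
Local Notation T := (measurableTypeR R).

Lemma measurable_rect (u0 v0 : R) : measurable (rect u0 v0 : set (T * T)).
Proof. by apply: measurableX; exact: mitv. Qed.

Definition finite_slice (g : T * T -> R) : set T :=
  [set u | (\int[mu]_v `|g (u, v)|%:E < +oo)%E].

Lemma measurable_finite_slice (g : T * T -> R) : measurable_fun setT g -> measurable (finite_slice g).
Proof.
move=> mg; have mF : measurable_fun setT (fun u : T => \int[mu]_v `|g (u, v)|%:E)%E.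
  apply: (measurable_fun_fubini_tonelli_F (m2 := mu) (fun p : T * T => `|g p|%:E)) => //.
  by apply/measurable_EFinP; exact: measurableT_comp.
rewrite -[X in measurable X]setTI.
exact: emeasurable_fun_infty_o.
Qed.

Lemma ae_finite_slice (g : T * T -> R) : (leb2 R).-integrable setT (EFin \o g) ->
  {ae mu, forall u, finite_slice g u}.
Proof.
move=> /ae_integrable1; apply: aeS => u /integrableP[_].
by under eq_integral do rewrite /=.
Qed.

(** Set the function to zero on the null set of lines where its section is
    not integrable. *)
Lemma kernel2_of_integrable (g : T * T -> R) : (leb2 R).-integrable setT (EFin \o g) ->
  exists2 G, kernel2 G &
    (forall u v, g (u, v) = 0 -> G u v = 0) /\ {ae leb2 R, forall p : R * R, g p = G p.1 p.2}.
Proof.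
move=> ig; have mg : measurable_fun setT g by have /integrableP[/measurable_EFinP] := ig.
pose gs (p : T * T) := g (p.2, p.1).
have mgs : measurable_fun setT gs.
  by apply: (measurableT_comp mg); exact: measurable_swap.
have igs : (leb2 R).-integrable setT (EFin \o gs).
  apply/integrable21ltyP => /=; first exact/measurable_EFinP.
  have mE : measurable_fun setT (EFin \o g) by exact/measurable_EFinP.
  by have [/(_ ig)] := @integrable12ltyP _ _ _ _ _ mu mu _ mE.
have mU := measurable_finite_slice mg; have mV := measurable_finite_slice mgs.
set U := finite_slice g in mU; set V := finite_slice gs in mV.
pose G u v : R := \1_U u * \1_V v * g (u, v).
have mG : measurable2 G.
  apply: measurable_funM; last first.
    apply: (measurableT_comp mg); apply: measurable_fun_pair => //.
  apply: measurable_funM.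
    by apply: measurableT_comp => //; exact: measurable_indic.
  by apply: measurableT_comp => //; exact: measurable_indic.
have Gg u v : `|G u v| <= `|g (u, v)|.
  rewrite /G !indicE; case: (_ \in U); case: (_ \in V);
  by rewrite ?mul1r ?mul0r ?normr0.
exists G.
  split => //.
  - apply: (le_integrable _ _ _ ig) => //; first exact/measurable_EFinP.
    by move=> [u v] _ /=; rewrite lee_fin.
  - move=> u; have [Uu|Uu] := boolP (u \in U); last first.
      have -> : G u = cst 0; last exact: L1_0.
      by apply/funext => v; rewrite /G indicE (negbTE Uu) !mul0r.
    apply/integrableP; split.
      by apply/measurable_EFinP; exact: measurable2_section2.
    apply: le_lt_trans (set_mem Uu); apply: ge0_le_integral => //.
    + apply/measurable_EFinP; apply: measurableT_comp => //; exact: measurable2_section2.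
    + apply/measurable_EFinP; apply: measurableT_comp => //.
      by apply: (measurableT_comp mg); apply: measurable_fun_pair.
    + by move=> v _; rewrite lee_fin.
  - move=> v; have [Vv|Vv] := boolP (v \in V); last first.
      have -> : (fun u => G u v) = cst 0; last exact: L1_0.
      by apply/funext => u; rewrite /G [\1_V v]indicE (negbTE Vv) mulr0 mul0r.
    apply/integrableP; split.
      by apply/measurable_EFinP; exact: measurable2_section1.
    apply: le_lt_trans (set_mem Vv); apply: ge0_le_integral => //.
    + apply/measurable_EFinP; apply: measurableT_comp => //; exact: measurable2_section1.
    + apply/measurable_EFinP; apply: measurableT_comp => //.
      by apply: (measurableT_comp mgs); apply: measurable_fun_pair.
    + by move=> u _; rewrite lee_fin.
split; first by move=> u v g0; rewrite /G g0 mulr0.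
move: (ae_fst (ae_finite_slice ig)) (ae_snd (ae_finite_slice igs)).
apply: aeS2 => -[u v] /= Uu Vv.
by rewrite /G !indicE !mem_set// !mul1r.
Qed.

Lemma kernel2_of_in_L1 (u0 v0 : R) f : in_L1 (rect u0 v0) f ->
  exists G, [/\ kernel2 G, (forall u v, ~ rect u0 v0 (u, v) -> G u v = 0) &
    {ae leb2 R, forall p : R * R, rect u0 v0 p -> f p.1 p.2 = G p.1 p.2}].
Proof.
move=> [g ig fg]; have mr := measurable_rect u0 v0.
have [|G kG [G0 gG]] := @kernel2_of_integrable (g \_ (rect u0 v0)).
  by rewrite -restrict_EFin; apply/integrable_restrict => //; rewrite setTI.
exists G; split => //.
  by move=> u v nr; apply: G0; rewrite patchE memNset.
move: fg gG; apply: aeS2 => p fg gG pr.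
by rewrite fg// -gG patchE mem_set.
Qed.

End normalization.

Section integral_ae.
Context d (T : measurableType d) (R : realType) (m : {measure set T -> \bar R}).
Import HBNNSimple.
Local Open Scope ereal_scope.

Let le_integral_null (N : set T) (f g : T -> \bar R) : measurable N -> m N = 0 ->
  (forall x, 0 <= f x) -> (forall x, 0 <= g x) -> (forall x, ~ N x -> f x = g x) ->
  \int[m]_x f x <= \int[m]_x g x.
Proof.
move=> mN N0 f0 g0 fg; rewrite ge0_integralTE//.
apply: ge_ereal_sup => _ [h hf <-].
have mC : measurable (~` N) by exact: measurableC.
pose h' := proj_nnsfun h mC.
have -> : sintegral m h = sintegral m h'.
  rewrite -!integralT_nnsfun; apply: ge0_ae_eq_integral => //.
  - exact/measurable_EFinP.
  - exact/measurable_EFinP.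
  - by move=> x _; rewrite lee_fin.
  - by move=> x _; rewrite lee_fin.
  exists N; split => // x /= /not_implyP[_] hh; apply: contrapT => Nx; apply: hh.
  by rewrite mindicE mem_set ?mulr1.
rewrite ge0_integralTE//; apply: ereal_sup_ubound; exists h' => //= x.
rewrite mindicE; have [Nx|Nx] := boolP (x \in ~` N).
  by rewrite mulr1 -fg//; exact: set_mem Nx.
by rewrite mulr0.
Qed.

Let ge0_integral_null (f g : T -> \bar R) : (forall x, 0 <= f x) -> (forall x, 0 <= g x) ->
  {ae m, forall x, f x = g x} -> \int[m]_x f x = \int[m]_x g x.
Proof.
move=> f0 g0 [N [mN N0 fgN]].
have fg x : ~ N x -> f x = g x by move=> Nx; apply: contrapT => /fgN.
apply/eqP; rewrite eq_le (le_integral_null mN N0 f0 g0 fg) (le_integral_null mN N0 g0 f0)//.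
by move=> x /fg.
Qed.

(** Derivatives are determined almost everywhere only and may fail to be
    measurable. The integral of an arbitrary nonnegative function is a
    supremum over simple functions below it, and cutting these off on a null
    set does not change their integrals. *)
Lemma integral_ae_congr (D : set T) (f g : T -> \bar R) :
  {ae m, forall x, D x -> f x = g x} -> \int[m]_(x in D) f x = \int[m]_(x in D) g x.
Proof.
move=> fg; rewrite integral_mkcond [RHS]integral_mkcond integralE [RHS]integralE.
have {}fg : {ae m, forall x, (f \_ D) x = (g \_ D) x}.
  by move: fg; apply: aeS => x H; rewrite !patchE; case: ifPn => // /set_mem/H.
congr (_ - _); apply: ge0_integral_null => //; move: fg; apply: aeS => x H.
  by rewrite !funeposE H.
by rewrite !funenegE H.
Qed.

End integral_ae.

(** * A Gronwall inequality for the Goursat problem *)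

Section gronwall.
Context {R : realType}.
Implicit Types (g k s t m n : R -> R) (h : R -> R -> R).
Local Notation mu := (@lebesgue_measure R).
Local Notation T := (measurableTypeR R).

Lemma le_primitive_ae g k x : L1 g -> L1 k ->
  {ae mu, forall z : R, 0 < z -> g z <= k z} -> primitive g x <= primitive k x.
Proof.
move=> Lg Lk gk; have Lkg := L1B Lk Lg.
rewrite -subr_ge0 -primitiveB// (primitive_ae (h := fun z => `|k z - g z|))//.
- exact: primitive_ge0.
- exact: L1_norm.
- by move: gk; apply: aeS => z H /andP[/H zx _]; rewrite ger0_norm// subr_ge0.
Qed.

Lemma L1_decay n g (lam : R) : 0 <= lam -> L1 n -> (forall z, 0 <= n z) -> L1 g ->
  L1 (fun z => expR (- (lam * primitive n z)) * g z).
Proof.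
move=> lam0 Ln n0 Lg; apply: (L1Mbounded (B := 1) Lg).
  apply: measurableT_comp => //; apply: measurableT_comp => //.
  apply: measurable_funM => //.
  exact: is_primitive_measurable (is_primitive_primitive Ln).
move=> z; rewrite ger0_norm ?expR_ge0// -expR0 ler_expR oppr_le0 mulr_ge0// primitive_ge0//.
Qed.

Section bound.
Variables (m n s t : R -> R) (eps U V : R) (h : R -> R -> R).
Hypotheses (Lm : L1 m) (Ln : L1 n) (Ls : L1 s) (Lt : L1 t).
Hypotheses (m0 : forall z, 0 <= m z) (n0 : forall z, 0 <= n z).
Hypotheses (s0 : forall z, 0 <= s z) (t0 : forall z, 0 <= t z) (eps0 : 0 <= eps).
Hypotheses (kh : kernel2 h) (h0 : forall u v, 0 <= h u v).
Hypothesis hle : {ae leb2 R, forall p : R * R, 0 < p.1 -> 0 < p.2 ->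
  h p.1 p.2 <= n p.2 * (s p.1 + primitive (h p.1) p.2)
             + m p.1 * (t p.2 + primitive (h ^~ p.2) p.1)
             + m p.1 * n p.2 * (eps + primitive2 h p.1 p.2)}.
Let lam : R := 4.
Let lam0 : 0 < lam. Proof. by []. Qed.
Let N := primitive n.
Let M := primitive m.
Let wn v := expR (- (lam * N v)).
Let wm u := expR (- (lam * M u)).
Let W u := primitive (fun v => wn v * h u v) V.

Let wn_le1 v : wn v <= 1.
Proof. by rewrite /wn -expR0 ler_expR oppr_le0 mulr_ge0// primitive_ge0. Qed.
Let wm_le1 v : wm v <= 1.
Proof. by rewrite /wm -expR0 ler_expR oppr_le0 mulr_ge0// primitive_ge0. Qed.
Let wn_ge0 v : 0 <= wn v. Proof. exact: expR_ge0. Qed.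
Let wm_ge0 v : 0 <= wm v. Proof. exact: expR_ge0. Qed.

Let kwh : kernel2 (fun u v => wn v * h u v).
Proof.
apply: (@kernel2_Mbounded _ h (fun _ v => wn v) 1) => //; last first.
  by move=> _ v; rewrite ger0_norm.
apply: (measurableT_comp (f := wn) _ measurable_snd).
apply: measurableT_comp => //; apply: measurable_funN; apply: measurable_funM => //.
exact: is_primitive_measurable (is_primitive_primitive Ln).
Qed.

Let LW : L1 W.
Proof. exact: kernel2_primitive_L1 kwh. Qed.

Let W0 u : 0 <= W u.
Proof. by apply: primitive_ge0 => v; rewrite mulr_ge0. Qed.

Let slice_bound : {ae mu, forall u : R, 0 < u ->
  W u <= s u * primitive n V + lam^-1 * W u
    + m u * (primitive t V + primitive W u)
    + m u * (eps * primitive n V + lam^-1 * primitive W u)}.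
Proof.
have := ae_xsection hle; apply: aeS => u Hu u0.
have Lhu := kernel2_L1r kh u.
have pk := is_primitive_primitive Lhu.
have LD g : L1 g -> L1 (fun z => wn z * g z) by exact: L1_decay.
have Ln2 k : (exists B, forall z, `|k z| <= B) -> measurable_fun [set: T] k -> L1 (fun z => n z * k z).
  move=> [B kB] mk; have := L1Mbounded Ln mk kB.
  by congr (L1 _); apply/funext => z; rewrite mulrC.
have LnK k : L1 k -> L1 (fun z => n z * primitive k z).
  move=> Lk; have pp := is_primitive_primitive Lk; apply: Ln2.
    by have [B _ HB] := is_primitive_bounded pp; exists B.
  exact: is_primitive_measurable pp.
pose k v := primitive (h ^~ v) u.
have Lk : L1 k by exact: kernel2_primitive_L1' kh.
have E2 v : primitive2 h u v = primitive k v by rewrite primitive2_swap.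
have FW : primitive (fun v => wn v * k v) V = primitive W u.
  have := primitive2_swap u V kwh; rewrite /primitive2 -/W => ->.
  congr primitive; apply/funext => v.
  by rewrite /k primitiveZ//; exact: kernel2_L1l kh v.
have L1a := LD _ (L1D (L1Z (s u) Ln) (LnK _ Lhu)).
have L1b := LD _ (L1Z (m u) (L1D Lt Lk)).
have L1c := LD _ (L1Z (m u) (L1D (L1Z eps Ln) (LnK _ Lk))).
apply: (@le_trans _ _ (primitive (fun v =>
    wn v * (s u * n v + n v * primitive (h u) v)
  + wn v * (m u * (t v + k v))
  + wn v * (m u * (eps * n v + n v * primitive k v))) V)).
  apply: le_primitive_ae; [exact: kernel2_L1r kwh u|exact: L1D (L1D L1a L1b) L1c|].
  move: Hu; apply: aeS => v /= Hv v0; have := Hv u0 v0; rewrite E2 -/(k v) => le.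
  apply: le_trans (ler_wpM2l (wn_ge0 v) le) _; rewrite le_eqVlt; apply/orP; left; apply/eqP; ring.
rewrite (primitiveD _ (L1D L1a L1b) L1c) (primitiveD _ L1a L1b).
have wle g : L1 g -> (forall z, 0 <= g z) -> primitive (fun z => wn z * g z) V <= primitive g V.
  move=> Lg g0; apply: le_primitive => //; first exact: LD.
  by move=> z _ _; rewrite ler_piMl.
apply: lerD; first apply: lerD.
- have -> : (fun z => wn z * (s u * n z + n z * primitive (h u) z)) =
     (fun z => s u * (wn z * n z) + wn z * (n z * primitive (h u) z)).
    by apply/funext => z; ring.
  rewrite primitiveD; [|exact: L1Z (LD _ Ln)|exact: LD (LnK _ Lhu)].
  rewrite primitiveZ; last exact: LD.
  apply: lerD; first by rewrite ler_wpM2l// wle.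
  exact: primitive_decay.
- have -> : (fun z => wn z * (m u * (t z + k z))) = (fun z => m u * (wn z * t z + wn z * k z)).
    by apply/funext => z; ring.
  rewrite primitiveZ; last exact: L1D (LD _ Lt) (LD _ Lk).
  rewrite (primitiveD _ (LD _ Lt) (LD _ Lk)) ler_wpM2l// FW lerD2r; exact: wle.
- have -> : (fun z => wn z * (m u * (eps * n z + n z * primitive k z))) =
    (fun z => m u * (eps * (wn z * n z) + wn z * (n z * primitive k z))).
    by apply/funext => z; ring.
  rewrite primitiveZ; last exact: L1D (L1Z _ (LD _ Ln)) (LD _ (LnK _ Lk)).
  rewrite (primitiveD _ (L1Z _ (LD _ Ln)) (LD _ (LnK _ Lk))) ler_wpM2l//.
  rewrite primitiveZ; last exact: LD.
  apply: lerD; first by rewrite ler_wpM2l// wle.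
  rewrite -FW; apply: primitive_decay => // z; exact: primitive_ge0.
Qed.

(** The inequality for [h] is integrated against the weight
    [expR (- lam * (M u + N v))]: first in [v] ([slice_bound]), then in [u].
    Every Volterra term costs a factor [1 / lam] by [primitive_decay] and
    can be absorbed on the left when [lam = 4]; the constant [16 / 7] is
    what remains after absorption. *)
Lemma goursat_L1_bound : primitive2 h U V <=
  16 / 7 * expR (4 * (primitive m U + primitive n V)) *
  (primitive n V * primitive s U + primitive m U * (primitive t V + eps * primitive n V)).
Proof.
pose Y := primitive (fun u => wm u * W u) U.
have LD g : L1 g -> L1 (fun z => wm z * g z) by exact: L1_decay.
set S := primitive s U; set Tt := primitive t V; set NV := primitive n V; set MU := primitive m U.
have NV0 : 0 <= NV by exact: primitive_ge0.
have Tt0 : 0 <= Tt by exact: primitive_ge0.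
have pW := is_primitive_primitive LW.
have LmW : L1 (fun z => m z * primitive W z).
  have [B _ HB] := is_primitive_bounded pW.
  have := L1Mbounded Lm (is_primitive_measurable pW) HB.
  by congr (L1 _); apply/funext => z; rewrite mulrC.
have YE : (3 / 4) * Y <= NV * S + MU * (Tt + eps * NV) + (5 / 4) * (lam^-1 * Y).
  have le1 : (3 / 4) * Y <= primitive (fun u => NV * (wm u * s u) +
      ((Tt + eps * NV) * (wm u * m u) + (5 / 4) * (wm u * (m u * primitive W u)))) U.
    rewrite -primitiveZ; last exact: LD.
    apply: le_primitive_ae; [exact: L1Z (LD _ LW)| |].
      exact: L1D (L1Z _ (LD _ Ls)) (L1D (L1Z _ (LD _ Lm)) (L1Z _ (LD _ LmW))).
    move: slice_bound; apply: aeS => u H u0; have {}H := H u0.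
    have {H} : 3 / 4 * W u <= s u * NV + m u * (Tt + eps * NV) + 5 / 4 * (m u * primitive W u).
      move: H; rewrite /lam -/NV -/Tt; lra.
    move=> /(ler_wpM2l (wm_ge0 u)) H; rewrite mulrCA; apply: le_trans H _.
    rewrite le_eqVlt; apply/orP; left; apply/eqP; ring.
  apply: le_trans le1 _.
  rewrite primitiveD; [|exact: L1Z (LD _ Ls)|exact: L1D (L1Z _ (LD _ Lm)) (L1Z _ (LD _ LmW))].
  rewrite (primitiveD _ (L1Z _ (LD _ Lm)) (L1Z _ (LD _ LmW))).
  rewrite (primitiveZ _ _ (LD _ Ls)) (primitiveZ _ _ (LD _ Lm)) (primitiveZ _ _ (LD _ LmW)).
  rewrite addrA; apply: lerD; first apply: lerD.
  - rewrite ler_wpM2l//; apply: le_primitive => //; first exact: LD.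
    by move=> z _ _; rewrite ler_piMl.
  - rewrite mulrC ler_wpM2r//; first by rewrite addr_ge0// mulr_ge0.
    apply: le_primitive => //; first exact: LD.
    by move=> z _ _; rewrite ler_piMl.
  - by rewrite ler_wpM2l//; exact: primitive_decay.
have W_Y : primitive W U <= expR (4 * MU) * Y.
  rewrite -primitiveZ; last exact: LD.
  apply: le_primitive => //; first exact: L1Z (LD _ LW).
  move=> z _ zU; rewrite mulrA /wm -expRD ler_peMl// -[leLHS]expR0 ler_expR.
  have : M z <= MU by exact: primitive_nd.
  rewrite /lam; lra.
have h_W : primitive2 h U V <= expR (4 * NV) * primitive W U.
  rewrite -primitiveZ//; apply: le_primitive; [exact: kernel2_primitive_L1 kh|exact: L1Z|].
  move=> u _ _; rewrite -primitiveZ; last exact: kernel2_L1r kwh u.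
  apply: le_primitive; [exact: kernel2_L1r kh u|exact: L1Z (kernel2_L1r kwh u)|].
  move=> z _ zV; rewrite mulrA /wn -expRD ler_peMl// -[leLHS]expR0 ler_expR.
  have : N z <= NV by exact: primitive_nd.
  rewrite /lam; lra.
apply: le_trans h_W _.
apply: (@le_trans _ _ (expR (4 * NV) * (expR (4 * MU) * Y))).
  by rewrite ler_wpM2l ?expR_ge0.
rewrite mulrA -expRD -mulrDr [NV + MU]addrC [16 / 7 * _]mulrC -[leRHS]mulrA.
rewrite ler_wpM2l ?expR_ge0//; move: YE; rewrite /lam; lra.
Qed.

End bound.

End gronwall.

(** * Mild wave maps: conservation and stability *)

Section ae_lemmas.
Context {R : realType}.
Local Notation mu := (@lebesgue_measure R).
Local Notation T := (measurableTypeR R).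

(** A finite type embeds in [nat], where countable intersections are
    available. *)
Lemma ae_forall_fin d (X : measurableType d) (m : {measure set X -> \bar R})
    (I : finType) (P : I -> X -> Prop) :
  (forall i, {ae m, forall x, P i x}) -> {ae m, forall x, forall i, P i x}.
Proof.
move=> H; have : {ae m, forall x, forall k : nat, forall i, enum_rank i = k :> nat -> P i x}.
  apply: ae_foralln => k; have [[j jk]|no] := pselect (exists j : I, enum_rank j = k :> nat).
    move: (H j); apply: aeS => x Px i ik.
    by have -> : i = j by apply/enum_rank_inj/val_inj; rewrite /= ik jk.
  by apply: aeW => x i ik; case: no; exists i.
by apply: aeS => x Hx i; exact: (Hx _ i erefl).
Qed.

Lemma ae_swap (P : T * T -> Prop) :
  {ae leb2 R, forall p, P p} -> {ae leb2 R, forall p, P (p.2, p.1)}.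
Proof.
move=> [N [mN N0 PN]]; pose sw (p : T * T) := (p.2, p.1).
have msw : measurable_fun setT sw by exact: measurable_fun_pair.
exists (sw @^-1` N).
have mS : measurable (sw @^-1` N) by rewrite -[X in measurable X]setTI; apply: msw.
split => //; last by move=> [u v] /= /PN.
rewrite leb2_ysection// -N0 leb2_xsection//; apply: eq_integral => y _; congr (mu _).
Qed.

End ae_lemmas.

Section vectors.
Context {R : realType} {n : nat}.
Implicit Types (x y z : 'rV[R]_n).

Definition l1 x : R := \sum_i `|x ord0 i|.

Lemma dotE x y : dot x y = \sum_i x ord0 i * y ord0 i.
Proof. by rewrite /dot mxE; apply: eq_bigr => i _; rewrite mxE. Qed.

Lemma dotC x y : dot x y = dot y x.
Proof. by rewrite !dotE; apply: eq_bigr => i _; rewrite mulrC. Qed.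

Lemma dot_ge0 x : 0 <= dot x x.
Proof. by rewrite dotE sumr_ge0// => i _; rewrite -expr2 sqr_ge0. Qed.

Lemma dotBl x y z : dot (x - y) z = dot x z - dot y z.
Proof.
by rewrite !dotE -sumrB; apply: eq_bigr => i _; rewrite !mxE mulrBl.
Qed.

Lemma dotBr x y z : dot z (x - y) = dot z x - dot z y.
Proof. by rewrite dotC dotBl dotC [dot y _]dotC. Qed.

Lemma dotZr (c : R) x y : dot x (c *: y) = c * dot x y.
Proof.
by rewrite !dotE mulr_sumr; apply: eq_bigr => i _; rewrite !mxE mulrCA.
Qed.

Lemma dotZl (c : R) x y : dot (c *: x) y = c * dot x y.
Proof. by rewrite dotC dotZr dotC. Qed.

Lemma l1_ge0 x : 0 <= l1 x.
Proof. by apply: sumr_ge0. Qed.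

Lemma enorm_ge0 x : 0 <= enorm x.
Proof. exact: sqrtr_ge0. Qed.

Lemma coord_le_enorm x i : `|x ord0 i| <= enorm x.
Proof.
rewrite /enorm -sqrtr_sqr ler_wsqrtr// dotE (bigD1 i)//= -expr2 lerDl.
by apply: sumr_ge0 => j _; rewrite -expr2 sqr_ge0.
Qed.

Lemma coord_le_l1 x i : `|x ord0 i| <= l1 x.
Proof. by rewrite /l1 (bigD1 i)//= lerDl sumr_ge0. Qed.

Lemma l1_le_enorm x : l1 x <= n%:R * enorm x.
Proof.
rewrite /l1; apply: le_trans (ler_sum _ (fun i _ => coord_le_enorm x i)) _.
by rewrite sumr_const card_ord mulr_natl.
Qed.

Lemma norm_dot_le x y (B : R) : (forall i, `|y ord0 i| <= B) -> `|dot x y| <= l1 x * B.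
Proof.
move=> yB; rewrite dotE; apply: le_trans (ler_norm_sum _ _ _) _.
rewrite /l1 mulr_suml; apply: ler_sum => i _; rewrite normrM ler_wpM2l//.
Qed.

Lemma enorm_le_l1 x : enorm x <= l1 x.
Proof.
rewrite -[leRHS]ger0_norm ?l1_ge0// -sqrtr_sqr /enorm ler_wsqrtr//.
by apply: le_trans (ler_norm _) _; apply: norm_dot_le; exact: coord_le_l1.
Qed.

Lemma l1D x y : l1 (x + y) <= l1 x + l1 y.
Proof.
by rewrite /l1 -big_split/=; apply: ler_sum => i _; rewrite mxE ler_normD.
Qed.

Lemma l1N x : l1 (- x) = l1 x.
Proof. by apply: eq_bigr => i _; rewrite mxE normrN. Qed.

Lemma l1B x y : l1 (x - y) <= l1 x + l1 y.
Proof. by rewrite -[l1 y]l1N; exact: l1D. Qed.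

Lemma l1Z (c : R) x : l1 (c *: x) = `|c| * l1 x.
Proof. by rewrite /l1 mulr_sumr; apply: eq_bigr => i _; rewrite mxE normrM. Qed.

Lemma eq_enorm x y : dot x x = dot y y -> enorm x = enorm y.
Proof. by rewrite /enorm => ->. Qed.

Lemma l1_eq0 x : l1 x = 0 -> x = 0.
Proof.
move=> /eqP; rewrite psumr_eq0// => /allP H; apply/rowP => i; rewrite mxE.
by apply/eqP; rewrite -normr_eq0; apply: (H i); rewrite mem_index_enum.
Qed.

End vectors.

Section mild_waves.
Context {R : realType} {n : nat}.
Local Notation mu := (@lebesgue_measure R).
Local Notation T := (measurableTypeR R).
Local Notation vec := 'rV[R]_n.

Definition vprimitive (g : R -> vec) (x : R) : vec :=
  \row_i primitive (fun t => g t ord0 i) x.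

Definition vprimitive2 (G : R -> R -> vec) (u v : R) : vec :=
  \row_i primitive2 (fun w z => G w z ord0 i) u v.

Definition is_vprimitive (f g : R -> vec) :=
  forall i, is_primitive (fun x => f x ord0 i) (fun x => g x ord0 i).

Definition vkernel (G : R -> R -> vec) := forall i, kernel2 (fun u v => G u v ord0 i).

(** The characteristic derivatives [d_u phi] and [d_v phi] of the wave map
    whose double derivative is [- G]. *)
Definition char_u (a : R -> vec) (G : R -> R -> vec) (u v : R) : vec :=
  a u - vprimitive (G u) v.

Definition char_v (b : R -> vec) (G : R -> R -> vec) (u v : R) : vec :=
  b v - vprimitive (G ^~ v) u.

(** The integrated form of the wave map equation on the quadrant, with data
    extended to the whole line: [G] is the nonlinearity, and no derivative
    of [phi] occurs. *)
Record mild_wave (p q a b : R -> vec) (G phi : R -> R -> vec) : Prop := {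
  mild_p : is_vprimitive p a ;
  mild_q : is_vprimitive q b ;
  mild_pq : p 0 = q 0 ;
  mild_kernel : vkernel G ;
  mild_phi : forall u v, phi u v = p u + q v - p 0 - vprimitive2 G u v ;
  mild_sphere : forall u v, dot (phi u v) (phi u v) = 1 ;
  mild_eq : {ae leb2 R, forall x : R * R, 0 < x.1 -> 0 < x.2 ->
    G x.1 x.2 = dot (char_u a G x.1 x.2) (char_v b G x.1 x.2) *: phi x.1 x.2} }.

Lemma vprimitive2E G u v i :
  vprimitive2 G u v ord0 i = primitive2 (fun w z => G w z ord0 i) u v.
Proof. by rewrite mxE. Qed.

Lemma vprimitive2_swap G u v : vkernel G -> vprimitive2 G u v = vprimitive2 (fun v u => G u v) v u.
Proof.
move=> kG; apply/rowP => i; apply: (etrans (vprimitive2E G u v i)).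
exact: (etrans (primitive2_swap u v (kG i)) (esym (vprimitive2E _ v u i))).
Qed.

Lemma mild_wave_swap p q a b G phi : mild_wave p q a b G phi ->
  mild_wave q p b a (fun v u => G u v) (fun v u => phi u v).
Proof.
move=> [hp hq pq kG phiE sph eqG]; split.
- exact: hq.
- exact: hp.
- by rewrite pq.
- by move=> i; exact: kernel2_swap (kG i).
- move=> v u; rewrite phiE vprimitive2_swap//; congr (_ - _).
  by rewrite [p u + _]addrC pq.
- by move=> v u; exact: sph.
- move: (ae_swap eqG); apply: aeS => x /= H x1 x2.
  by rewrite (H x2 x1) dotC.
Qed.

(** Stated for the integral formula alone, to be applied to wave maps before
    [G] is known to be their nonlinearity. *)
Lemma mild_formula_derive (p q a : R -> vec) (G phi : R -> R -> vec) :
  is_vprimitive p a -> vkernel G -> (forall u v, phi u v = p u + q v - p 0 - vprimitive2 G u v) ->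
  {ae mu, forall u : R, 0 < u -> forall v i,
    is_derive u 1 (fun w => phi w v ord0 i) (char_u a G u v ord0 i)}.
Proof.
move=> hp kG phiE.
have H1 i := is_primitive_derive (hp i).
have H2 i := primitive2_derive (kG i).
move: (ae_forall_fin H1) (ae_forall_fin H2); apply: aeS2 => u {H1}H1 {H2}H2 u0 v i.
have -> : (fun w => phi w v ord0 i) =
    (fun w => (p w ord0 i + (q v ord0 i - p 0 ord0 i)) - primitive2 (fun w z => G w z ord0 i) w v).
  by apply/funext => w; rewrite phiE !mxE addrA.
rewrite /char_u !mxE -[a u ord0 i]addr0.
apply: is_deriveB; last exact: H2.
by apply: is_deriveD; exact: H1.
Qed.

Section facts.
Variables (p q a b : R -> vec) (G phi : R -> R -> vec).
Hypothesis W : mild_wave p q a b G phi.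

Let mild_wave_derive := mild_formula_derive (mild_p W) (mild_kernel W) (mild_phi W).

Lemma is_derive_dot (f : R -> vec) (x : R) (l : vec) :
  (forall i, is_derive x 1 (fun w => f w ord0 i) (l ord0 i)) ->
  is_derive x 1 (fun w => dot (f w) (f w)) (2 * dot (f x) l).
Proof.
move=> H; have -> : (fun w => dot (f w) (f w)) = \sum_i (fun w => f w ord0 i * f w ord0 i).
  by apply/funext => w; rewrite dotE fct_sumE.
rewrite dotE mulr_sumr; apply: is_derive_sum => i.
have -> : 2 * (f x ord0 i * l ord0 i) = f x ord0 i *: l ord0 i + f x ord0 i *: l ord0 i.
  by rewrite /GRing.scale/=; ring.
exact: is_deriveM.
Qed.

(** Differentiate [dot phi phi = 1]. *)
Lemma mild_wave_orth : {ae mu, forall u : R, 0 < u -> forall v,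
  dot (phi u v) (char_u a G u v) = 0}.
Proof.
have := mild_wave_derive; apply: aeS => u H u0 v.
have D := is_derive_dot (fun i => H u0 v i).
have D' : is_derive u 1 (fun w => dot (phi w v) (phi w v)) 0.
  have -> : (fun w => dot (phi w v) (phi w v)) = cst 1.
    by apply/funext => w; rewrite (mild_sphere W).
  exact: is_derive_cst.
have : 2 * dot (phi u v) (char_u a G u v) = 0.
  by rewrite -(derive_val (f := fun w => dot (phi w v) (phi w v))
    (df := 2 * dot (phi u v) (char_u a G u v))) (@derive_val _ _ _ _ _ _ _ D').
move=> /eqP; rewrite mulf_eq0 pnatr_eq0/= => /eqP//.
Qed.

Lemma char_u_is_primitive u i :
  is_primitive (fun v => char_u a G u v ord0 i) (fun v => - G u v ord0 i).
Proof.
have L := kernel2_L1r (mild_kernel W i) u.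
have := is_primitiveB (is_primitive_cst (a u ord0 i)) (is_primitive_primitive L).
congr is_primitive; apply/funext => v; rewrite /char_u ?mxE//.
by rewrite sub0r.
Qed.

Lemma is_primitive_dot (f g : R -> vec) : is_vprimitive f g ->
  is_primitive (fun x => dot (f x) (f x)) (fun x => 2 * dot (f x) (g x)).
Proof.
move=> H; have := is_primitive_sum (fun i => is_primitiveM (H i) (H i)).
congr is_primitive; apply/funext => x; rewrite dotE//.
by rewrite mulr_sumr; apply: eq_bigr => i _; ring.
Qed.

Lemma char_u_0 u : char_u a G u 0 = a u.
Proof. by apply/rowP => i; rewrite !mxE primitive0 subr0. Qed.

(** Along almost every line the characteristic derivative [A] has derivative
    [- G], a multiple of [phi], and [phi] is orthogonal to [A]; so [dot A A]
    has zero derivative. *)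
Lemma mild_wave_conservation : {ae mu, forall u : R, 0 < u -> forall v,
  dot (char_u a G u v) (char_u a G u v) = dot (a u) (a u)}.
Proof.
have H1 := ae_xsection (mild_eq W).
move: H1 mild_wave_orth; apply: aeS2 => u /= H1 H2 u0 v.
have pd := is_primitive_dot (f := char_u a G u) (g := fun v => - G u v).
rewrite (is_primitive_const (pd _)) ?char_u_0//.
  move=> i; have := char_u_is_primitive u i.
  by congr is_primitive; apply/funext => z; rewrite !mxE.
move: H1; apply: aeS => z H1 z0; rewrite H1// -scaleNr dotZr.
by rewrite [dot _ (phi u z)]dotC H2// mulr0 mulr0.
Qed.

(** The conservation law as an a priori bound: it makes the quadratic
    nonlinearity Lipschitz, with weights depending on the data only. *)
Lemma norm_char_u_coord : {ae mu, forall u : R, 0 < u -> forall v i,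
  `|char_u a G u v ord0 i| <= l1 (a u)}.
Proof.
have := mild_wave_conservation; apply: aeS => u H u0 v i.
apply: le_trans (coord_le_enorm _ _) _; rewrite (eq_enorm (H u0 v)); exact: enorm_le_l1.
Qed.

End facts.

Lemma kernel2D (G H : R -> R -> R) : kernel2 G -> kernel2 H -> kernel2 (fun u v => G u v + H u v).
Proof.
move=> [mG iG rG lG] [mH iH rH lH]; split.
- exact: measurable_funD.
- exact: (integrableD _ iG iH).
- by move=> u; exact: L1D.
- by move=> v; exact: L1D (lG v) (lH v).
Qed.

Lemma kernel2_0 : kernel2 (fun _ _ => 0 : R).
Proof.
split; [exact: measurable_cst|exact: integrable0|by move=> u; exact: L1_0|].
by move=> u; exact: L1_0.
Qed.

Lemma kernel2B (G H : R -> R -> R) : kernel2 G -> kernel2 H -> kernel2 (fun u v => G u v - H u v).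
Proof.
move=> [mG iG rG lG] [mH iH rH lH]; split.
- exact: measurable_funB.
- exact: (integrableB _ iG iH).
- by move=> u; exact: L1B.
- by move=> v; exact: L1B (lG v) (lH v).
Qed.

Lemma kernel2_sum (I : finType) (G : I -> R -> R -> R) :
  (forall i, kernel2 (G i)) -> kernel2 (fun u v => \sum_i G i u v).
Proof.
move=> kG; suff H (s : seq I) : kernel2 (fun u v => \sum_(i <- s) G i u v).
  exact: (H (index_enum I)).
elim: s => [|i s IH].
  have -> : (fun u v => \sum_(i <- [::]) G i u v) = (fun _ _ => 0).
    by apply/funext => u; apply/funext => v; rewrite big_nil.
  exact: kernel2_0.
have -> : (fun u v => \sum_(i <- i :: s) G i u v) = (fun u v => G i u v + \sum_(i <- s) G i u v).
  by apply/funext => u; apply/funext => v; rewrite big_cons.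
exact: kernel2D.
Qed.

Lemma L1_sum (I : finType) (g : I -> R -> R) :
  (forall i, L1 (g i)) -> L1 (fun u => \sum_i g i u).
Proof.
by move=> Lg; have [] := is_primitive_sum (fun i => is_primitive_primitive (Lg i)).
Qed.

Lemma primitive_sum (I : finType) (g : I -> R -> R) x :
  (forall i, L1 (g i)) -> primitive (fun u => \sum_i g i u) x = \sum_i primitive (g i) x.
Proof.
move=> Lg; have [_ ->] := is_primitive_sum (fun i => is_primitive_primitive (Lg i)).
by rewrite big1 ?add0r// => i _; rewrite primitive0.
Qed.

Definition L1_vec (g : R -> vec) := forall i, L1 (fun t => g t ord0 i).

Lemma L1_vecB g1 g2 : L1_vec g1 -> L1_vec g2 -> L1_vec (fun t => g1 t - g2 t).
Proof.
move=> L1g L2g i; have := L1B (L1g i) (L2g i).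
by congr L1; apply/funext => t; rewrite !mxE.
Qed.

Lemma L1_l1 g : L1_vec g -> L1 (fun t => l1 (g t)).
Proof. by move=> Lg; apply: L1_sum => i; exact: L1_norm. Qed.

Lemma vprimitiveB g1 g2 x : L1_vec g1 -> L1_vec g2 ->
  vprimitive (fun t => g1 t - g2 t) x = vprimitive g1 x - vprimitive g2 x.
Proof.
move=> L1g L2g; apply/rowP => i; rewrite !mxE -primitiveB//.
by congr primitive; apply/funext => t; rewrite !mxE.
Qed.

Lemma l1_vprimitive g x : L1_vec g -> l1 (vprimitive g x) <= primitive (fun t => l1 (g t)) x.
Proof.
move=> Lg; rewrite primitive_sum; last by move=> i; exact: L1_norm.
by apply: ler_sum => i _; rewrite mxE; exact: norm_primitive.
Qed.

Lemma vkernelB G H : vkernel G -> vkernel H -> vkernel (fun u v => G u v - H u v).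
Proof.
move=> kG kH i; have := kernel2B (kG i) (kH i).
by congr kernel2; apply/funext => u; apply/funext => v; rewrite !mxE.
Qed.

Lemma vkernel_L1r G u : vkernel G -> L1_vec (G u).
Proof. by move=> kG i; exact: (kernel2_L1r (kG i) u). Qed.

Lemma vkernel_L1l G v : vkernel G -> L1_vec (G ^~ v).
Proof. by move=> kG i; exact: (kernel2_L1l (kG i) v). Qed.

Lemma vkernel_l1 G : vkernel G -> kernel2 (fun u v => l1 (G u v)).
Proof. by move=> kG; apply: kernel2_sum => i; exact: kernel2_norm. Qed.

Lemma vkernel_primitive_L1 G v : vkernel G -> L1_vec (fun u => vprimitive (G u) v).
Proof.
move=> kG i; have := kernel2_primitive_L1 v (kG i).
by congr L1; apply/funext => u; rewrite mxE.
Qed.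

Lemma vprimitive2_iter G u v : vprimitive2 G u v = vprimitive (fun w => vprimitive (G w) v) u.
Proof.
apply/rowP => i; rewrite vprimitive2E mxE; congr (primitive _ u).
by apply/funext => w; rewrite mxE.
Qed.

Lemma vprimitive2B G H u v : vkernel G -> vkernel H ->
  vprimitive2 (fun u v => G u v - H u v) u v = vprimitive2 G u v - vprimitive2 H u v.
Proof.
move=> kG kH; rewrite !vprimitive2_iter -vprimitiveB; try exact: vkernel_primitive_L1.
congr (vprimitive _ u); apply/funext => w.
by rewrite vprimitiveB//; exact: vkernel_L1r.
Qed.

Lemma l1_vprimitive2 G u v : vkernel G ->
  l1 (vprimitive2 G u v) <= primitive2 (fun u v => l1 (G u v)) u v.
Proof.
move=> kG; rewrite vprimitive2_iter; apply: le_trans (l1_vprimitive _ (vkernel_primitive_L1 v kG)) _.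
apply: le_primitive; [exact: L1_l1 (vkernel_primitive_L1 v kG)|exact: kernel2_primitive_L1 (vkernel_l1 kG)|].
by move=> w _ _; apply: l1_vprimitive; exact: vkernel_L1r.
Qed.

Lemma is_vprimitiveE f g x : is_vprimitive f g -> f x = f 0 + vprimitive g x.
Proof. by move=> H; apply/rowP => i; rewrite !mxE; have [_ ->] := H i. Qed.

Lemma is_vprimitive_L1 f g : is_vprimitive f g -> L1_vec g.
Proof. by move=> H i; have [] := H i. Qed.

Definition total_integral (g : R -> R) := \int[mu]_z g z.

Lemma primitive_le_total_integral g x : L1 g -> (forall z, 0 <= g z) -> primitive g x <= total_integral g.
Proof.
move=> Lg g0; rewrite /primitive /total_integral /Rintegral fine_le//.
- by apply: integrable_fin_num => //; exact: L1_itv.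
- exact: integrable_fin_num.
- apply: (ge0_subset_integral _ (mitv _)) => //.
    by have /integrableP[] := Lg.
  by move=> z _; rewrite lee_fin.
Qed.

Lemma mild_phi_primitive p q a b G phi u v : mild_wave p q a b G phi ->
  phi u v = p 0 + vprimitive a u + vprimitive b v - vprimitive2 G u v.
Proof.
move=> W; rewrite (mild_phi W) (is_vprimitiveE u (mild_p W)) (is_vprimitiveE v (mild_q W)).
rewrite -(mild_pq W); congr (_ - _); apply/rowP => i; rewrite !mxE; ring.
Qed.

(** Telescoping, arranged so that in each term the factors next to the
    difference are bounded by the data. *)
Lemma nonlinearity_diff (A A' B B' f f' : vec) :
  dot A B *: f - dot A' B' *: f' =
  dot (A - A') B *: f + dot (B - B') A' *: f + dot A' B' *: (f - f').
Proof.
rewrite !dotBl (dotC B A') (dotC B' A').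
by apply/rowP => i; rewrite !mxE; ring.
Qed.

Section stability.
Variables (p1 q1 a1 b1 p2 q2 a2 b2 : R -> vec) (G1 phi1 G2 phi2 : R -> R -> vec).
Hypotheses (W1 : mild_wave p1 q1 a1 b1 G1 phi1) (W2 : mild_wave p2 q2 a2 b2 G2 phi2).
Let h u v := l1 (G1 u v - G2 u v).
Let s u := l1 (a1 u - a2 u).
Let t v := l1 (b1 v - b2 v).
Let c : R := n%:R.
Let kD : vkernel (fun u v => G1 u v - G2 u v) := vkernelB (mild_kernel W1) (mild_kernel W2).
Let La1 : L1_vec a1 := is_vprimitive_L1 (mild_p W1).
Let La2 : L1_vec a2 := is_vprimitive_L1 (mild_p W2).
Let Lb1 : L1_vec b1 := is_vprimitive_L1 (mild_q W1).
Let Lb2 : L1_vec b2 := is_vprimitive_L1 (mild_q W2).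

Let diff_char_u u v : l1 (char_u a1 G1 u v - char_u a2 G2 u v) <= s u + primitive (h u) v.
Proof.
have -> : char_u a1 G1 u v - char_u a2 G2 u v =
    (a1 u - a2 u) - vprimitive (fun z => G1 u z - G2 u z) v.
  rewrite vprimitiveB; [|exact: vkernel_L1r (mild_kernel W1)|exact: vkernel_L1r (mild_kernel W2)].
  by apply/rowP => i; rewrite !mxE; ring.
apply: le_trans (l1B _ _) _; rewrite lerD2l; apply: l1_vprimitive.
exact: (vkernel_L1r u kD).
Qed.

Let diff_char_v u v : l1 (char_v b1 G1 u v - char_v b2 G2 u v) <= t v + primitive (h ^~ v) u.
Proof.
have -> : char_v b1 G1 u v - char_v b2 G2 u v =
    (b1 v - b2 v) - vprimitive (fun z => G1 z v - G2 z v) u.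
  rewrite vprimitiveB; [|exact: vkernel_L1l (mild_kernel W1)|exact: vkernel_L1l (mild_kernel W2)].
  by apply/rowP => i; rewrite !mxE; ring.
apply: le_trans (l1B _ _) _; rewrite lerD2l; apply: l1_vprimitive.
exact: (vkernel_L1l v kD).
Qed.

(** The pointwise distance of the maps is controlled by the data and by the
    [L1] distance [h] of the nonlinearities. *)
Lemma mild_wave_diff u v : l1 (phi1 u v - phi2 u v) <=
  (l1 (p1 0 - p2 0) + total_integral s + total_integral t) + primitive2 h u v.
Proof.
have -> : phi1 u v - phi2 u v = (p1 0 - p2 0) + vprimitive (fun x => a1 x - a2 x) u
   + vprimitive (fun x => b1 x - b2 x) v - vprimitive2 (fun u v => G1 u v - G2 u v) u v.
  rewrite (mild_phi_primitive _ _ W1) (mild_phi_primitive _ _ W2).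
  rewrite vprimitive2B; [|exact: mild_kernel W1|exact: mild_kernel W2].
  rewrite !vprimitiveB//; apply/rowP => i; rewrite !mxE; ring.
apply: le_trans (l1B _ _) _; apply: lerD; last exact: l1_vprimitive2.
apply: le_trans (l1D _ _) _; apply: lerD; last first.
  apply: le_trans (l1_vprimitive _ (L1_vecB Lb1 Lb2)) _; apply: primitive_le_total_integral.
    exact: L1_l1 (L1_vecB Lb1 Lb2).
  by move=> z; exact: l1_ge0.
apply: le_trans (l1D _ _) _; rewrite lerD2l.
apply: le_trans (l1_vprimitive _ (L1_vecB La1 La2)) _; apply: primitive_le_total_integral.
  exact: L1_l1 (L1_vecB La1 La2).
by move=> z; exact: l1_ge0.
Qed.

(** Expand [G1 - G2] by [nonlinearity_diff], bound the fixed factors by the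
    conservation laws and the differences by their integral formulas, and
    apply the Gronwall inequality. *)
Lemma mild_wave_L1_bound U V (m := fun u => c * l1 (a2 u)) (k := fun v => c * l1 (b1 v) + l1 (b2 v)) :
  primitive2 h U V <=
  16 / 7 * expR (4 * (primitive m U + primitive k V)) *
  (primitive k V * primitive s U +
   primitive m U * (primitive t V + (l1 (p1 0 - p2 0) + total_integral s + total_integral t) * primitive k V)).
Proof.
have tot0 g : (forall z, 0 <= g z) -> 0 <= total_integral g by move=> g0; exact: Rintegral_ge0.
have c0 : 0 <= c by [].
have s0 z : 0 <= s z by exact: l1_ge0.
have t0 z : 0 <= t z by exact: l1_ge0.
apply: (goursat_L1_bound (s := s) (t := t)).
- exact: L1Z (L1_l1 La2).
- exact: L1D (L1Z _ (L1_l1 Lb1)) (L1_l1 Lb2).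
- exact: L1_l1 (L1_vecB La1 La2).
- exact: L1_l1 (L1_vecB Lb1 Lb2).
- by move=> z; rewrite /m mulr_ge0 ?l1_ge0.
- by move=> z; rewrite /k addr_ge0 ?mulr_ge0 ?l1_ge0.
- exact: s0.
- exact: t0.
- by rewrite !addr_ge0 ?l1_ge0 ?tot0.
- exact: vkernel_l1 kD.
- by move=> u v; exact: l1_ge0.
have B1 := ae_snd (norm_char_u_coord (mild_wave_swap W1)).
have B2 := ae_snd (norm_char_u_coord (mild_wave_swap W2)).
have A2 := ae_fst (norm_char_u_coord W2).
have := aeS2 (fun x => @conj _ _) B1 B2; move/(aeS2 (fun x => @conj _ _) A2).
move: (mild_eq W1) (mild_eq W2); apply: aeS3 => -[u v] /= E1 E2 [H2 [K1 K2]] u0 v0.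
have {}E1 := E1 u0 v0; have {}E2 := E2 u0 v0; have {}H2 := H2 u0 v; have {}K1 := K1 v0 u; have {}K2 := K2 v0 u.
have dA := diff_char_u u v; have dB := diff_char_v u v; have dphi := mild_wave_diff u v.
rewrite {1}/h E1 E2.
set A1' := char_u a1 G1 u v in E1 dA *; set A2' := char_u a2 G2 u v in E2 dA H2 *.
set B1' := char_v b1 G1 u v in E1 dB *; set B2' := char_v b2 G2 u v in E2 dB *.
have {}K1 i : `|B1' ord0 i| <= l1 (b1 v) by exact: K1.
have {}K2 i : `|B2' ord0 i| <= l1 (b2 v) by exact: K2.
rewrite nonlinearity_diff.
have l1phi : l1 (phi1 u v) <= c.
  by apply: le_trans (l1_le_enorm _) _; rewrite /enorm (mild_sphere W1) sqrtr1 mulr1.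
apply: le_trans (l1D _ _) _; rewrite !l1Z; apply: lerD; last first.
  have d2 : `|dot A2' B2'| <= c * l1 (a2 u) * l1 (b2 v).
    apply: le_trans (norm_dot_le _ K2) _; rewrite ler_wpM2r ?l1_ge0//.
    rewrite /l1; apply: le_trans (ler_sum _ (fun i _ => H2 i)) _.
    by rewrite sumr_const card_ord mulr_natl.
  apply: le_trans (ler_pM _ _ d2 dphi) _ => //; first exact: l1_ge0.
  apply: ler_wpM2r.
    rewrite !addr_ge0 ?l1_ge0 ?tot0//; apply: primitive_ge0 => z; apply: primitive_ge0 => w.
    exact: l1_ge0.
  rewrite /m /k ler_wpM2l ?mulr_ge0 ?l1_ge0// lerDr mulr_ge0 ?l1_ge0//.
apply: le_trans (l1D _ _) _; rewrite !l1Z; apply: lerD.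
  apply: (@le_trans _ _ ((l1 (A1' - A2') * l1 (b1 v)) * c)).
    by apply: ler_pM => //; [exact: l1_ge0|exact: norm_dot_le].
  rewrite -mulrA mulrC [l1 (b1 v) * c]mulrC; apply: ler_pM => //.
  - by rewrite mulr_ge0 ?l1_ge0.
  - exact: l1_ge0.
  - by rewrite /k lerDl l1_ge0.
apply: (@le_trans _ _ ((l1 (B1' - B2') * l1 (a2 u)) * c)).
  by apply: ler_pM => //; [exact: l1_ge0|exact: norm_dot_le].
rewrite -mulrA mulrC [l1 (a2 u) * c]mulrC; apply: ler_pM => //.
- by rewrite mulr_ge0 ?l1_ge0.
- exact: l1_ge0.
Qed.

End stability.

End mild_waves.

(** * The Goursat problem for Lipschitz systems *)

Section geometric.
Context {R : realType}.

Lemma pow2_small (C e : R) : 0 < e -> exists k0 : nat, forall k, (k0 <= k)%N -> C / 2 ^+ k <= e.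
Proof.
move=> e0; have [C0|C0] := lerP C 0.
  exists 0%N => k _; apply: le_trans (ltW e0).
  by rewrite mulr_le0_ge0// invr_ge0 exprn_ge0.
have eC : 0 < e / C by rewrite divr_gt0.
have [k0 Hk] := natSinv_lt eC; exists k0 => k k0k.
rewrite mulrC -ler_pdivlMr//; apply: le_trans (ltW Hk).
rewrite lef_pV2 ?posrE ?exprn_gt0// -natrX ler_nat.
exact: leq_ltn_trans k0k (ltn_expl _ _).
Qed.

(** The limit is the supremum of the increasing lower bounds [x k - e k];
    the explicit rate gives pointwise control of Picard iterates without a
    function space. *)
Lemma geometric_limit (x : nat -> R) (C : R) :
  (forall k, `|x k.+1 - x k| <= C / 2 ^+ k) ->
  exists l, forall k, `|x k - l| <= 2 * C / 2 ^+ k.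
Proof.
move=> H; pose e k := 2 * C / 2 ^+ k.
have eE k : e k - e k.+1 = C / 2 ^+ k.
  by rewrite /e exprS; field; rewrite expf_neq0.
have C0 : 0 <= C by have := le_trans (normr_ge0 _) (H 0%N); rewrite expr0 divr1.
have e0 k : 0 <= e k by rewrite /e divr_ge0 ?exprn_ge0// mulr_ge0.
have H' k : - (e k - e k.+1) <= x k.+1 - x k <= e k - e k.+1.
  by rewrite -ler_norml eE.
have nd j d : x j - e j <= x (j + d)%N - e (j + d)%N.
  elim: d => [|d IH]; first by rewrite addn0.
  apply: le_trans IH _; rewrite addnS; have /andP[h1 _] := H' (j + d)%N; lra.
have ni j d : x (j + d)%N + e (j + d)%N <= x j + e j.
  elim: d => [|d IH]; first by rewrite addn0.
  apply: le_trans _ IH; rewrite addnS; have /andP[_ h1] := H' (j + d)%N; lra.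
have yz j k : x j - e j <= x k + e k.
  have [jk|/ltnW kj] := leqP j k.
    have := nd j (k - j)%N; rewrite subnKC//; have := e0 k; lra.
  have := ni k (j - k)%N; rewrite subnKC//; have := e0 j; lra.
pose Y := [set x k - e k | k in [set: nat]].
have Y0 : Y !=set0 by exists (x 0%N - e 0%N), 0%N.
exists (sup Y) => k; rewrite -/(e k) ler_distl; apply/andP; split.
  rewrite lerBlDr; apply: ge_sup => // _ [j _ <-]; exact: yz.
rewrite -lerBlDr; apply: ub_le_sup; last by exists k.
by exists (x 0%N + e 0%N) => _ [j _ <-]; exact: yz.
Qed.

End geometric.

Section goursat.
Context {R : realType}.
Local Notation mu := (@lebesgue_measure R).
Local Notation T := (measurableTypeR R).

(** Bounded measurable functions of two variables: the space in which the
    Picard iteration takes place. *)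
Definition bounded2 (f : R -> R -> R) :=
  measurable2 f /\ exists2 B : R, 0 <= B & forall u v, `|f u v| <= B.

Variables (m n : R -> R).
Hypotheses (Lm : L1 m) (Ln : L1 n) (m0 : forall z, 0 <= m z) (n0 : forall z, 0 <= n z).

Definition int_v (f : R -> R -> R) u v := primitive (fun z => n z * f u z) v.
Definition int_u (f : R -> R -> R) u v := primitive (fun w => m w * f w v) u.

Lemma bounded2_L1r f u : bounded2 f -> L1 (fun z => n z * f u z).
Proof.
move=> [mf [B _ fB]]; have := L1Mbounded Ln (measurable2_section2 u mf) (fB u).
by congr L1; apply/funext => z; rewrite mulrC.
Qed.

Lemma bounded2_L1l f v : bounded2 f -> L1 (fun w => m w * f w v).
Proof.
move=> [mf [B _ fB]]; have := L1Mbounded Lm (measurable2_section1 v mf) (fun w => fB w v).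
by congr L1; apply/funext => z; rewrite mulrC.
Qed.

Lemma bounded2_int_v f : bounded2 f -> bounded2 (int_v f).
Proof.
move=> bf; have [mf [B B0 fB]] := bf; split.
  apply: (measurable2_primitive (G := fun u z => n z * f u z)); apply: measurable_funM => //.
  by apply: measurableT_comp => //; exact: L1_measurable.
exists (B * total_integral n) => [|u v]; first by rewrite mulr_ge0// Rintegral_ge0.
apply: le_trans (norm_primitive _ (bounded2_L1r u bf)) _.
apply: (@le_trans _ _ (primitive (fun z => B * n z) v)).
  apply: le_primitive; [exact: L1_norm (bounded2_L1r u bf)|exact: L1Z|].
  by move=> z _ _; rewrite normrM ger0_norm// mulrC ler_wpM2r.
by rewrite primitiveZ// ler_wpM2l// primitive_le_total_integral.
Qed.

Lemma bounded2_int_u f : bounded2 f -> bounded2 (int_u f).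
Proof.
move=> bf; have [mf [B B0 fB]] := bf; split.
  apply: (measurable2_swap (G := fun v u => primitive (fun w => m w * f w v) u)).
  apply: (measurable2_primitive (G := fun v w => m w * f w v)); apply: measurable_funM.
    by apply: measurableT_comp => //; exact: L1_measurable.
  exact: measurable2_swap mf.
exists (B * total_integral m) => [|u v]; first by rewrite mulr_ge0// Rintegral_ge0.
apply: le_trans (norm_primitive _ (bounded2_L1l v bf)) _.
apply: (@le_trans _ _ (primitive (fun z => B * m z) u)).
  apply: le_primitive; [exact: L1_norm (bounded2_L1l v bf)|exact: L1Z|].
  by move=> z _ _; rewrite normrM ger0_norm// mulrC ler_wpM2r.
by rewrite primitiveZ// ler_wpM2l// primitive_le_total_integral.
Qed.

Lemma bounded2D f g : bounded2 f -> bounded2 g -> bounded2 (fun u v => f u v + g u v).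
Proof.
move=> [mf [B B0 fB]] [mg [C C0 gC]]; split; first exact: measurable_funD.
exists (B + C); first exact: addr_ge0.
by move=> u v; apply: le_trans (ler_normD _ _) _; exact: lerD.
Qed.

Lemma bounded2M f g : bounded2 f -> bounded2 g -> bounded2 (fun u v => f u v * g u v).
Proof.
move=> [mf [B B0 fB]] [mg [C C0 gC]]; split; first exact: measurable_funM.
exists (B * C); first exact: mulr_ge0.
by move=> u v; rewrite normrM; exact: ler_pM.
Qed.

Lemma bounded2N f : bounded2 f -> bounded2 (fun u v => - f u v).
Proof.
move=> [mf [B B0 fB]]; split; first exact: measurable_funN.
by exists B => // u v; rewrite normrN.
Qed.

Lemma bounded2_norm f : bounded2 f -> bounded2 (fun u v => `|f u v|).
Proof.
move=> [mf [B B0 fB]]; split; first exact: measurableT_comp.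
by exists B => // u v; rewrite normr_id.
Qed.

Lemma bounded2_cst (c : R) : bounded2 (fun _ _ => c).
Proof. by split; [exact: measurable_cst|exists `|c|]. Qed.

Lemma bounded2_sum (I : finType) (f : I -> R -> R -> R) :
  (forall i, bounded2 (f i)) -> bounded2 (fun u v => \sum_i f i u v).
Proof.
move=> H; suff S (s : seq I) : bounded2 (fun u v => \sum_(i <- s) f i u v).
  exact: (S (index_enum I)).
elim: s => [|i s IH].
  have -> : (fun u v => \sum_(i <- [::]) f i u v) = (fun _ _ => 0).
    by apply/funext => u; apply/funext => v; rewrite big_nil.
  exact: bounded2_cst.
have -> : (fun u v => \sum_(i <- i :: s) f i u v) = (fun u v => f i u v + \sum_(i <- s) f i u v).
  by apply/funext => u; apply/funext => v; rewrite big_cons.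
exact: bounded2D.
Qed.

Section weight.
Variable (lam : R).
Hypothesis lam0 : 0 < lam.

(** In the sup norm divided by this weight both Volterra operators have norm
    at most [1 / lam]. *)
Definition weight u v := expR (lam * primitive m u) * expR (lam * primitive n v).

Lemma weight_ge1 u v : 1 <= weight u v.
Proof.
by rewrite /weight -expRD -[leLHS]expR0 ler_expR addr_ge0// mulr_ge0 ?(ltW lam0)// primitive_ge0.
Qed.

Lemma weight_ge0 u v : 0 <= weight u v.
Proof. exact: le_trans (weight_ge1 u v). Qed.

Lemma int_v_weight f (K : R) : 0 <= K -> bounded2 f -> (forall u v, `|f u v| <= K * weight u v) ->
  forall u v, `|int_v f u v| <= K / lam * weight u v.
Proof.
move=> K0 bf fK u v; apply: le_trans (norm_primitive _ (bounded2_L1r u bf)) _.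
pose w z := expR (lam * primitive n z) * n z.
have Lw : L1 w.
  have [L _] := is_primitive_expR (is_primitiveZ lam (is_primitive_primitive Ln)).
  have := L1Z lam^-1 L; congr L1; apply/funext => z; rewrite /w; field; exact: lt0r_neq0.
apply: (@le_trans _ _ (primitive (fun z => (K * expR (lam * primitive m u)) * w z) v)).
  apply: le_primitive; [exact: L1_norm (bounded2_L1r u bf)|exact: L1Z|].
  move=> z _ _; rewrite normrM ger0_norm//.
  apply: le_trans (ler_wpM2l (n0 z) (fK u z)) _.
  by rewrite /weight /w le_eqVlt; apply/orP; left; apply/eqP; ring.
rewrite primitiveZ//; apply: le_trans (ler_wpM2l _ (primitive_weight Ln lam0 v)) _.
  by rewrite mulr_ge0// expR_ge0.
by rewrite /weight le_eqVlt; apply/orP; left; apply/eqP; ring.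
Qed.

Lemma int_u_weight f (K : R) : 0 <= K -> bounded2 f -> (forall u v, `|f u v| <= K * weight u v) ->
  forall u v, `|int_u f u v| <= K / lam * weight u v.
Proof.
move=> K0 bf fK u v; apply: le_trans (norm_primitive _ (bounded2_L1l v bf)) _.
pose w z := expR (lam * primitive m z) * m z.
have Lw : L1 w.
  have [L _] := is_primitive_expR (is_primitiveZ lam (is_primitive_primitive Lm)).
  have := L1Z lam^-1 L; congr L1; apply/funext => z; rewrite /w; field; exact: lt0r_neq0.
apply: (@le_trans _ _ (primitive (fun z => (K * expR (lam * primitive n v)) * w z) u)).
  apply: le_primitive; [exact: L1_norm (bounded2_L1l v bf)|exact: L1Z|].
  move=> z _ _; rewrite normrM ger0_norm//.
  apply: le_trans (ler_wpM2l (m0 z) (fK z v)) _.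
  by rewrite /weight /w le_eqVlt; apply/orP; left; apply/eqP; ring.
rewrite primitiveZ//; apply: le_trans (ler_wpM2l _ (primitive_weight Lm lam0 u)) _.
  by rewrite mulr_ge0// expR_ge0.
by rewrite /weight le_eqVlt; apply/orP; left; apply/eqP; ring.
Qed.

End weight.

(** Iterating the inequality halves the weighted bound each time. *)
Lemma goursat_gronwall f (C : R) : 0 <= C -> bounded2 f -> (forall u v, 0 <= f u v) ->
  (forall u v, f u v <= C * (int_v f u v + int_u f u v)) -> forall u v, f u v = 0.
Proof.
move=> C0 bf f0 fC u v; pose lam : R := 4 * C + 1.
have lam0 : 0 < lam by rewrite /lam; lra.
have [_ [B B0 fB]] := bf.
have it k : forall u v, `|f u v| <= B / 2 ^+ k * weight lam u v.
  elim: k => [|k IH] {}u {}v.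
    rewrite expr0 divr1; apply: le_trans (fB u v) _.
    by rewrite ler_peMr// weight_ge1.
  have K0 : 0 <= B / 2 ^+ k by rewrite divr_ge0// exprn_ge0.
  rewrite ger0_norm//; apply: le_trans (fC u v) _.
  have h1 := int_v_weight lam0 K0 bf IH u v; have h2 := int_u_weight lam0 K0 bf IH u v.
  apply: (@le_trans _ _ (C * (B / 2 ^+ k / lam * weight lam u v + B / 2 ^+ k / lam * weight lam u v))).
    rewrite ler_wpM2l// lerD//.
      exact: le_trans (ler_norm _) h1.
    exact: le_trans (ler_norm _) h2.
  have -> : C * (B / 2 ^+ k / lam * weight lam u v + B / 2 ^+ k / lam * weight lam u v) =
     (B / 2 ^+ k * weight lam u v) * (2 * C / lam) by ring.
  have -> : B / 2 ^+ k.+1 * weight lam u v = (B / 2 ^+ k * weight lam u v) * 2^-1.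
    by rewrite exprS; field; rewrite expf_neq0.
  rewrite ler_wpM2l ?mulr_ge0 ?(le_trans ler01 (weight_ge1 lam0 _ _))// ler_pdivrMr//.
  rewrite /lam; lra.
apply/eqP; rewrite eq_le f0 andbT; apply/ler_addgt0Pr => e e0; rewrite add0r.
have [k0 Hk] := pow2_small (B * weight lam u v) e0.
apply: le_trans (ler_norm _) _; apply: le_trans (it k0 u v) _.
by apply: le_trans (Hk _ (leqnn k0)); rewrite mulrAC.
Qed.

Section picard.
Variables (J : finType) (F1 F2 : J -> (J -> R) -> R) (L : R) (X0 : J -> R -> R -> R).
Hypotheses (L0 : 0 <= L)
  (lip1 : forall j x y, `|F1 j x - F1 j y| <= L * \sum_k `|x k - y k|)
  (lip2 : forall j x y, `|F2 j x - F2 j y| <= L * \sum_k `|x k - y k|)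
  (bF1 : forall X : J -> R -> R -> R, (forall k, bounded2 (X k)) ->
     forall j, bounded2 (fun u v => F1 j (X ^~ u ^~ v)))
  (bF2 : forall X : J -> R -> R -> R, (forall k, bounded2 (X k)) ->
     forall j, bounded2 (fun u v => F2 j (X ^~ u ^~ v)))
  (bX0 : forall j, bounded2 (X0 j)).

(** The unknowns are indexed by [J]; each equation propagates in [v] through
    [F1] and in [u] through [F2]. *)
Definition picard_step (X : J -> R -> R -> R) j u v :=
  X0 j u v + int_v (fun u v => F1 j (X ^~ u ^~ v)) u v
           + int_u (fun u v => F2 j (X ^~ u ^~ v)) u v.

Let bounded2_step X : (forall k, bounded2 (X k)) -> forall k, bounded2 (picard_step X k).
Proof.
move=> bX k; apply: bounded2D; last by apply: bounded2_int_u; exact: bF2.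
by apply: bounded2D => //; apply: bounded2_int_v; exact: bF1.
Qed.

Let lam : R := 4 * (#|J|%:R * L) + 1.
Let lam0 : 0 < lam.
Proof. by rewrite /lam ltr_wpDl// mulr_ge0// mulr_ge0. Qed.

Let int_vB f g u v : bounded2 f -> bounded2 g ->
  int_v f u v - int_v g u v = int_v (fun u v => f u v - g u v) u v.
Proof.
move=> bf bg; rewrite /int_v -primitiveB; [|exact: bounded2_L1r bf|exact: bounded2_L1r bg].
by congr primitive; apply/funext => z; rewrite mulrBr.
Qed.

Let int_uB f g u v : bounded2 f -> bounded2 g ->
  int_u f u v - int_u g u v = int_u (fun u v => f u v - g u v) u v.
Proof.
move=> bf bg; rewrite /int_u -primitiveB; [|exact: bounded2_L1l bf|exact: bounded2_L1l bg].
by congr primitive; apply/funext => z; rewrite mulrBr.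
Qed.

Let contraction X Y (K : R) : 0 <= K -> (forall k, bounded2 (X k)) -> (forall k, bounded2 (Y k)) ->
  (forall k u v, `|X k u v - Y k u v| <= K * weight lam u v) ->
  forall k u v, `|picard_step X k u v - picard_step Y k u v| <= K / 2 * weight lam u v.
Proof.
move=> K0 bX bY XY k u v; rewrite /picard_step.
set f1 := fun u v => F1 k (X ^~ u ^~ v); set g1 := fun u v => F1 k (Y ^~ u ^~ v).
set f2 := fun u v => F2 k (X ^~ u ^~ v); set g2 := fun u v => F2 k (Y ^~ u ^~ v).
have -> : X0 k u v + int_v f1 u v + int_u f2 u v - (X0 k u v + int_v g1 u v + int_u g2 u v) =
   (int_v f1 u v - int_v g1 u v) + (int_u f2 u v - int_u g2 u v) by ring.
have bf1 := bF1 bX k; have bg1 := bF1 bY k; have bf2 := bF2 bX k; have bg2 := bF2 bY k.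
rewrite int_vB// int_uB//.
have K1 : 0 <= L * (#|J|%:R * K) by rewrite !mulr_ge0.
have sum_le u' v' : \sum_j `|X j u' v' - Y j u' v'| <= #|J|%:R * K * weight lam u' v'.
  apply: le_trans (ler_sum _ (fun j _ => XY j u' v')) _.
  by rewrite sumr_const -[leRHS]mulrA mulr_natl.
have h1 := int_v_weight lam0 K1 (bounded2D bf1 (bounded2N bg1)).
have h2 := int_u_weight lam0 K1 (bounded2D bf2 (bounded2N bg2)).
apply: le_trans (ler_normD _ _) _.
apply: le_trans (lerD (h1 _ u v) (h2 _ u v)) _.
- move=> u' v'; apply: le_trans (lip1 _ _ _) _.
  by rewrite -[leRHS]mulrA ler_wpM2l.
- move=> u' v'; apply: le_trans (lip2 _ _ _) _.
  by rewrite -[leRHS]mulrA ler_wpM2l.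
rewrite -mulrDl ler_wpM2r ?weight_ge0// -mulrDl ler_pdivrMr//.
rewrite [K / 2 * lam](_ : _ = L * (#|J|%:R * K) + L * (#|J|%:R * K) + K / 2); last first.
  by rewrite /lam; field.
by rewrite lerDl divr_ge0.
Qed.

(** Picard iteration converges geometrically in the weighted sup norm. *)
Theorem goursat_solution : exists X : J -> R -> R -> R,
  (forall j, bounded2 (X j)) /\ forall j u v, X j u v = picard_step X j u v.
Proof.
pose X k := iter k picard_step X0.
have bX k j : bounded2 (X k j) by elim: k j => [|k IH] j; [exact: bX0|exact: bounded2_step].
have [K K0 HK] : exists2 K : R, 0 <= K & forall j u v, `|X 1%N j u v - X 0%N j u v| <= K.
  have H j : exists2 B : R, 0 <= B & forall u v, `|X 1%N j u v - X 0%N j u v| <= B.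
    by have [] := bounded2D (bX 1%N j) (bounded2N (bX 0%N j)).
  pose B j := projT1 (cid2 (H j)).
  have B0 j : 0 <= B j by rewrite /B; case: cid2.
  exists (\sum_j B j); first exact: sumr_ge0.
  move=> j u v; apply: (@le_trans _ _ (B j)); first by rewrite /B; case: cid2.
  by rewrite (bigD1 j)//= lerDl sumr_ge0.
have step k : forall j u v, `|X k.+1 j u v - X k j u v| <= K / 2 ^+ k * weight lam u v.
  elim: k => [|k IH] j u v.
    rewrite expr0 divr1; apply: le_trans (HK j u v) _.
    by rewrite ler_peMr// weight_ge1.
  have := contraction _ (bX _) (bX _) IH; rewrite divr_ge0 ?exprn_ge0// => /(_ isT j u v).
  have -> : K / 2 ^+ k / 2 = K / 2 ^+ k.+1 by rewrite exprS; field; rewrite expf_neq0.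
  exact.
have lim j u v : exists l, forall k, `|X k j u v - l| <= 2 * (K * weight lam u v) / 2 ^+ k.
  apply: geometric_limit => k; have := step k j u v; by rewrite mulrAC.
pose Y j u v := projT1 (cid (lim j u v)).
have HY k j u v : `|X k j u v - Y j u v| <= (2 * K) / 2 ^+ k * weight lam u v.
  have : `|X k j u v - Y j u v| <= 2 * (K * weight lam u v) / 2 ^+ k by rewrite /Y; case: cid.
  by rewrite mulrA mulrAC.
have [W0 W00 HW] : exists2 W0 : R, 0 <= W0 & forall u v, weight lam u v <= W0.
  exists (expR (lam * total_integral m) * expR (lam * total_integral n)).
    by rewrite mulr_ge0// expR_ge0.
  move=> u v; apply: ler_pM; rewrite ?expR_ge0// ler_expR ler_wpM2l ?(ltW lam0)//;
    exact: primitive_le_total_integral.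
have bY j : bounded2 (Y j).
  split.
    apply: (@measurable_fun_cvg _ _ R setT (fun k p => X k j p.1 p.2)).
      by move=> k; have [] := bX k j.
    move=> p _; apply/cvgrPdist_le => e e0.
    have [k0 Hk] := pow2_small (2 * K * weight lam p.1 p.2) e0.
    exists k0 => // k /= k0k; rewrite distrC; apply: le_trans (HY _ _ _ _) _.
    by rewrite mulrAC; exact: Hk.
  have [_ [B B0 HB]] := bX0 j; exists (B + 2 * K * W0).
    by rewrite addr_ge0// mulr_ge0// mulr_ge0.
  move=> u v; have := HY 0%N j u v; rewrite expr0 divr1 => h.
  have -> : Y j u v = X0 j u v - (X 0%N j u v - Y j u v) by rewrite /X/=; ring.
  apply: le_trans (ler_normB _ _) _; apply: lerD => //.
  by apply: le_trans h _; rewrite ler_wpM2l// mulr_ge0.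
exists Y; split => // j u v; apply/eqP; rewrite -subr_eq0 -normr_eq0 eq_le normr_ge0 andbT.
apply/ler_addgt0Pr => e e0; rewrite add0r.
have [k0 Hk] := pow2_small (2 * K * weight lam u v) e0.
have c := contraction _ (bX k0) bY (HY k0).
have {}c := c _ j u v; rewrite -/(X k0.+1 j u v) in c.
have -> : Y j u v - picard_step Y j u v =
   (X k0.+1 j u v - picard_step Y j u v) - (X k0.+1 j u v - Y j u v) by ring.
apply: le_trans (ler_normB _ _) _.
have h1 : `|X k0.+1 j u v - picard_step Y j u v| <= 2 * K / 2 ^+ k0 / 2 * weight lam u v.
  by apply: c; rewrite divr_ge0 ?exprn_ge0// mulr_ge0.
apply: le_trans (lerD h1 (HY k0.+1 j u v)) _.
apply: le_trans _ (Hk _ (leqnn k0)); rewrite le_eqVlt; apply/orP; left; apply/eqP.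
by rewrite exprS; field; rewrite expf_neq0.
Qed.

End picard.

End goursat.

(** * Existence of mild wave maps *)

Section truncation.
Context {R : realType}.

Definition trunc (x : R) : R := Num.max (-1) (Num.min 1 x).

Lemma trunc_norm x : `|trunc x| <= 1.
Proof.
by rewrite ler_norml /trunc le_max lexx/= ge_max ge_min lexx andbT; lra.
Qed.

Lemma trunc_lip x y : `|trunc x - trunc y| <= `|x - y|.
Proof.
suff H a b : trunc a - trunc b <= `|a - b|.
  by rewrite ler_norml lerNl opprB H andbT distrC H.
have h1 := ler_norm (a - b); have h2 := normr_ge0 (a - b).
move: (`|a - b|) h1 h2 => r h1 h2; rewrite /trunc /Num.max /Num.min.
by case: (ltP 1 a) => h3; case: (ltP 1 b) => h4; case: ltP => h5; case: ltP => h6; lra.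
Qed.

Lemma trunc_id x : `|x| <= 1 -> trunc x = x.
Proof.
rewrite ler_norml => /andP[h1 h2]; rewrite /trunc (min_idPr h2); exact/max_idPr.
Qed.

Lemma trunc_defect x (y : R) : x ^+ 2 - 1 <= y -> 0 <= y -> `|x - trunc x| <= y.
Proof.
move=> xy y0; rewrite ler_norml /trunc /Num.max /Num.min.
by case: (ltP 1 x) => h3; case: ltP => h4; apply/andP; split; nra.
Qed.

Lemma bounded2_trunc (f : R -> R -> R) : measurable2 f -> bounded2 (fun u v => trunc (f u v)).
Proof.
move=> mf; split; last by exists 1 => // u v; exact: trunc_norm.
by apply: measurable_maxr => //; apply: measurable_minr.
Qed.

End truncation.

Section cutoff.
Context {R : realType} {n : nat}.
Local Notation vec := 'rV[R]_n.

(** Truncation of each coordinate, a Lipschitz substitute for the projection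
    onto the unit ball which does nothing inside it. *)
Definition truncv (x : vec) : vec := \row_i trunc (x ord0 i).

(** The right-hand side [- (A . B) phi] made bounded and Lipschitz. *)
Definition cutoff (A B f : vec) : vec := - dot (truncv A) (truncv B) *: truncv f.

Lemma truncvE x i : truncv x ord0 i = trunc (x ord0 i).
Proof. by rewrite mxE. Qed.

Lemma truncv_le1 x i : `|truncv x ord0 i| <= 1.
Proof. by rewrite truncvE trunc_norm. Qed.

Lemma norm_dot_le_nat (x y : vec) (K M : R) : (forall i, `|x ord0 i| <= K) ->
  (forall i, `|y ord0 i| <= M) -> `|dot x y| <= n%:R * (K * M).
Proof.
move=> xK yM; rewrite dotE; apply: le_trans (ler_norm_sum _ _ _) _.
have H i : `|x ord0 i * y ord0 i| <= K * M by rewrite normrM ler_pM.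
by apply: le_trans (ler_sum _ (fun i _ => H i)) _; rewrite sumr_const card_ord mulr_natl.
Qed.

(** A vector that overshoots the unit ball by little is moved by little.
    This linear bound is what closes the Gronwall argument for the
    constraints. *)
Lemma truncv_defect x (y : R) : dot x x - 1 <= y -> 0 <= y ->
  forall i, `|(x - truncv x) ord0 i| <= y.
Proof.
move=> xy y0 i; rewrite !mxE; apply: trunc_defect => //.
apply: le_trans xy; rewrite lerD2r dotE (bigD1 i)//= -expr2 lerDl.
by apply: sumr_ge0 => j _; rewrite -expr2 sqr_ge0.
Qed.

Lemma truncv_id x : dot x x <= 1 -> truncv x = x.
Proof.
move=> x1; apply/rowP => i; rewrite mxE trunc_id//.
apply: le_trans (coord_le_enorm x i) _; rewrite /enorm -sqrtr1; exact: ler_wsqrtr.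
Qed.

Section constraint.
Variables (A B f : vec) (K y z w : R).
Hypotheses (K1 : 1 <= K) (BK : forall i, `|B ord0 i| <= K)
  (fK : forall i, `|f ord0 i| <= K).
Hypotheses (y0 : 0 <= y) (z0 : 0 <= z) (w0 : 0 <= w).
Hypotheses (Ay : dot A A - 1 <= y) (Bz : dot B B - 1 <= z) (fw : `|dot f f - 1| <= w).
Local Notation N := (n%:R : R).
Let K0 : 0 <= K. Proof. exact: le_trans ler01 K1. Qed.
Let N0 : 0 <= N. Proof. exact: ler0n. Qed.

Let fw' : dot f f - 1 <= w. Proof. by apply: le_trans fw; exact: ler_norm. Qed.

Let dotT_le (x x' : vec) : `|dot (truncv x) (truncv x')| <= N.
Proof.
have := norm_dot_le_nat (truncv_le1 x) (truncv_le1 x').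
by rewrite mulr1 mulr1.
Qed.

(** Without truncation and with [dot f f = 1] the left side is zero; each
    error is linear in one of the defects [y], [z], [w]. *)
Lemma cutoff_defect_phi : `|dot f (cutoff A B f) + dot A B| <= (N * K + N + N * N * K) * (y + z + w).
Proof.
have -> : dot f (cutoff A B f) + dot A B =
   (dot (A - truncv A) B + dot (truncv A) (B - truncv B)) +
   dot (truncv A) (truncv B) * ((1 - dot f f) + dot f (f - truncv f)).
  by rewrite /cutoff dotZr !dotBl !dotBr; ring.
apply: le_trans (ler_normD _ _) _; rewrite normrM.
have h1 : `|dot (A - truncv A) B| <= N * (y * K).
  by apply: norm_dot_le_nat => //; exact: truncv_defect.
have h2 : `|dot (truncv A) (B - truncv B)| <= N * (1 * z).
  by apply: norm_dot_le_nat; [exact: truncv_le1|exact: truncv_defect].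
have h3 : `|dot f (f - truncv f)| <= N * (K * w).
  by apply: norm_dot_le_nat => //; exact: truncv_defect.
have h4 : `|1 - dot f f + dot f (f - truncv f)| <= w + N * (K * w).
  by apply: le_trans (ler_normD _ _) _; rewrite lerD// distrC.
have h5 : `|dot (truncv A) (truncv B)| * `|1 - dot f f + dot f (f - truncv f)| <= N * (w + N * (K * w)).
  by apply: ler_pM.
apply: le_trans (lerD (le_trans (ler_normD _ _) (lerD h1 h2)) h5) _.
have e1 : 0 <= N * K * w by rewrite !mulr_ge0.
have e2 : 0 <= N * K * z by rewrite !mulr_ge0.
have e3 : 0 <= N * y by rewrite !mulr_ge0.
have e4 : 0 <= N * N * K * y by rewrite !mulr_ge0.
have e5 : 0 <= N * N * K * z by rewrite !mulr_ge0.
rewrite -subr_ge0.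
have -> : (N * K + N + N * N * K) * (y + z + w) - (N * (y * K) + N * (1 * z) + N * (w + N * (K * w)))
  = N * K * w + N * K * z + N * y + N * N * K * y + N * N * K * z by ring.
by rewrite !addr_ge0.
Qed.

Lemma cutoff_defect (x : vec) (S : R) : (forall i, `|x ord0 i| <= K) -> `|dot f x| <= S ->
  `|dot x (cutoff A B f)| <= N * S + N * N * K * w.
Proof.
move=> xK xS; have -> : dot x (cutoff A B f) = - dot (truncv A) (truncv B) * (dot f x - dot x (f - truncv f)).
  by rewrite /cutoff dotZr dotBr [dot f x]dotC; ring.
rewrite normrM normrN.
have h3 : `|dot x (f - truncv f)| <= N * (K * w).
  by apply: norm_dot_le_nat => //; exact: truncv_defect.
have h4 : `|dot f x - dot x (f - truncv f)| <= S + N * (K * w).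
  by apply: le_trans (ler_normB _ _) _; rewrite lerD.
apply: (@le_trans _ _ (N * (S + N * (K * w)))); first exact: ler_pM.
by rewrite le_eqVlt; apply/orP; left; apply/eqP; ring.
Qed.

End constraint.

End cutoff.

Section normalize.
Context {R : realType} {n : nat}.
Local Notation mu := (@lebesgue_measure R).
Local Notation T := (measurableTypeR R).
Local Notation vec := 'rV[R]_n.

Lemma measurable_enorm d (X : measurableType d) (g : X -> vec) :
  (forall i, measurable_fun setT (fun x => g x ord0 i)) -> measurable_fun setT (fun x => enorm (g x)).
Proof.
move=> mg; have -> : (fun x => enorm (g x)) = (fun x => (dot (g x) (g x)) `^ 2^-1).
  by apply/funext => x; rewrite powR12_sqrt// dot_ge0.
apply: (measurableT_comp (measurable_powR _)).
have -> : (fun x => dot (g x) (g x)) = (fun x => \sum_i g x ord0 i * g x ord0 i).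
  by apply/funext => x; rewrite dotE.
by apply: measurable_sum => i; exact: measurable_funM.
Qed.

Lemma measurable_enorm_inv (g : R -> vec) : (forall i, measurable_fun [set: T] (fun x => g x ord0 i)) ->
  measurable_fun [set: T] (fun x => (enorm (g x))^-1).
Proof.
move=> mg; have -> : (fun x => (enorm (g x))^-1) = (fun x => (enorm (g x)) `^ (-1)).
  by apply/funext => x; rewrite powR_inv1// enorm_ge0.
exact: (measurableT_comp (measurable_powR _) (measurable_enorm mg)).
Qed.

Lemma dot_enorm (x : vec) : dot x x = enorm x ^+ 2.
Proof. by rewrite /enorm sqr_sqrtr// dot_ge0. Qed.

Lemma enorm0 (x : vec) : enorm x = 0 -> x = 0.
Proof.
move=> x0; apply/rowP => i; rewrite mxE; apply/eqP; rewrite -normr_eq0 eq_le normr_ge0 andbT.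
by rewrite -x0; exact: coord_le_enorm.
Qed.

Lemma sphere_curve_orth (p a : R -> vec) : is_vprimitive p a -> (forall x, dot (p x) (p x) = 1) ->
  {ae mu, forall x : R, 0 < x -> dot (p x) (a x) = 0}.
Proof.
move=> pa p1; have H1 := is_primitive_dot pa.
have : is_primitive (fun x => dot (p x) (p x)) (cst 0).
  have -> : (fun x => dot (p x) (p x)) = cst 1 by apply/funext => x; rewrite p1.
  exact: is_primitive_cst.
move=> /(is_primitive_unique H1); apply: aeS => x H x0.
have /eqP := H x0; rewrite mulf_eq0 pnatr_eq0/= => /eqP//.
Qed.

(** Separating the speed [m] from the direction [A] moves all unboundedness
    into the scalar weight [m]. The velocity is orthogonal to [p] only
    almost everywhere; it is set to zero on the exceptional set, which is
    measurable. *)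
Lemma normalized_curve (p a : R -> vec) : is_vprimitive p a -> (forall x, dot (p x) (p x) = 1) ->
  exists (m : R -> R) (A : R -> vec), [/\ L1 m /\ (forall x, 0 <= m x),
    forall i, measurable_fun [set: T] (fun x => A x ord0 i),
    forall x, dot (A x) (A x) <= 1, forall x, dot (p x) (A x) = 0 &
    is_vprimitive p (fun x => m x *: A x)].
Proof.
move=> pa p1; have La := is_vprimitive_L1 pa.
have ma i : measurable_fun [set: T] (fun x => a x ord0 i) := L1_measurable (La i).
have mp i : measurable_fun [set: T] (fun x => p x ord0 i) := is_primitive_measurable (pa i).
pose E : set T := [set x | dot (p x) (a x) = 0].
have mE : measurable E.
  have mD : measurable_fun [set: T] (fun x => dot (p x) (a x)).
    have -> : (fun x => dot (p x) (a x)) = (fun x => \sum_i p x ord0 i * a x ord0 i).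
      by apply/funext => x; rewrite dotE.
    by apply: measurable_sum => i; exact: measurable_funM.
  by have := mD measurableT [set 0] (measurable_set1 0); rewrite setTI.
pose a' x : vec := (\1_E x : R) *: a x.
have ma' i : measurable_fun [set: T] (fun x => a' x ord0 i).
  have -> : (fun x => a' x ord0 i) = (fun x => \1_E x * a x ord0 i).
    by apply/funext => x; rewrite mxE.
  by apply: measurable_funM => //; exact: measurable_indic.
have a'a i x : `|a' x ord0 i| <= `|a x ord0 i|.
  rewrite mxE indicE; case: (_ \in _); rewrite ?mul1r ?mul0r ?normr0//.
have La' : L1_vec a' by move=> i; exact: le_L1 (ma' i) (L1_norm (La i)) (a'a i).
exists (fun x => enorm (a' x)), (fun x => (enorm (a' x))^-1 *: a' x).
have scaleE x : enorm (a' x) *: ((enorm (a' x))^-1 *: a' x) = a' x.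
  have [e0|e0] := eqVneq (enorm (a' x)) 0; first by rewrite (enorm0 e0) !scaler0.
  by rewrite scalerA mulfV// scale1r.
split.
- split; last by move=> x; exact: enorm_ge0.
  apply: (le_L1 (measurable_enorm ma') (L1_l1 La')) => x.
  by rewrite ger0_norm ?enorm_ge0// enorm_le_l1.
- move=> i; have -> : (fun x => ((enorm (a' x))^-1 *: a' x) ord0 i) = (fun x => (enorm (a' x))^-1 * a' x ord0 i).
    by apply/funext => x; rewrite mxE.
  by apply: measurable_funM => //; exact: measurable_enorm_inv.
- move=> x; rewrite dotZl dotZr dot_enorm.
  have [->|e0] := eqVneq (enorm (a' x)) 0; first by rewrite invr0 mul0r.
  by rewrite expr2 mulKf// mulVf.
- move=> x; rewrite dotZr dotZr indicE.
  have [xE|xE] := boolP (x \in E); last by rewrite mul0r mulr0.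
  by rewrite (set_mem xE : dot (p x) (a x) = 0) !mulr0.
- have -> : (fun x => enorm (a' x) *: ((enorm (a' x))^-1 *: a' x)) = a'.
    by apply/funext => x.
  move=> i; split; first exact: La'.
  move=> x; have [_ ->] := pa i; congr (_ + _); apply: primitive_ae; [exact: La|exact: La'|].
  move: (sphere_curve_orth pa p1); apply: aeS => z Hz /andP[/Hz zE _].
  by rewrite mxE indicE mem_set// mul1r.
Qed.

End normalize.

Section existence.
Context {R : realType} {n : nat}.
Local Notation mu := (@lebesgue_measure R).
Local Notation T := (measurableTypeR R).
Local Notation vec := 'rV[R]_n.
Local Notation N := (n%:R : R).

Lemma cutoff_lip (A B f A' B' f' : vec) (S : R) i :
  (forall i, `|A ord0 i - A' ord0 i| <= S) -> (forall i, `|B ord0 i - B' ord0 i| <= S) ->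
  (forall i, `|f ord0 i - f' ord0 i| <= S) ->
  `|cutoff A B f ord0 i - cutoff A' B' f' ord0 i| <= 3 * N * S.
Proof.
move=> AS BS fS.
have TS (x y : vec) : (forall i, `|x ord0 i - y ord0 i| <= S) ->
    forall i, `|(truncv x - truncv y) ord0 i| <= S.
  move=> xy j; rewrite mxE [(- truncv y) _ _]mxE !truncvE.
  by apply: le_trans (trunc_lip _ _) _; exact: xy.
have -> : cutoff A B f ord0 i - cutoff A' B' f' ord0 i =
   - ((dot (truncv A - truncv A') (truncv B) + dot (truncv A') (truncv B - truncv B')) * truncv f ord0 i)
   - dot (truncv A') (truncv B') * (truncv f - truncv f') ord0 i.
  rewrite dotBl dotBr; rewrite /cutoff [(_ *: truncv f) _ _]mxE [(_ *: truncv f') _ _]mxE.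
  rewrite [(truncv f - _) _ _]mxE [(- truncv f') _ _]mxE; ring.
apply: le_trans (ler_normB _ _) _; rewrite normrN !normrM.
have h1 : `|dot (truncv A - truncv A') (truncv B)| <= N * (S * 1).
  by apply: norm_dot_le_nat; [exact: TS|exact: truncv_le1].
have h2 : `|dot (truncv A') (truncv B - truncv B')| <= N * (1 * S).
  by apply: norm_dot_le_nat; [exact: truncv_le1|exact: TS].
have h3 : `|dot (truncv A') (truncv B')| <= N * (1 * 1).
  by apply: norm_dot_le_nat; exact: truncv_le1.
have h4 := TS _ _ fS i.
have h5 := ler_pM (normr_ge0 _) (normr_ge0 _) (le_trans (ler_normD _ _) (lerD h1 h2)) (truncv_le1 f i).
have h6 := ler_pM (normr_ge0 _) (normr_ge0 _) h3 h4.
apply: le_trans (lerD h5 h6) _; rewrite le_eqVlt; apply/orP; left; apply/eqP; ring.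
Qed.

Lemma bounded2_dot (f g : R -> R -> vec) : (forall i, bounded2 (fun u v => f u v ord0 i)) ->
  (forall i, bounded2 (fun u v => g u v ord0 i)) -> bounded2 (fun u v => dot (f u v) (g u v)).
Proof.
move=> bf bg; have := bounded2_sum (fun i => bounded2M (bf i) (bg i)).
by congr bounded2; apply/funext => u; apply/funext => v; rewrite dotE.
Qed.

Lemma bounded2_cutoff (A B f : R -> R -> vec) : (forall i, bounded2 (fun u v => A u v ord0 i)) ->
  (forall i, bounded2 (fun u v => B u v ord0 i)) -> (forall i, bounded2 (fun u v => f u v ord0 i)) ->
  forall i, bounded2 (fun u v => cutoff (A u v) (B u v) (f u v) ord0 i).
Proof.
move=> bA bB bf i.
have bt (g : R -> R -> vec) : (forall i, bounded2 (fun u v => g u v ord0 i)) ->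
    forall i, bounded2 (fun u v => truncv (g u v) ord0 i).
  move=> bg j; have := bounded2_trunc (bg j).1.
  by congr bounded2; apply/funext => u; apply/funext => v; rewrite truncvE.
have := bounded2M (bounded2N (bounded2_dot (bt _ bA) (bt _ bB))) (bt _ bf i).
by congr bounded2; apply/funext => u; apply/funext => v; rewrite /cutoff [RHS]mxE.
Qed.

Lemma bounded2_unif (I : finType) (f : I -> R -> R -> R) : (forall i, bounded2 (f i)) ->
  exists2 K : R, 0 <= K & forall i u v, `|f i u v| <= K.
Proof.
move=> bf; pose B j := projT1 (cid2 (bf j).2).
have B0 j : 0 <= B j by rewrite /B; case: cid2.
exists (\sum_j B j); first exact: sumr_ge0.
move=> j u v; apply: (@le_trans _ _ (B j)); first by rewrite /B; case: cid2.
by rewrite (bigD1 j)//= lerDl sumr_ge0.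
Qed.

Lemma is_primitive_affine (g d : R -> R) (c : R) : L1 d ->
  (forall x, g x = c + primitive d x) -> is_primitive g d.
Proof.
move=> Ld gE; split=> // x; rewrite gE; congr (_ + _).
by rewrite gE primitive0 addr0.
Qed.

Lemma is_primitive_dot2 (f g f' g' : R -> vec) : is_vprimitive f g -> is_vprimitive f' g' ->
  is_primitive (fun x => dot (f x) (f' x)) (fun x => dot (f x) (g' x) + dot (f' x) (g x)).
Proof.
move=> H H'; have := is_primitive_sum (fun i => is_primitiveM (H i) (H' i)).
congr is_primitive; apply/funext => x; rewrite !dotE//.
by rewrite -big_split.
Qed.

Section constraint.
Variables (m k : R -> R) (p q A0 B0 : R -> vec) (A B f : R -> R -> vec).
Hypotheses (Lm : L1 m) (Lk : L1 k) (m0 : forall x, 0 <= m x) (k0 : forall x, 0 <= k x).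
Hypotheses (A01 : forall x, dot (A0 x) (A0 x) <= 1) (B01 : forall x, dot (B0 x) (B0 x) <= 1)
  (pA0 : forall x, dot (p x) (A0 x) = 0) (qB0 : forall x, dot (q x) (B0 x) = 0)
  (hp : is_vprimitive p (fun x => m x *: A0 x)) (hq : is_vprimitive q (fun x => k x *: B0 x))
  (pq : p 0 = q 0) (p1 : forall x, dot (p x) (p x) = 1)
  (mA0 : forall i, measurable_fun [set: T] (fun x => A0 x ord0 i))
  (mB0 : forall i, measurable_fun [set: T] (fun x => B0 x ord0 i)).
Hypotheses (bA : forall i, bounded2 (fun u v => A u v ord0 i))
  (bB : forall i, bounded2 (fun u v => B u v ord0 i))
  (bf : forall i, bounded2 (fun u v => f u v ord0 i)).
Let F u v := cutoff (A u v) (B u v) (f u v).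
Hypotheses
  (eA : forall i u v, A u v ord0 i = A0 u ord0 i + primitive (fun z => k z * F u z ord0 i) v)
  (eB : forall i u v, B u v ord0 i = B0 v ord0 i + primitive (fun w => m w * F w v ord0 i) u)
  (ef : forall i u v, f u v ord0 i = p u ord0 i + primitive (fun z => k z * B u z ord0 i) v).

Let bF : forall i, bounded2 (fun u v => F u v ord0 i) := bounded2_cutoff bA bB bf.

Let density (u v : R) : vec := (m u * k v) *: F u v.

Lemma kernel2_tensor : kernel2 (fun u v => m u * k v).
Proof.
have mm := L1_measurable Lm; have mk := L1_measurable Lk.
have mt : measurable2 (fun u v => m u * k v).
  by apply: measurable_funM; apply: measurableT_comp => //.
split => //; last first.
- by move=> v; have := L1Z (k v) Lm; congr L1; apply/funext => u; rewrite mulrC.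
- by move=> u; exact: L1Z.
have mE : measurable_fun setT (fun p : T * T => (m p.1 * k p.2)%:E) by exact/measurable_EFinP.
have [_] := @integrable12ltyP _ _ _ _ _ mu mu _ mE; apply => /=.
have kfin : (\int[mu]_y (k y)%:E = (total_integral k)%:E)%E.
  by rewrite /total_integral /Rintegral fineK// L1_fin.
have -> : (\int[mu]_x \int[mu]_y `|m x * k y|%:E = \int[mu]_x ((total_integral k)%:E * (m x)%:E))%E.
  apply: eq_integral => x _.
  under eq_integral do rewrite ger0_norm ?mulr_ge0// EFinM.
  rewrite ge0_integralZl_EFin//; last 2 first.
    by move=> y _; rewrite lee_fin.
    exact/measurable_EFinP.
  by rewrite kfin muleC.
have t0 : 0 <= total_integral k by exact: Rintegral_ge0.
rewrite ge0_integralZl_EFin//; last 2 first.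
  by move=> y _; rewrite lee_fin.
  exact/measurable_EFinP.
have -> : (\int[mu]_y (m y)%:E = (total_integral m)%:E)%E.
  by rewrite /total_integral /Rintegral fineK// L1_fin.
by rewrite -EFinM ltry.
Qed.

Lemma vkernel_density : vkernel density.
Proof.
move=> i; have [mF [K _ FK]] := bF i.
have := kernel2_Mbounded kernel2_tensor mF FK.
by congr kernel2; apply/funext => u; apply/funext => v; rewrite /density [RHS]mxE mulrC.
Qed.

Let densityE u v i : density u v ord0 i = m u * (k v * F u v ord0 i).
Proof. by rewrite /density mxE mulrA. Qed.

Let pf : forall u, is_vprimitive (f u) (fun z => k z *: B u z).
Proof.
move=> u i; have -> : (fun z => (k z *: B u z) ord0 i) = (fun z => k z * B u z ord0 i).
  by apply/funext => z; rewrite mxE.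
by apply: (is_primitive_affine (c := p u ord0 i)); [exact: (bounded2_L1r Lk u (bB i))|exact: ef].
Qed.

Let pA : forall u, is_vprimitive (A u) (fun z => k z *: F u z).
Proof.
move=> u i; have -> : (fun z => (k z *: F u z) ord0 i) = (fun z => k z * F u z ord0 i).
  by apply/funext => z; rewrite mxE.
by apply: (is_primitive_affine (c := A0 u ord0 i)); [exact: (bounded2_L1r Lk u (bF i))|exact: eA].
Qed.

Let pB : forall v, is_vprimitive (B ^~ v) (fun w => m w *: F w v).
Proof.
move=> v i; have -> : (fun z => (m z *: F z v) ord0 i) = (fun z => m z * F z v ord0 i).
  by apply/funext => z; rewrite mxE.
by apply: (is_primitive_affine (c := B0 v ord0 i)); [exact: (bounded2_L1l Lm v (bF i))|].
Qed.

Let B_primitive u v i : primitive (fun z => k z * B u z ord0 i) v =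
  primitive (fun z => k z * B0 z ord0 i) v + primitive2 (fun u v => density u v ord0 i) u v.
Proof.
have kd := vkernel_density i.
have Lq : L1 (fun z => k z * B0 z ord0 i).
  have := is_vprimitive_L1 hq i; congr L1; apply/funext => z; by rewrite mxE.
have E z : primitive (fun w => density w z ord0 i) u = k z * primitive (fun w => m w * F w z ord0 i) u.
  rewrite -primitiveZ; last exact: (bounded2_L1l Lm z (bF i)).
  by congr (primitive _ u); apply/funext => w; rewrite densityE; ring.
rewrite (primitive2_swap u v kd) /primitive2 -primitiveD//; last exact: (kernel2_primitive_L1' u kd).
by congr (primitive _ v); apply/funext => z; rewrite E eB; ring.
Qed.

Let f_mild u v i : f u v ord0 i = (p u + q v - p 0) ord0 i + primitive2 (fun u v => density u v ord0 i) u v.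
Proof.
rewrite ef B_primitive !mxE pq.
have -> : primitive (fun z => k z * B0 z ord0 i) v = q v ord0 i - q 0 ord0 i.
  have [_ ->] := hq i; rewrite addrC addKr; congr (primitive _ v).
  by apply/funext => z; rewrite mxE.
ring.
Qed.

Let pf' : forall v, is_vprimitive (f ^~ v) (fun w => m w *: A w v).
Proof.
move=> v i; have -> : (fun z => (m z *: A z v) ord0 i) = (fun z => m z * A z v ord0 i).
  by apply/funext => z; rewrite mxE.
apply: (is_primitive_affine (c := q v ord0 i)); first exact: (bounded2_L1l Lm v (bA i)).
move=> u; have Lp : L1 (fun z => m z * A0 z ord0 i).
  have := is_vprimitive_L1 hp i; congr L1; apply/funext => z; by rewrite mxE.
have kd := vkernel_density i.
have E w : primitive (fun z => density w z ord0 i) v = m w * primitive (fun z => k z * F w z ord0 i) v.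
  rewrite -primitiveZ; last exact: (bounded2_L1r Lk w (bF i)).
  by congr (primitive _ v); apply/funext => z; rewrite densityE.
have -> : primitive (fun w => m w * A w v ord0 i) u =
    primitive (fun z => m z * A0 z ord0 i) u + primitive2 (fun u v => density u v ord0 i) u v.
  rewrite /primitive2 -primitiveD//; last exact: (kernel2_primitive_L1 v kd).
  by congr (primitive _ u); apply/funext => z; rewrite E eA; ring.
have -> : primitive (fun z => m z * A0 z ord0 i) u = p u ord0 i - p 0 ord0 i.
  have [_ ->] := hp i; rewrite addrC addKr; congr (primitive _ u).
  by apply/funext => z; rewrite mxE.
rewrite f_mild !mxE; ring.
Qed.

Let f_u0 u : f u 0 = p u.
Proof. by apply/rowP => i; rewrite ef primitive0 addr0. Qed.
Let f_0v v : f 0 v = q v.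
Proof. by apply/rowP => i; have [_ /(_ 0)] := pf' v i; rewrite f_mild !mxE /primitive2 primitive0 addr0; move=> _; ring. Qed.
Let A_u0 u : A u 0 = A0 u.
Proof. by apply/rowP => i; rewrite eA primitive0 addr0. Qed.
Let B_0v v : B 0 v = B0 v.
Proof. by apply/rowP => i; rewrite eB primitive0 addr0. Qed.

Let P u v := dot (f u v) (A u v).
Let Q u v := dot (f u v) (B u v).
Let Y u v := dot (A u v) (A u v) - dot (A0 u) (A0 u).
Let Z u v := dot (B u v) (B u v) - dot (B0 v) (B0 v).
Let D u v := dot (f u v) (f u v) - 1.
Let S u v := dot (f u v) (F u v) + dot (A u v) (B u v).
Let X u v := `|P u v| + `|Q u v| + `|Y u v| + `|Z u v| + `|D u v|.

Let PE u v : P u v = int_v k S u v.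
Proof.
rewrite /P; have [_ ->] := is_primitive_dot2 (pf u) (pA u); rewrite f_u0 A_u0 pA0 add0r.
by rewrite /int_v /int_u; congr (primitive _ v); apply/funext => z; rewrite /S !dotZr mulrDr.
Qed.

Let QE u v : Q u v = int_u m S u v.
Proof.
rewrite /Q; have [_ ->] := is_primitive_dot2 (pf' v) (pB v); rewrite f_0v B_0v qB0 add0r.
by rewrite /int_v /int_u; congr (primitive _ u); apply/funext => z; rewrite /S !dotZr mulrDr [dot (B z v) _]dotC.
Qed.

Let YE u v : Y u v = int_v k (fun u v => 2 * dot (A u v) (F u v)) u v.
Proof.
rewrite /Y; have [_ ->] := is_primitive_dot (pA u); rewrite A_u0 addrC addKr.
by rewrite /int_v /int_u; congr (primitive _ v); apply/funext => z; rewrite dotZr; ring.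
Qed.

Let ZE u v : Z u v = int_u m (fun u v => 2 * dot (B u v) (F u v)) u v.
Proof.
rewrite /Z; have [_ ->] := is_primitive_dot (pB v); rewrite B_0v addrC addKr.
by rewrite /int_v /int_u; congr (primitive _ u); apply/funext => z; rewrite dotZr; ring.
Qed.

Let DE u v : D u v = int_v k (fun u v => 2 * Q u v) u v.
Proof.
rewrite /D; have [_ ->] := is_primitive_dot (pf u); rewrite f_u0 p1 addrC addKr.
by rewrite /int_v /int_u; congr (primitive _ v); apply/funext => z; rewrite dotZr /Q; ring.
Qed.

Let bP : bounded2 P. Proof. exact: bounded2_dot. Qed.
Let bQ : bounded2 Q. Proof. exact: bounded2_dot. Qed.
Let bS : bounded2 S. Proof. by apply: bounded2D; exact: bounded2_dot. Qed.
Let bA0 i : bounded2 (fun u _ => A0 u ord0 i).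
Proof.
split; first by apply: (measurableT_comp (mA0 i)).
exists 1 => // u _; apply: le_trans (coord_le_enorm _ _) _.
by rewrite /enorm -[leRHS]sqrtr1 ler_wsqrtr.
Qed.
Let bB0 i : bounded2 (fun _ v => B0 v ord0 i).
Proof.
split; first by apply: (measurableT_comp (mB0 i)).
exists 1 => // _ u; apply: le_trans (coord_le_enorm _ _) _.
by rewrite /enorm -[leRHS]sqrtr1 ler_wsqrtr.
Qed.
Let bY : bounded2 Y.
Proof.
apply: bounded2D; first exact: bounded2_dot.
by apply: bounded2N; apply: (bounded2_dot (f := fun u _ => A0 u) (g := fun u _ => A0 u)).
Qed.
Let bZ : bounded2 Z.
Proof.
apply: bounded2D; first exact: bounded2_dot.
by apply: bounded2N; apply: (bounded2_dot (f := fun _ u => B0 u) (g := fun _ u => B0 u)).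
Qed.
Let bD : bounded2 D.
Proof. by apply: bounded2D; [exact: bounded2_dot|exact: bounded2_cst]. Qed.
Let bX : bounded2 X.
Proof. by do ?[apply: bounded2D]; exact: bounded2_norm. Qed.

Let int_v_le g (C : R) u v : bounded2 g -> (forall u v, `|g u v| <= C * X u v) ->
  `|int_v k g u v| <= C * int_v k X u v.
Proof.
move=> bg gC; apply: le_trans (norm_primitive _ (bounded2_L1r Lk u bg)) _.
rewrite /int_v -primitiveZ; last exact: (bounded2_L1r Lk u bX).
apply: le_primitive; [exact: L1_norm (bounded2_L1r Lk u bg)|exact: L1Z (bounded2_L1r Lk u bX)|].
by move=> z _ _; rewrite normrM ger0_norm// mulrCA ler_wpM2l.
Qed.

Let int_u_le g (C : R) u v : bounded2 g -> (forall u v, `|g u v| <= C * X u v) ->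
  `|int_u m g u v| <= C * int_u m X u v.
Proof.
move=> bg gC; apply: le_trans (norm_primitive _ (bounded2_L1l Lm v bg)) _.
rewrite /int_u -primitiveZ; last exact: (bounded2_L1l Lm v bX).
apply: le_primitive; [exact: L1_norm (bounded2_L1l Lm v bg)|exact: L1Z (bounded2_L1l Lm v bX)|].
by move=> z _ _; rewrite normrM ger0_norm// mulrCA ler_wpM2l.
Qed.

(** Each of the five constraint defects is zero on one of the initial
    characteristics, and its derivative away from it is bounded linearly by
    their sum [X], because the truncation errors are; so [goursat_gronwall]
    applies. *)
Lemma constraint_defect u v : X u v = 0.
Proof.
have [KA KA0 HKA] := bounded2_unif bA; have [KB KB0 HKB] := bounded2_unif bB.
have [Kf Kf0 HKf] := bounded2_unif bf.
pose K := 1 + KA + KB + Kf.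
have K1 : 1 <= K by rewrite /K; lra.
have AK u' v' i : `|A u' v' ord0 i| <= K by apply: le_trans (HKA i u' v') _; rewrite /K; lra.
have BK u' v' i : `|B u' v' ord0 i| <= K by apply: le_trans (HKB i u' v') _; rewrite /K; lra.
have fK u' v' i : `|f u' v' ord0 i| <= K by apply: le_trans (HKf i u' v') _; rewrite /K; lra.
have X0 u' v' : 0 <= X u' v' by rewrite /X !addr_ge0.
have Ay u' v' : dot (A u' v') (A u' v') - 1 <= `|Y u' v'|.
  apply: le_trans (ler_norm _); rewrite /Y lerD2l lerN2; exact: A01.
have Bz u' v' : dot (B u' v') (B u' v') - 1 <= `|Z u' v'|.
  apply: le_trans (ler_norm _); rewrite /Z lerD2l lerN2; exact: B01.
have N0 : 0 <= N by exact: ler0n.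
have K0 : 0 <= K by exact: le_trans ler01 K1.
pose C1 := N * K + N + N * N * K.
have C10 : 0 <= C1 by rewrite /C1 !addr_ge0// !mulr_ge0.
have SX u' v' : `|S u' v'| <= C1 * X u' v'.
  apply: le_trans (cutoff_defect_phi K1 (BK u' v') (fK u' v') (normr_ge0 (Y u' v'))
    (normr_ge0 (Z u' v')) (normr_ge0 (D u' v')) (Ay u' v') (Bz u' v') (lexx _)) _.
  rewrite ler_wpM2l// /X -!addrA [leRHS]addrA lerDr addr_ge0//.
have FX (x : R -> R -> vec) u' v' : (forall i, `|x u' v' ord0 i| <= K) ->
    `|dot (f u' v') (x u' v')| <= X u' v' -> `|2 * dot (x u' v') (F u' v')| <= 2 * (N + N * N * K) * X u' v'.
  move=> xK sX; rewrite normrM ger0_norm// -mulrA ler_wpM2l//.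
  apply: le_trans (cutoff_defect (A u' v') (B u' v') (normr_ge0 (D u' v')) (lexx _) xK sX) _.
  have DX : `|D u' v'| <= X u' v' by rewrite /X lerDr !addr_ge0.
  by rewrite mulrDl lerD// ler_wpM2l// !mulr_ge0.
have PX u' v' : `|P u' v'| <= X u' v' by rewrite /X -!addrA lerDl !addr_ge0.
have QX u' v' : `|Q u' v'| <= X u' v'.
  by rewrite /X [`|P _ _| + _]addrC -!addrA lerDl !addr_ge0.
pose C2 := 2 * (N + N * N * K).
have C20 : 0 <= C2 by rewrite /C2 !mulr_ge0// addr_ge0// !mulr_ge0.
pose C := C1 + C2 + 2.
have C1C : C1 <= C by rewrite /C; lra.
have C2C : C2 <= C by rewrite /C; lra.
have CC : 2 <= C by rewrite /C; lra.
have lC (c : R) u' v' : c <= C -> c * X u' v' <= C * X u' v' by move=> h; rewrite ler_wpM2r.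
have iv u' v' : 0 <= int_v k X u' v' by apply: primitive_ge0 => z; rewrite mulr_ge0.
have iu u' v' : 0 <= int_u m X u' v' by apply: primitive_ge0 => z; rewrite mulr_ge0.
apply: (@goursat_gronwall _ m k Lm Lk m0 k0 X (3 * C)) => //.
  by rewrite /C; lra.
move=> {}u {}v.
have hP : `|P u v| <= C * int_v k X u v.
  by rewrite PE; apply: int_v_le => // *; apply: le_trans (SX _ _) (lC _ _ _ C1C).
have hQ : `|Q u v| <= C * int_u m X u v.
  by rewrite QE; apply: int_u_le => // *; apply: le_trans (SX _ _) (lC _ _ _ C1C).
have bAF : bounded2 (fun u v => 2 * dot (A u v) (F u v)).
  by apply: bounded2M; [exact: bounded2_cst|exact: bounded2_dot].
have bBF : bounded2 (fun u v => 2 * dot (B u v) (F u v)).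
  by apply: bounded2M; [exact: bounded2_cst|exact: bounded2_dot].
have hY : `|Y u v| <= C * int_v k X u v.
  rewrite YE; apply: int_v_le => // u' v'; apply: le_trans (lC _ _ _ C2C).
  by apply: FX; [exact: AK|exact: PX].
have hZ : `|Z u v| <= C * int_u m X u v.
  rewrite ZE; apply: int_u_le => // u' v'; apply: le_trans (lC _ _ _ C2C).
  by apply: FX; [exact: BK|exact: QX].
have hD : `|D u v| <= C * int_v k X u v.
  rewrite DE; apply: int_v_le; first by apply: bounded2M; [exact: bounded2_cst|].
  move=> u' v'; apply: le_trans (lC _ _ _ CC); rewrite normrM ger0_norm// ler_wpM2l//.
have C0 : 0 <= C by lra.
have := mulr_ge0 C0 (iu u v); have := mulr_ge0 C0 (iv u v).
rewrite /X; lra.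
Qed.

(** Once the constraints hold, all vectors lie in the unit ball and the
    truncation is the identity, so that the solution of the modified system
    solves the original one. *)
Lemma cutoff_solution_mild_wave :
  mild_wave p q (fun x => m x *: A0 x) (fun x => k x *: B0 x) (fun u v => - density u v) f.
Proof.
have sumX0 u v : [/\ Y u v = 0, Z u v = 0 & D u v = 0].
  have := constraint_defect u v; rewrite /X.
  have := normr_ge0 (P u v); have := normr_ge0 (Q u v); have := normr_ge0 (Y u v).
  have := normr_ge0 (Z u v); have := normr_ge0 (D u v) => h1 h2 h3 h4 h5 h6.
  by split; apply/eqP; rewrite -normr_eq0; apply/eqP; lra.
have sph u v : dot (f u v) (f u v) = 1.
  by have [_ _ /eqP] := sumX0 u v; rewrite subr_eq0 => /eqP.
have TA u v : truncv (A u v) = A u v.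
  by apply: truncv_id; have [/eqP + _ _] := sumX0 u v; rewrite subr_eq0 => /eqP ->.
have TB u v : truncv (B u v) = B u v.
  by apply: truncv_id; have [_ /eqP + _] := sumX0 u v; rewrite subr_eq0 => /eqP ->.
have Tf u v : truncv (f u v) = f u v by apply: truncv_id; rewrite sph.
have FE u v : F u v = - dot (A u v) (B u v) *: f u v by rewrite /F /cutoff TA TB Tf.
have kd := vkernel_density.
have kN : vkernel (fun u v => - density u v).
  move=> i; have := kernel2B kernel2_0 (kd i); congr kernel2.
  by apply/funext => u; apply/funext => v; rewrite [RHS]mxE sub0r.
split => //.
- move=> u v; apply/rowP => i.
  have -> : vprimitive2 (fun u v => - density u v) u v = - vprimitive2 density u v.
    have k0v : vkernel (fun _ _ : R => 0 : vec).
      by move=> j; have := @kernel2_0 R; congr kernel2; apply/funext => ?; apply/funext => ?; rewrite mxE.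
    have := vprimitive2B u v k0v kd.
    have -> : vprimitive2 (fun _ _ : R => 0 : vec) u v = 0.
      apply/rowP => j; rewrite vprimitive2E [RHS]mxE.
      have -> : (fun _ _ : R => (0 : vec) ord0 j) = (fun _ _ : R => 0 : R).
        by apply/funext => ?; apply/funext => ?; rewrite mxE.
      by rewrite /primitive2 /primitive /Rintegral !integral0.
    rewrite sub0r => <-; congr (vprimitive2 _ u v).
    by apply/funext => ?; apply/funext => ?; rewrite sub0r.
  rewrite opprK f_mild [RHS]mxE; congr (_ + _); exact/esym/vprimitive2E.
- apply: aeW => -[u v] /= _ _.
  have -> : char_u (fun x => m x *: A0 x) (fun u v => - density u v) u v = m u *: A u v.
    apply/rowP => i; rewrite /char_u !mxE eA mulrDr; congr (_ + _).
    rewrite -primitiveZ; last exact: (bounded2_L1r Lk u (bF i)).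
    rewrite -mulN1r -primitiveZ; last exact: (kernel2_L1r (kN i) u).
    congr (primitive _ v); apply/funext => z; rewrite mxE densityE; ring.
  have -> : char_v (fun x => k x *: B0 x) (fun u v => - density u v) u v = k v *: B u v.
    apply/rowP => i; rewrite /char_v !mxE eB mulrDr; congr (_ + _).
    rewrite -primitiveZ; last exact: (bounded2_L1l Lm v (bF i)).
    rewrite -mulN1r -primitiveZ; last exact: (kernel2_L1l (kN i) v).
    congr (primitive _ u); apply/funext => z; rewrite mxE densityE; ring.
  by rewrite dotZl dotZr /density FE scalerA -scaleNr; congr (_ *: _); ring.
Qed.

End constraint.

(** The system for the directions [A], [B] and the map [phi] is [A_v = k F],
    [B_u = m F], [phi_v = k B], with [F] the cutoff of [- (A . B) phi]. Its
    unknowns are indexed by [Some true], [Some false] and [None]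
    respectively. *)
Theorem mild_wave_exists (p q a b : R -> vec) : is_vprimitive p a -> is_vprimitive q b -> p 0 = q 0 ->
  (forall x, dot (p x) (p x) = 1) -> (forall x, dot (q x) (q x) = 1) ->
  exists a' b' G phi, mild_wave p q a' b' G phi.
Proof.
move=> pa qb pq p1 q1.
have [m [A0 [[Lm m0] mA0 A01 pA0 hp]]] := normalized_curve pa p1.
have [k [B0 [[Lk k0] mB0 B01 qB0 hq]]] := normalized_curve qb q1.
pose J := (option bool * 'I_n)%type.
pose blk (o : option bool) (X : J -> R) : vec := \row_i X (o, i).
pose cut X := cutoff (blk (Some true) X) (blk (Some false) X) (blk None X).
pose F1 (j : J) (X : J -> R) : R := match j.1 with
  | Some true => cut X ord0 j.2 | Some false => 0 | None => X (Some false, j.2) end.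
pose F2 (j : J) (X : J -> R) : R := if j.1 is Some false then cut X ord0 j.2 else 0.
pose X0 (j : J) (u v : R) : R := match j.1 with
  | Some true => A0 u ord0 j.2 | Some false => B0 v ord0 j.2 | None => p u ord0 j.2 end.
have N0 : 0 <= N by exact: ler0n.
pose L := 3 * N + 1; have L0 : 0 <= L by rewrite addr_ge0// mulr_ge0.
have coord_le (X Y : J -> R) j : `|X j - Y j| <= \sum_k `|X k - Y k|.
  by rewrite (bigD1 j)//= lerDl sumr_ge0.
have sum_ge (X Y : J -> R) : 0 <= \sum_k `|X k - Y k| by exact: sumr_ge0.
have cut_lip (X Y : J -> R) i : `|cut X ord0 i - cut Y ord0 i| <= L * \sum_k `|X k - Y k|.
  have blk_le o j : `|blk o X ord0 j - blk o Y ord0 j| <= \sum_k `|X k - Y k|.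
    by rewrite !mxE; exact: (coord_le X Y (o, j)).
  apply: le_trans (cutoff_lip i (blk_le _) (blk_le _) (blk_le _)) _.
  by rewrite ler_wpM2r// lerDl.
have lip1 j X Y : `|F1 j X - F1 j Y| <= L * \sum_k `|X k - Y k|.
  case: j => -[[]|] i; rewrite /F1/=; first exact: cut_lip.
    by rewrite subrr normr0 mulr_ge0.
  apply: le_trans (coord_le X Y _) _; rewrite ler_peMl//.
  by rewrite lerDr mulr_ge0.
have lip2 j X Y : `|F2 j X - F2 j Y| <= L * \sum_k `|X k - Y k|.
  by case: j => -[[]|] i; rewrite /F2/=; [|exact: cut_lip|]; rewrite subrr normr0 mulr_ge0.
have bcut (X : J -> R -> R -> R) : (forall j, bounded2 (X j)) ->
    forall i, bounded2 (fun u v => cut (X ^~ u ^~ v) ord0 i).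
  move=> bX i; have bblk o j : bounded2 (fun u v => blk o (X ^~ u ^~ v) ord0 j).
    have := bX (o, j); congr bounded2.
    by apply/funext => u; apply/funext => v; rewrite mxE.
  exact: (bounded2_cutoff (bblk _) (bblk _) (bblk _)).
have bF1 (X : J -> R -> R -> R) : (forall j, bounded2 (X j)) ->
    forall j, bounded2 (fun u v => F1 j (X ^~ u ^~ v)).
  move=> bX [[[]|] i]; rewrite /F1/=; [exact: bcut|exact: bounded2_cst|exact: bX].
have bF2 (X : J -> R -> R -> R) : (forall j, bounded2 (X j)) ->
    forall j, bounded2 (fun u v => F2 j (X ^~ u ^~ v)).
  by move=> bX [[[]|] i]; rewrite /F2/=; [exact: bounded2_cst|exact: bcut|exact: bounded2_cst].
have unit_bound (C : vec) i : dot C C <= 1 -> `|C ord0 i| <= 1.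
  move=> C1; apply: le_trans (coord_le_enorm _ _) _.
  by rewrite /enorm -[leRHS]sqrtr1 ler_wsqrtr.
have bX0 j : bounded2 (X0 j).
  case: j => -[[]|] i; rewrite /X0/=; split.
  - exact: (measurableT_comp (mA0 i)).
  - by exists 1 => // u _; exact: unit_bound.
  - exact: (measurableT_comp (mB0 i)).
  - by exists 1 => // _ v; exact: unit_bound.
  - exact: (measurableT_comp (is_primitive_measurable (hp i))).
  - by exists 1 => // u _; apply: unit_bound; rewrite p1.
have [X [bX XE]] := goursat_solution Lm Lk m0 k0 L0 lip1 lip2 bF1 bF2 bX0.
pose V o u v := blk o (X ^~ u ^~ v).
have bV o i : bounded2 (fun u v => V o u v ord0 i).
  have := bX (o, i); congr bounded2.
  by apply/funext => u; apply/funext => v; rewrite mxE.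
have V0 : int_v k (fun _ _ : R => 0) = (fun _ _ => 0).
  apply/funext => u; apply/funext => v; rewrite /int_v /primitive.
  under eq_Rintegral do rewrite mulr0.
  by rewrite /Rintegral integral0.
have U0 : int_u m (fun _ _ : R => 0) = (fun _ _ => 0).
  apply/funext => u; apply/funext => v; rewrite /int_u /primitive.
  under eq_Rintegral do rewrite mulr0.
  by rewrite /Rintegral integral0.
exists (fun x => m x *: A0 x), (fun x => k x *: B0 x),
  (fun u v => - ((m u * k v) *: cutoff (V (Some true) u v) (V (Some false) u v) (V None u v))), (V None).
apply: (cutoff_solution_mild_wave Lm Lk m0 k0 A01 B01 pA0 qB0 hp hq pq p1 mA0 mB0 (bV _) (bV _) (bV _)).
- by move=> i u v; rewrite [LHS]mxE XE /picard_step /X0 /F1 /F2/= U0 addr0.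
- by move=> i u v; rewrite [LHS]mxE XE /picard_step /X0 /F1 /F2/= V0 addr0.
- move=> i u v; rewrite [LHS]mxE XE /picard_step /X0 /F1 /F2/= U0 addr0; congr (_ + _).
  by rewrite /int_v; congr (primitive _ v); apply/funext => z; rewrite [V _ _ _ _ _]mxE.
Qed.

End existence.

(** * Wave maps and mild wave maps *)

Section clamp.
Context {R : realType}.
Implicit Types (b x y : R).

(** Composition with [clamp b] extends a curve on [[0, b]] by its end
    values. *)
Definition clamp b x := Num.min b (Num.max 0 x).

Lemma clamp_in b x : 0 <= b -> 0 <= clamp b x <= b.
Proof. by move=> b0; rewrite /clamp le_min b0 le_max lexx/= ge_min lexx. Qed.

Lemma clamp_id b x : 0 <= x <= b -> clamp b x = x.
Proof. by move=> /andP[x0 xb]; rewrite /clamp (max_idPr x0) (min_idPr xb). Qed.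

Lemma clamp_homo b : {homo clamp b : x y / x <= y}.
Proof. by move=> x y xy; rewrite /clamp le_min !ge_min lexx/= max0_homo ?orbT. Qed.

Lemma clamp_contract b x y : x <= y -> clamp b y - clamp b x <= y - x.
Proof.
move=> xy; apply: le_trans (max0_contract xy).
by rewrite /clamp /Num.min; case: ltP => ?; case: ltP => ?; have := max0_homo xy; lra.
Qed.

Lemma primitive_clamp (g : R -> R) b x : 0 <= b -> L1 g -> (forall z, b < z -> g z = 0) ->
  primitive g (clamp b x) = primitive g x.
Proof.
move=> b0 Lg g0; have [x0|/ltW x0] := lerP 0 x; last first.
  by rewrite /clamp (max_idPl x0) (min_idPr b0) primitive0 primitive_lt0.
have [xb|/ltW bx] := lerP x b; first by rewrite clamp_id// x0.
by rewrite /clamp (max_idPr x0) (min_idPl bx); apply/esym/primitive_const.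
Qed.

End clamp.

Section boundary_curves.
Context {R : realType} {n : nat}.
Local Notation mu := (@lebesgue_measure R).
Local Notation T := (measurableTypeR R).
Local Notation vec := 'rV[R]_n.
Implicit Types (f g : R -> vec) (b : R).

Lemma apart_disjoint (x y : R * R) : apart x y ->
  [set` `]x.1, x.2[] `&` [set` `]y.1, y.2[] = set0 :> set R.
Proof.
move=> xy; rewrite -subset0 => z; rewrite /= !in_itv/= => -[/andP[z1 z2] /andP[z3 z4]].
by case/orP: xy => h; lra.
Qed.

(** Clamping the intervals keeps them nonoverlapping and shortens them, so
    that they form an admissible family inside [[0, b]]. *)
Lemma absolutely_continuous_coord f b i : 0 <= b -> absolutely_continuous 0 b f ->
  abs_cont (fun x => f (clamp b x) ord0 i).
Proof.
move=> b0 acf e e0; have [dl dl0 H] := acf _ e0; exists dl => // p pn pd.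
have [] := nonoverlapping_clamp (@clamp_homo _ b) (@clamp_contract _ b) pn.
set r := map _ p => /andP[r1 r2] rp.
have rin x : x \in r -> 0 <= x.1 /\ x.1 <= x.2 /\ x.2 <= b.
  move=> xr; have := allP r1 _ xr; move: xr => /mapP[y _ ->]/= ->.
  by have /andP[-> _] := clamp_in y.1 b0; have /andP[_ ->] := clamp_in y.2 b0.
pose s (j : 'I_(size r)) := (nth (0, 0) r j).1; pose t (j : 'I_(size r)) := (nth (0, 0) r j).2.
have jr (j : 'I_(size r)) : nth (0, 0) r j \in r by rewrite mem_nth.
have := H _ s t (fun j => rin _ (jr j)); have -> : \sum_(j < size r) (t j - s j) = \sum_(x <- r) (x.2 - x.1).
  by rewrite (big_nth (0, 0)) big_mkord.
move=> /(_ _ (le_lt_trans rp pd)) => h; apply: ltW; apply: le_lt_trans (h _); last first.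
  apply/trivIsetP => j k _ _ jk; apply: apart_disjoint.
  have {}r2 := pairwiseP (0, 0) r2.
  have [jk'|kj|/val_inj jk'] := ltngtP j k; last by rewrite jk' eqxx in jk.
    by apply: r2 => //; rewrite inE ltn_ord.
  by rewrite apartC; apply: r2 => //; rewrite inE ltn_ord.
rewrite [leRHS](_ : _ = \sum_(x <- r) enorm (f x.2 - f x.1)); last first.
  by rewrite (big_nth (0, 0)) big_mkord.
rewrite big_map; apply: ler_sum => x _ /=.
by apply: le_trans (coord_le_enorm _ i); rewrite !mxE.
Qed.

Lemma is_derive_vec f (x : R) (l : vec) : (forall i, is_derive x 1 (fun w => f w ord0 i) (l ord0 i)) ->
  is_derive x 1 f l.
Proof.
move=> H; have df : derivable f x 1.
  by apply/derivable_mxP => i j; rewrite (ord1 i); have [] := H j.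
apply: DeriveDef => //; rewrite derive_mx//; apply/rowP => i; rewrite mxE.
by have [_ <-] := H i.
Qed.

End boundary_curves.

Section waves.
Context {R : realType} {d : nat}.
Local Notation mu := (@lebesgue_measure R).
Local Notation T := (measurableTypeR R).
Local Notation vec := 'rV[R]_d.+1.
Implicit Types (p q a b f : R -> vec) (G phi psi : R -> R -> vec).

Lemma near_in_itv (u u0 : R) : 0 < u < u0 -> \forall w \near u, 0 <= w <= u0.
Proof.
move=> u01; have := @near_in_itvoo R 0 u0 u; rewrite in_itv/= => /(_ u01).
by apply: filterS => w; rewrite in_itv/= => /andP[/ltW-> /ltW->].
Qed.

Lemma is_derive_near f g (u : R) (l : vec) : (\forall w \near u, f w = g w) ->
  is_derive u 1 g l -> is_derive u 1 f l.
Proof.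
move=> fg [dg <-]; have gf : {near u, g =1 f} by move: fg; apply: filterS.
apply: DeriveDef; first exact: near_eq_derivable gf dg.
by apply/esym/near_eq_derive.
Qed.

(** The derivative of the data, as an everywhere defined integrable function
    that vanishes outside the interval. *)
Lemma boundary_curve f (b : R) : 0 < b -> absolutely_continuous 0 b f ->
  exists a, [/\ is_vprimitive (f \o clamp b) a, (forall x, ~ (0 <= x <= b) -> a x = 0) &
    {ae mu, forall x : R, 0 < x < b -> derive1 f x = a x}].
Proof.
move=> b0 acf; have bge0 := ltW b0.
have H i : exists2 g, is_primitive (fun x => f (clamp b x) ord0 i) g & (forall x, ~ (0 <= x <= b) -> g x = 0).
  apply: AC_clamp_is_primitive => //; first exact: absolutely_continuous_coord.
  by move=> x; rewrite [clamp b (Num.min _ _)]clamp_id// clamp_in.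
pose g i := projT1 (cid2 (H i)).
have gp i : is_primitive (fun x => f (clamp b x) ord0 i) (g i) by rewrite /g; case: cid2.
have g0 i x : ~ (0 <= x <= b) -> g i x = 0 by rewrite /g; case: cid2 => //= ? _; exact.
exists (fun x => \row_i g i x); split.
- move=> i; have -> // : (fun x => (\row_j g j x) ord0 i) = g i.
  by apply/funext => x; rewrite mxE.
- by move=> x /g0 gx; apply/rowP => i; rewrite !mxE gx.
have := ae_forall_fin (fun i => is_primitive_derive (gp i)).
apply: aeS => x Hx xb.
have D : is_derive x 1 (f \o clamp b) (\row_i g i x).
  apply: is_derive_vec => i; rewrite mxE; apply: Hx.
  by case/andP: xb.
have D' : is_derive x 1 f (\row_i g i x).
  apply: is_derive_near D; move: (near_in_itv xb); apply: filterS => w wb /=.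
  by rewrite clamp_id.
by rewrite derive1E; apply: derive_val.
Qed.

Lemma wave_has_d_u p q a G phi phi' (u0 v0 : R) :
  is_vprimitive p a -> vkernel G -> (forall u v, phi' u v = p u + q v - p 0 - vprimitive2 G u v) ->
  (forall u v, 0 <= u <= u0 -> 0 <= v <= v0 -> phi u v = phi' u v) ->
  {ae mu, forall u : R, 0 < u < u0 -> forall v, 0 <= v <= v0 ->
    has_d_u phi u v /\ d_u phi u v = char_u a G u v}.
Proof.
move=> hp kG phiE pp; have := mild_formula_derive hp kG phiE.
apply: aeS => u H uu v vv.
have D : is_derive u 1 (fun w => phi w v) (char_u a G u v).
  apply: (@is_derive_near _ (fun w => phi' w v)).
    by move: (near_in_itv uu); apply: filterS => w wu; exact: pp.
  by apply: is_derive_vec => i; apply: H; case/andP: uu.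
split; first exact: ex_derive.
by rewrite /d_u derive1E; apply: derive_val.
Qed.

Lemma ae_neq (x0 : R) : {ae mu, forall x : R, x <> x0}.
Proof.
exists [set x0]; split => //; first exact: lebesgue_measure_set1.
by move=> x /= /contrapT ->.
Qed.

Lemma ae_itv_interior (P : R -> Prop) (u0 : R) : {ae mu, forall x : R, 0 < x < u0 -> P x} ->
  {ae mu, forall x : R, 0 <= x <= u0 -> P x}.
Proof.
move: (ae_neq 0) (ae_neq u0); apply: aeS3 => x /eqP x0 /eqP xu H /andP[x1 x2].
by apply: H; rewrite !lt_neqAle eq_sym x0 x1 xu x2.
Qed.

(** Derivatives in the plane are known at interior points only; the boundary
    of the rectangle is a null set. *)
Lemma ae_rect_interior (P : R * R -> Prop) (u0 v0 : R) :
  {ae leb2 R, forall p : R * R, 0 < p.1 < u0 -> 0 < p.2 < v0 -> P p} ->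
  {ae leb2 R, forall p : R * R, rect u0 v0 p -> P p}.
Proof.
have h (x y : R) : x <> 0 -> x <> y -> 0 <= x <= y -> 0 < x < y.
  by move=> /eqP x0 /eqP xy /andP[x1 x2]; rewrite !lt_neqAle eq_sym x0 x1 xy x2.
have N0 u : {ae mu, forall x : R, x <> 0 /\ x <> u}.
  by move: (ae_neq 0) (ae_neq u); apply: aeS2.
move: (ae_fst (N0 u0)) (ae_snd (N0 v0)); apply: aeS3 => -[u v] /= [u1 u2] [v1 v2] H [].
by rewrite /= !in_itv/= => uu vv; apply: H; exact: h.
Qed.

Lemma rectE (u0 v0 u v : R) : rect u0 v0 (u, v) <-> 0 <= u <= u0 /\ 0 <= v <= v0.
Proof. by rewrite /rect/=; split => -[]; rewrite /= !in_itv. Qed.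

Lemma ae_rect_fst (P : R -> R -> Prop) (u0 v0 : R) :
  {ae mu, forall u : R, 0 < u < u0 -> forall v, 0 <= v <= v0 -> P u v} ->
  {ae leb2 R, forall p : R * R, rect u0 v0 p -> P p.1 p.2}.
Proof.
move=> /ae_fst H; apply: ae_rect_interior; move: H; apply: aeS => -[u v] /= H uu /andP[v1 v2].
by apply: H => //; rewrite !ltW.
Qed.

Lemma ae_rect_snd (P : R -> R -> Prop) (u0 v0 : R) :
  {ae mu, forall v : R, 0 < v < v0 -> forall u, 0 <= u <= u0 -> P u v} ->
  {ae leb2 R, forall p : R * R, rect u0 v0 p -> P p.1 p.2}.
Proof.
move=> /ae_snd H; apply: ae_rect_interior; move: H; apply: aeS => -[u v] /= H /andP[v1 v2] uu.
by apply: H => //; rewrite !ltW.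
Qed.

(** Replaces the possibly nonmeasurable nonlinearity by a kernel. *)
Lemma vec_double_integral_ae G (f : R -> R -> vec) (u0 v0 u v : R) :
  {ae leb2 R, forall p : R * R, rect u0 v0 p -> f p.1 p.2 = G p.1 p.2} ->
  u <= u0 -> v <= v0 -> vec_double_integral u v f = vprimitive2 G u v.
Proof.
move=> fG uu0 vv0; apply/rowP => i; rewrite mxE vprimitive2E /primitive2 {1}/primitive.
rewrite {1}/Rintegral [RHS]/Rintegral; congr fine; apply: integral_ae_congr.
have := ae_xsection fG; apply: aeS => w H; rewrite /= in_itv/= => /andP[w0 wu].
congr EFin; rewrite /primitive /Rintegral; congr fine; apply: integral_ae_congr.
move: H; apply: aeS => z H; rewrite /= in_itv/= => /andP[z0 zv].
rewrite H//; apply/rectE; rewrite w0 z0 (le_trans wu uu0) (le_trans zv vv0); split => //.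
Qed.

Lemma sphere_dot (x : vec) : sphere x <-> dot x x = 1.
Proof.
rewrite /sphere/= /enorm; split=> [h|->]; last exact: sqrtr1.
by rewrite -[LHS]sqr_sqrtr ?dot_ge0// h expr1n.
Qed.

Lemma vprimitive2_clamp G (u0 v0 u v : R) : 0 <= u0 -> 0 <= v0 -> vkernel G ->
  (forall u v, ~ rect u0 v0 (u, v) -> G u v = 0) ->
  vprimitive2 G (clamp u0 u) (clamp v0 v) = vprimitive2 G u v.
Proof.
move=> u00 v00 kG G0; apply/rowP => i; rewrite [LHS]vprimitive2E [RHS]vprimitive2E /primitive2.
have Gr z w : v0 < z -> G w z ord0 i = 0.
  by move=> vz; rewrite G0 ?mxE// => /rectE[_ /andP[_]]; rewrite leNgt vz.
have Gl z w : u0 < w -> G w z ord0 i = 0.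
  by move=> uz; rewrite G0 ?mxE// => /rectE[/andP[_]]; rewrite leNgt uz.
rewrite (primitive_clamp _ u00 (kernel2_primitive_L1 _ (kG i))); last first.
  move=> w uw; have -> : (fun z => G w z ord0 i) = cst 0 by apply/funext => z; rewrite Gl.
  by rewrite /primitive /Rintegral integral0.
congr (primitive _ u); apply/funext => w.
by apply: (primitive_clamp _ v00 (kernel2_L1r (kG i) w)) => z; exact: Gr.
Qed.

Section fixed_data.
Variables (u0 v0 : R) (p q a b phip phim : R -> vec).
Hypotheses (u00 : 0 < u0) (v00 : 0 < v0) (hp : is_vprimitive p a) (hq : is_vprimitive q b)
  (pE : p = phip \o clamp u0) (qE : q = phim \o clamp v0) (phi0 : phip 0 = phim 0).

Let ge0u0 : 0 <= u0 := ltW u00.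
Let ge0v0 : 0 <= v0 := ltW v00.
Let p0 : p 0 = phip 0. Proof. by rewrite pE/= clamp_id// lexx. Qed.
Let pq0 : p 0 = q 0. Proof. by rewrite pE qE/= !clamp_id// lexx. Qed.

(** The kernel is a representative of the nonlinearity, set to zero outside
    the rectangle. The integral equation then determines the derivatives of
    [phi] as [char_u] and [char_v], which closes the equation for the
    kernel; outside the rectangle both sides vanish since the data are
    constant there. *)
Lemma mild_wave_of_wave_map phi :
  (forall x, ~ (0 <= x <= u0) -> a x = 0) -> (forall x, ~ (0 <= x <= v0) -> b x = 0) ->
  wave_map u0 v0 phip phim phi ->
  exists G, mild_wave p q a b G (fun u v => phi (clamp u0 u) (clamp v0 v)).
Proof.
move=> a0 b0 W.
have H i := kernel2_of_in_L1 (wave_map_nonlinearity_L1 W i).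
pose g i := projT1 (cid (H i)).
have gP i : [/\ kernel2 (g i), (forall u v, ~rect u0 v0 (u, v) -> g i u v = 0) &
    {ae leb2 R, forall x : R * R, rect u0 v0 x -> nonlinearity phi x.1 x.2 ord0 i = g i x.1 x.2}].
  by rewrite /g; case: cid.
pose G u v : vec := \row_i g i u v.
have kG : vkernel G.
  move=> i; have [+ _ _] := gP i; congr kernel2.
  by apply/funext => u; apply/funext => v; rewrite mxE.
have G0 u v : ~ rect u0 v0 (u, v) -> G u v = 0.
  by move=> uv; apply/rowP => i; rewrite !mxE; have [_ gi0 _] := gP i; exact: gi0.
have NG : {ae leb2 R, forall x : R * R, rect u0 v0 x -> nonlinearity phi x.1 x.2 = G x.1 x.2}.
  have hG i : {ae leb2 R, forall x : R * R, rect u0 v0 x -> nonlinearity phi x.1 x.2 ord0 i = g i x.1 x.2}.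
    by have [] := gP i.
  move: (ae_forall_fin hG); apply: aeS => x h xr.
  by apply/rowP => i; rewrite (h i xr) mxE.
pose phi' u v := phi (clamp u0 u) (clamp v0 v).
have phi'E u v : phi' u v = p u + q v - p 0 - vprimitive2 G u v.
  have uu := clamp_in u ge0u0; have vv := clamp_in v ge0v0.
  have pX : p u = phip (clamp u0 u) by rewrite pE.
  have qX : q v = phim (clamp v0 v) by rewrite qE.
  apply: (etrans (wave_map_eq W uu vv)); rewrite pX qX p0.
  case/andP: uu => _ h1; case/andP: vv => _ h2.
  by rewrite (vec_double_integral_ae NG h1 h2) (vprimitive2_clamp _ _ ge0u0 ge0v0 kG G0).
have kGs : vkernel (fun v u => G u v) by move=> i; exact: kernel2_swap (kG i).
have phi'Es v u : phi' u v = q v + p u - q 0 - vprimitive2 (fun v u => G u v) v u.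
  by rewrite phi'E vprimitive2_swap// -pq0 [p u + _]addrC.
have phiphi' u v : 0 <= u <= u0 -> 0 <= v <= v0 -> phi u v = phi' u v.
  by move=> uu vv; rewrite /phi' !clamp_id.
have Du := ae_rect_fst (wave_has_d_u hp kG phi'E phiphi').
have Dv := ae_rect_snd (wave_has_d_u (phi := fun v u => phi u v) (phi' := fun v u => phi' u v)
  hq kGs phi'Es (fun v u vv uu => phiphi' u v uu vv)).
exists G; split.
- exact: hp.
- exact: hq.
- exact: pq0.
- exact: kG.
- exact: phi'E.
- by move=> u v; apply/sphere_dot; apply: (wave_map_sphere W); exact: clamp_in.
- move: NG Du Dv; apply: aeS3 => -[u v] /= h1 h2 h3 u1 v1.
  have [/rectE[uu vv]|uv] := pselect (rect u0 v0 (u, v)).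
    have uv : rect u0 v0 (u, v) by apply/rectE.
    rewrite -h1// /nonlinearity !clamp_id//.
    have [_ ->] := h2 uv; have [_ hv] := h3 uv.
    congr (dot _ _ *: _); exact: hv.
  rewrite G0//; suff -> : dot (char_u a G u v) (char_v b G u v) = 0 by rewrite scale0r.
  have dot0 (x : vec) : dot 0 x = 0 by rewrite -(scale0r 0) dotZl mul0r.
  have vprim0 : forall t : R, vprimitive (cst (0 : vec)) t = 0.
    move=> t; apply/rowP => i; rewrite [LHS]mxE [RHS]mxE /primitive.
    have -> : (fun t : R => cst (0 : vec) t ord0 i) = cst 0 by apply/funext => z; rewrite mxE.
    by rewrite /Rintegral integral0.
  have [uu|uu] := pselect (0 <= u <= u0).
    have vv : ~ (0 <= v <= v0) by move=> vv; apply: uv; apply/rectE.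
    rewrite dotC /char_v b0//.
    have -> : G ^~ v = cst 0 by apply/funext => w; rewrite G0// => /rectE[_ /vv].
    by rewrite vprim0 subr0 dot0.
  rewrite /char_u a0//.
  have -> : G u = cst 0 by apply/funext => w; rewrite G0// => /rectE[/uu].
  by rewrite vprim0 subr0 dot0.
Qed.

Section consequences.
Variables (G : R -> R -> vec) (phi' phi : R -> R -> vec).
Hypothesis W : mild_wave p q a b G phi'.
Hypothesis phiphi' : forall u v, 0 <= u <= u0 -> 0 <= v <= v0 -> phi u v = phi' u v.

Lemma mild_has_d_u : {ae mu, forall u : R, 0 < u < u0 -> forall v, 0 <= v <= v0 ->
    has_d_u phi u v /\ d_u phi u v = char_u a G u v}.
Proof. exact: wave_has_d_u hp (mild_kernel W) (mild_phi W) phiphi'. Qed.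

Lemma mild_has_d_v : {ae mu, forall v : R, 0 < v < v0 -> forall u, 0 <= u <= u0 ->
    has_d_v phi u v /\ d_v phi u v = char_v b G u v}.
Proof.
have W' := mild_wave_swap W.
exact: (wave_has_d_u (phi := fun v u => phi u v) (phi' := fun v u => phi' u v)
  hq (mild_kernel W') (mild_phi W') (fun v u vv uu => phiphi' uu vv)).
Qed.

Lemma mild_nonlinearity : {ae leb2 R, forall x : R * R, rect u0 v0 x ->
  nonlinearity phi x.1 x.2 = G x.1 x.2 /\
  dot (d_u phi x.1 x.2) (d_v phi x.1 x.2) = dot (G x.1 x.2) (phi' x.1 x.2)}.
Proof.
have {}Du := ae_rect_fst mild_has_d_u; have Dv := ae_rect_snd mild_has_d_v.
apply: ae_rect_interior; move: (mild_eq W) Du Dv; apply: aeS3 => -[u v] /= h1 h2 h3 uu vv.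
have uu' : 0 <= u <= u0 by case/andP: uu => *; rewrite !ltW.
have vv' : 0 <= v <= v0 by case/andP: vv => *; rewrite !ltW.
have [|_ E2] := h2; first exact/rectE.
have [|_ E3] := h3; first exact/rectE.
have u1 : 0 < u by case/andP: uu.
have v1 : 0 < v by case/andP: vv.
rewrite /nonlinearity E2 E3 phiphi'// h1//; split => //.
by rewrite dotZl (mild_sphere W) mulr1.
Qed.

End consequences.

Lemma wave_map_of_mild_wave G phi : mild_wave p q a b G phi -> wave_map u0 v0 phip phim phi.
Proof.
move=> W; have N := mild_nonlinearity W (fun _ _ _ _ => erefl).
have mr := measurable_rect u0 v0.
have mphi i : measurable2 (fun u v => phi u v ord0 i).
  have mG := kernel2_measurable (mild_kernel W i).
  have mG2 := measurable2_swap (measurable2_primitive (measurable2_swap (measurable2_primitive mG))).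
  have -> : (fun u v => phi u v ord0 i) = (fun u v => (p u ord0 i + q v ord0 i - p 0 ord0 i)
      - primitive2 (fun u v => G u v ord0 i) u v).
    by apply/funext => u; apply/funext => v; rewrite (mild_phi W) !mxE.
  apply: measurable_funB; last exact: mG2.
  apply: measurable_funB; last exact: measurable_cst.
  apply: measurable_funD.
    exact: (measurableT_comp (is_primitive_measurable (hp i)) measurable_fst).
  exact: (measurableT_comp (is_primitive_measurable (hq i)) measurable_snd).
have phi1 i u v : `|phi u v ord0 i| <= 1.
  by apply: le_trans (coord_le_enorm _ _) _; rewrite /enorm (mild_sphere W) sqrtr1.
have kdot : kernel2 (fun u v => dot (G u v) (phi u v)).
  have := kernel2_sum (fun i => kernel2_Mbounded (mild_kernel W i) (mphi i) (phi1 i)).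
  congr kernel2; apply/funext => u; apply/funext => v; rewrite dotE.
  by apply: eq_bigr => i _; rewrite mulrC.
split.
- by move=> u v _ _; apply/sphere_dot; exact: (mild_sphere W).
- by move: (ae_rect_fst (mild_has_d_u W (fun _ _ _ _ => erefl))); apply: aeS => x h /h[].
- by move: (ae_rect_snd (mild_has_d_v W (fun _ _ _ _ => erefl))); apply: aeS => x h /h[].
- exists (fun x => dot (G x.1 x.2) (phi x.1 x.2)).
    exact: integrableS (kernel2_integrable kdot).
  by move: N; apply: aeS => x h /h[].
- move=> i; exists (fun x => G x.1 x.2 ord0 i).
    exact: integrableS (kernel2_integrable (mild_kernel W i)).
  by move: N; apply: aeS => x h /h[-> _].
- move=> u v uu vv; apply: (etrans (mild_phi W u v)).
  have pX : p u = phip u by rewrite pE/= clamp_id.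
  have qX : q v = phim v by rewrite qE/= clamp_id.
  rewrite pX qX p0; congr (_ - _).
  case/andP: uu => _ uu; case/andP: vv => _ vv; apply/esym.
  by apply: (vec_double_integral_ae _ uu vv); move: N; apply: aeS => x h /h[].
Qed.

End fixed_data.

(** The constant depends on the second wave only: the weights of
    [mild_wave_L1_bound] that involve the first one are bounded by those of
    the second as soon as the two are at distance at most [1]. *)
Lemma mild_wave_stability p2 q2 a2 b2 G2 phi2 (U V : R) : mild_wave p2 q2 a2 b2 G2 phi2 ->
  exists2 C : R, 0 <= C & forall p1 q1 a1 b1 G1 phi1 (y : R), mild_wave p1 q1 a1 b1 G1 phi1 ->
    0 <= y <= 1 -> l1 (p1 0 - p2 0) <= y ->
    total_integral (fun u => l1 (a1 u - a2 u)) <= y ->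
    total_integral (fun v => l1 (b1 v - b2 v)) <= y ->
    primitive2 (fun u v => l1 (G1 u v - G2 u v)) U V <= C * y.
Proof.
move=> W2; set N : R := d.+1%:R; have N0 : 0 <= N by exact: ler0n.
have Lb2 := L1_l1 (is_vprimitive_L1 (mild_q W2)).
pose M := primitive (fun u => N * l1 (a2 u)) U; pose B := primitive (fun v => l1 (b2 v)) V.
have M0 : 0 <= M by apply: primitive_ge0 => z; rewrite mulr_ge0// l1_ge0.
have B0 : 0 <= B by apply: primitive_ge0 => z; exact: l1_ge0.
pose K := N * (1 + B) + B; have K0 : 0 <= K by rewrite addr_ge0// mulr_ge0// addr_ge0.
have E0 : 0 <= 16 / 7 * expR (4 * (M + K)) by rewrite mulr_ge0 ?expR_ge0// divr_ge0.
exists (16 / 7 * expR (4 * (M + K)) * (K + M * (1 + 3 * K))).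
  by rewrite mulr_ge0// addr_ge0// mulr_ge0// addr_ge0// mulr_ge0.
move=> p1 q1 a1 b1 G1 phi1 y W1 /andP[y0 y1] hp hs ht.
have Lb1 := L1_l1 (is_vprimitive_L1 (mild_q W1)).
have Ls := L1_l1 (L1_vecB (is_vprimitive_L1 (mild_p W1)) (is_vprimitive_L1 (mild_p W2))).
have Lt := L1_l1 (L1_vecB (is_vprimitive_L1 (mild_q W1)) (is_vprimitive_L1 (mild_q W2))).
have sy : primitive (fun u => l1 (a1 u - a2 u)) U <= y.
  by apply: le_trans hs; apply: primitive_le_total_integral => // z; exact: l1_ge0.
have ty : primitive (fun v => l1 (b1 v - b2 v)) V <= y.
  by apply: le_trans ht; apply: primitive_le_total_integral => // z; exact: l1_ge0.
have s0 : 0 <= primitive (fun u => l1 (a1 u - a2 u)) U by apply: primitive_ge0 => z; exact: l1_ge0.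
have t0 : 0 <= primitive (fun v => l1 (b1 v - b2 v)) V by apply: primitive_ge0 => z; exact: l1_ge0.
have k0 : 0 <= primitive (fun v => N * l1 (b1 v) + l1 (b2 v)) V.
  by apply: primitive_ge0 => z; rewrite addr_ge0 ?mulr_ge0 ?l1_ge0.
have kK : primitive (fun v => N * l1 (b1 v) + l1 (b2 v)) V <= K.
  rewrite primitiveD//; last exact: L1Z.
  rewrite lerD2r primitiveZ// ler_wpM2l//.
  apply: (@le_trans _ _ (primitive (fun v => l1 (b1 v - b2 v) + l1 (b2 v)) V)); last first.
    by rewrite primitiveD// lerD2r; exact: le_trans ty y1.
  apply: le_primitive => //; first exact: L1D.
  by move=> z _ _; rewrite -{1}[b1 z](subrK (b2 z)); exact: l1D.
apply: le_trans (mild_wave_L1_bound W1 W2 U V) _; rewrite -/N -/M -[leRHS]mulrA.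
set k := primitive _ V in k0 kK *; set s := primitive _ U in sy s0 *; set t := primitive _ V in ty t0 *.
apply: ler_pM => //.
- rewrite addr_ge0 ?mulr_ge0// addr_ge0// mulr_ge0// !addr_ge0 ?l1_ge0//;
    by apply: Rintegral_ge0 => z _; exact: l1_ge0.
- by rewrite ler_wpM2l ?divr_ge0// ler_expR ler_wpM2l// lerD2l.
rewrite [leRHS]mulrDl; apply: lerD; first exact: ler_pM.
rewrite -[leRHS]mulrA ler_wpM2l// [leRHS]mulrDl mul1r lerD//.
(* the three distances: of the initial points and of the two derivatives *)
have -> : 3 * K * y = (y + y + y) * K by ring.
apply: ler_pM => //; last by do 2?[apply: lerD].
rewrite !addr_ge0 ?l1_ge0//; by apply: Rintegral_ge0 => z _; exact: l1_ge0.
Qed.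

Lemma mild_wave_unique p q a b G1 phi1 G2 phi2 (u v : R) :
  mild_wave p q a b G1 phi1 -> mild_wave p q a b G2 phi2 -> phi1 u v = phi2 u v.
Proof.
move=> W1 W2; have [C _ HC] := mild_wave_stability u v W2.
have l10 (f : R -> vec) x : l1 (f x - f x) = 0 by rewrite subrr /l1 big1// => i _; rewrite mxE normr0.
have tot0 (f : R -> vec) : total_integral (fun u => l1 (f u - f u)) = 0.
  have -> : (fun u => l1 (f u - f u)) = cst 0 by apply/funext => x; rewrite l10.
  by rewrite /total_integral /Rintegral integral0.
have := HC _ _ _ _ _ _ 0 W1; rewrite !tot0 l10 lexx ler01 mulr0 => /(_ isT isT isT isT) h0.
have := mild_wave_diff W1 W2 u v; rewrite !tot0 l10 !add0r => h1.
apply/eqP; rewrite -subr_eq0; apply/eqP/l1_eq0/eqP; rewrite eq_le l1_ge0 andbT.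
exact: le_trans h1 h0.
Qed.

Lemma total_integral_supp (g : R -> R) (u0 : R) : (forall x, ~ (0 <= x <= u0) -> g x = 0) ->
  total_integral g = primitive g u0.
Proof.
move=> g0; rewrite /primitive Rintegral_mkcond; congr Rintegral.
apply/funext => x; rewrite patchE; case: ifPn => // /negP xu; apply: g0 => xx; apply: xu.
by rewrite inE/= in_itv.
Qed.

Lemma L1_enorm f : L1_vec f -> L1 (fun x => enorm (f x)).
Proof.
move=> Lf; apply: (le_L1 (measurable_enorm (fun i => L1_measurable (Lf i))) (L1_l1 Lf)) => x.
by rewrite ger0_norm ?enorm_ge0// enorm_le_l1.
Qed.

(** [f] is a derivative, known only almost everywhere; [g] is its integrable
    representative. *)
Lemma L1norm_primitive f g (u0 : R) : L1_vec g ->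
  {ae mu, forall x : R, 0 < x < u0 -> f x = g x} ->
  L1norm u0 f = (primitive (fun x => enorm (g x)) u0)%:E.
Proof.
move=> Lg fg; rewrite /L1norm /primitive /Rintegral fineK; last first.
  by apply: integrable_fin_num => //; exact: L1_itv (L1_enorm Lg).
apply: integral_ae_congr; move: (ae_itv_interior fg); apply: aeS => x h.
by rewrite /= in_itv/= => /h ->.
Qed.

Lemma integral_rect (H : R -> R -> R) (u v : R) : kernel2 H -> (forall x y, 0 <= H x y) ->
  (\int[leb2 R]_(p in rect u v) (H p.1 p.2)%:E = (primitive2 H u v)%:E)%E.
Proof.
move=> kH H0; have mr := measurable_rect u v.
have mH : measurable_fun setT (fun p : T * T => (H p.1 p.2)%:E).
  by apply/measurable_EFinP; exact: kernel2_measurable kH.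
rewrite integral_mkcond.
have mHr : measurable_fun setT ((fun p : T * T => (H p.1 p.2)%:E) \_ (rect u v)).
  apply/(measurable_restrict _ mr) => //; rewrite ?setTI; exact: measurable_funTS.
rewrite (@fubini_tonelli1 _ _ _ _ _ mu mu _ mHr); last first.
  by move=> p; rewrite patchE; case: ifPn => // _; rewrite lee_fin.
rewrite /primitive2 {1}/primitive /Rintegral fineK; last first.
  by apply: integrable_fin_num => //; exact: L1_itv (kernel2_primitive_L1 v kH).
rewrite [RHS]integral_mkcond; apply: eq_integral => x _.
rewrite /fubini_F patchE; case: ifPn => [/set_mem xu|/negP xu].
  rewrite /primitive /Rintegral fineK; last first.
    by apply: integrable_fin_num => //; exact: L1_itv (kernel2_L1r kH x).
  rewrite [RHS]integral_mkcond; apply: eq_integral => y _; rewrite !patchE.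
  have -> : ((x, y) \in rect u v) = (y \in [set` `[0, v]]) => //.
  by apply/idP/idP => /set_mem h; apply/mem_set; [case: h|split].
rewrite integral0_eq// => y _; rewrite patchE memNset// => -[] /= xu' _.
by apply: xu; apply/mem_set.
Qed.

Section difference.
Variables (u0 v0 : R) (p1 q1 a1 b1 p2 q2 a2 b2 : R -> vec) (G1 phi1 G2 phi2 psi1 psi2 : R -> R -> vec).
Hypotheses (W1 : mild_wave p1 q1 a1 b1 G1 phi1) (W2 : mild_wave p2 q2 a2 b2 G2 phi2)
  (E1 : forall u v, 0 <= u <= u0 -> 0 <= v <= v0 -> psi1 u v = phi1 u v)
  (E2 : forall u v, 0 <= u <= u0 -> 0 <= v <= v0 -> psi2 u v = phi2 u v).
Let psi u v := psi1 u v - psi2 u v.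

(** For almost every [v] the function [d_v psi] is given on the whole line
    by [char_v], a primitive of [- (G1 - G2)], which is differentiable at
    almost every point. *)
Lemma has_d_u_d_v_diff : {ae leb2 R, forall x : R * R, rect u0 v0 x ->
  has_d_u_d_v psi x.1 x.2 /\ d_u (d_v psi) x.1 x.2 = G2 x.1 x.2 - G1 x.1 x.2}.
Proof.
have D1 := mild_has_d_v (mild_q W1) W1 E1; have D2 := mild_has_d_v (mild_q W2) W2 E2.
have D : {ae mu, forall v : R, 0 < v < v0 -> forall u, 0 <= u <= u0 ->
    has_d_v psi u v /\ d_v psi u v = char_v b1 G1 u v - char_v b2 G2 u v}.
  move: D1 D2; apply: aeS2 => v h1 h2 vv u uu.
  have [d1 e1] := h1 vv u uu; have [d2 e2] := h2 vv u uu.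
  split; first exact: (derivableB d1 d2).
  rewrite -e1 -e2 /d_v !derive1E; exact: (deriveB d1 d2).
have kG i := kernel2B (mild_kernel W1 i) (mild_kernel W2 i).
have S := ae_forall_fin (fun i => primitive_section_derive (kG i)).
apply: ae_rect_interior; move: (ae_snd D) S; apply: aeS2 => -[u v] /= h S uu vv.
have E : is_derive u 1 (d_v psi ^~ v) (G2 u v - G1 u v).
  apply: (@is_derive_near _ (fun w => char_v b1 G1 w v - char_v b2 G2 w v)).
    by move: (near_in_itv uu); apply: filterS => w ww; have [] := h vv w ww.
  apply: is_derive_vec => i.
  have -> : (fun w => (char_v b1 G1 w v - char_v b2 G2 w v) ord0 i) =
      (fun w => cst ((b1 v - b2 v) ord0 i) w - primitive (fun x => G1 x v ord0 i - G2 x v ord0 i) w).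
    apply/funext => w; rewrite primitiveB; [|exact: (kernel2_L1l (mild_kernel W1 i))
                                            |exact: (kernel2_L1l (mild_kernel W2 i))].
    by rewrite /char_v /cst !mxE; ring.
  have -> : (G2 u v - G1 u v) ord0 i = 0 - (G1 u v ord0 i - G2 u v ord0 i) by rewrite !mxE; ring.
  apply: is_deriveB.
  by apply: S; case/andP: uu.
have [dE eE] := E; split; last by rewrite /d_u derive1E.
split; last exact: dE.
by move: (near_in_itv uu); apply: filterS => w ww; have [] := h vv w ww.
Qed.

Lemma vec_in_L1_diff : vec_in_L1 (rect u0 v0) (d_u (d_v psi)).
Proof.
move=> i; exists (fun x => (G2 x.1 x.2 - G1 x.1 x.2) ord0 i); last first.
  by move: has_d_u_d_v_diff; apply: aeS => x h /h[_ ->].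
have k := vkernelB (mild_kernel W2) (mild_kernel W1) i.
exact: integrableS (measurable_rect u0 v0) _ (kernel2_integrable k).
Qed.

Lemma L1norm2_diff_le :
  (L1norm2 u0 v0 (d_u (d_v psi)) <= (primitive2 (fun u v => l1 (G1 u v - G2 u v)) u0 v0)%:E)%E.
Proof.
have k := vkernelB (mild_kernel W1) (mild_kernel W2).
rewrite -(integral_rect u0 v0 (vkernel_l1 k) (fun x y => l1_ge0 _)).
rewrite /L1norm2 (@integral_ae_congr _ _ _ (leb2 R) _ _ (fun x => (enorm (G2 x.1 x.2 - G1 x.1 x.2))%:E)); last first.
  by move: has_d_u_d_v_diff; apply: aeS => x h /h[_ ->].
have mr := measurable_rect u0 v0.
apply: ge0_le_integral.
- exact: mr.
- by move=> x _; rewrite lee_fin enorm_ge0.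
- apply/measurable_EFinP; apply: measurable_funTS.
  apply: (measurable_enorm (g := fun x : T * T => G2 x.1 x.2 - G1 x.1 x.2)) => i.
  exact: kernel2_measurable (vkernelB (mild_kernel W2) (mild_kernel W1) i).
- apply/measurable_EFinP; apply: measurable_funTS; exact: kernel2_measurable (vkernel_l1 k).
- by move=> x _; rewrite lee_fin -[G1 _ _ - _]opprB l1N enorm_le_l1.
Qed.

End difference.

(** Almost every [u] is good for all [v] simultaneously, so the pointwise
    conservation law may be used on the boundary line [v = v0]. *)
Lemma conservation_law u0 v0 p q a b G phi' phi f : 0 <= v0 ->
  mild_wave p q a b G phi' ->
  (forall u v, 0 <= u <= u0 -> 0 <= v <= v0 -> phi u v = phi' u v) ->
  {ae mu, forall x : R, 0 < x < u0 -> derive1 f x = a x} ->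
  {ae mu, forall u : R, 0 <= u <= u0 -> has_d_u phi u v0} /\
  L1norm u0 (fun u => d_u phi u v0) = L1norm u0 (derive1 f).
Proof.
move=> v00 W E fa; have D := mild_has_d_u (mild_p W) W E.
have v0v0 : 0 <= v0 <= v0 by rewrite v00 lexx.
split.
  by apply: ae_itv_interior; move: D; apply: aeS => u h uu; have [] := h uu _ v0v0.
apply: integral_ae_congr.
have : {ae mu, forall u : R, 0 < u < u0 -> enorm (d_u phi u v0) = enorm (derive1 f u)}.
  move: D (mild_wave_conservation W) fa; apply: aeS3 => u h1 h2 h3 uu.
  have [_ ->] := h1 uu _ v0v0; rewrite h3//; apply: eq_enorm; apply: h2; by case/andP: uu.
move=> /ae_itv_interior; apply: aeS => u h; rewrite /= in_itv/= => /h ->//.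
Qed.

Lemma total_l1_le f g (u0 : R) : L1_vec f -> L1_vec g ->
  (forall x, ~ (0 <= x <= u0) -> f x = 0) -> (forall x, ~ (0 <= x <= u0) -> g x = 0) ->
  total_integral (fun x => l1 (f x - g x)) <= d.+1%:R * primitive (fun x => enorm (f x - g x)) u0.
Proof.
move=> Lf Lg f0 g0; have L := L1_vecB Lf Lg.
rewrite (@total_integral_supp _ u0); last first.
  by move=> x xu; rewrite f0// g0// subrr /l1 big1// => i _; rewrite mxE normr0.
rewrite -primitiveZ; last exact: L1_enorm L.
apply: le_primitive; [exact: L1_l1 L|exact: (L1Z _ (L1_enorm L))|].
by move=> z _ _; exact: l1_le_enorm.
Qed.

Lemma L1norm_derive_sub f g a b (u0 : R) : L1_vec a -> L1_vec b ->
  {ae mu, forall x : R, 0 < x < u0 -> derive1 f x = a x} ->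
  {ae mu, forall x : R, 0 < x < u0 -> derive1 g x = b x} ->
  L1norm u0 (fun x => derive1 f x - derive1 g x) = (primitive (fun x => enorm (a x - b x)) u0)%:E.
Proof.
move=> La Lb fa gb; apply: (L1norm_primitive (L1_vecB La Lb)).
by move: fa gb; apply: aeS2 => x h1 h2 xu; rewrite h1// h2.
Qed.

Lemma boundary_curves u0 v0 phip phim : 0 < u0 -> 0 < v0 -> boundary_data u0 v0 phip phim ->
  exists a b, [/\ is_vprimitive (phip \o clamp u0) a /\ is_vprimitive (phim \o clamp v0) b,
    (forall x, ~ (0 <= x <= u0) -> a x = 0) /\ (forall x, ~ (0 <= x <= v0) -> b x = 0),
    {ae mu, forall x : R, 0 < x < u0 -> derive1 phip x = a x} &
    {ae mu, forall x : R, 0 < x < v0 -> derive1 phim x = b x}].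
Proof.
move=> u00 v00 [_ _ acp acm _].
have [a [pa a0 Da]] := boundary_curve u00 acp; have [b [pb b0 Db]] := boundary_curve v00 acm.
by exists a, b.
Qed.

Lemma wave_map_exists u0 v0 phip phim : 0 < u0 -> 0 < v0 -> boundary_data u0 v0 phip phim ->
  exists phi, wave_map u0 v0 phip phim phi.
Proof.
move=> u00 v00 D; have [a [b [[hp hq] _ _ _]]] := boundary_curves u00 v00 D.
have [sp sm _ _ e0] := D.
have p1 x : dot ((phip \o clamp u0) x) ((phip \o clamp u0) x) = 1.
  by apply/sphere_dot/sp; exact: clamp_in (ltW u00).
have q1 x : dot ((phim \o clamp v0) x) ((phim \o clamp v0) x) = 1.
  by apply/sphere_dot/sm; exact: clamp_in (ltW v00).
have pq : (phip \o clamp u0) 0 = (phim \o clamp v0) 0.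
  by rewrite /= !clamp_id// ?lexx ?(ltW u00) ?(ltW v00).
have [a' [b' [G [phi W]]]] := mild_wave_exists hp hq pq p1 q1.
exists phi; exact: (wave_map_of_mild_wave u00 (mild_p W) (mild_q W) erefl erefl W).
Qed.

Lemma wave_map_mild u0 v0 phip phim a b phi : 0 < u0 -> 0 < v0 -> boundary_data u0 v0 phip phim ->
  is_vprimitive (phip \o clamp u0) a /\ is_vprimitive (phim \o clamp v0) b ->
  (forall x, ~ (0 <= x <= u0) -> a x = 0) /\ (forall x, ~ (0 <= x <= v0) -> b x = 0) ->
  wave_map u0 v0 phip phim phi ->
  exists G phi', mild_wave (phip \o clamp u0) (phim \o clamp v0) a b G phi' /\
    forall u v, 0 <= u <= u0 -> 0 <= v <= v0 -> phi u v = phi' u v.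
Proof.
move=> u00 v00 [_ _ _ _ e0] [hp hq] [a0 b0] W.
have [G W'] := mild_wave_of_wave_map u00 v00 hp hq erefl erefl e0 a0 b0 W.
exists G, (fun u v => phi (clamp u0 u) (clamp v0 v)); split => // u v uu vv.
by rewrite !clamp_id.
Qed.

(** By [mild_wave_stability] the [L1] distance of the nonlinearities is at
    most a constant times the distance [x] of the data, as soon as the
    latter is small. *)
Lemma wave_map_continuous u0 v0 phip phim phi (phipn phimn : nat -> R -> vec) (phin : nat -> R -> R -> vec) :
  0 < u0 -> 0 < v0 -> boundary_data u0 v0 phip phim -> wave_map u0 v0 phip phim phi ->
  (forall n, boundary_data u0 v0 (phipn n) (phimn n)) ->
  (fun n : nat => maxe (enorm (phipn n 0 - phip 0))%:E
     (maxe (L1norm u0 (fun u => derive1 (phipn n) u - derive1 phip u))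
           (L1norm v0 (fun v => derive1 (phimn n) v - derive1 phim v)))) @ \oo --> 0%E ->
  (forall n : nat, wave_map u0 v0 (phipn n) (phimn n) (phin n)) ->
  (forall n : nat, let psi := fun u v => phin n u v - phi u v in
     {ae leb2 R, forall p : R * R, rect u0 v0 p -> has_d_u_d_v psi p.1 p.2} /\
     vec_in_L1 (rect u0 v0) (d_u (d_v psi))) /\
  (fun n : nat => L1norm2 u0 v0 (d_u (d_v (fun u v => phin n u v - phi u v)))) @ \oo --> 0%E.
Proof.
move=> u00 v00 D W Dn cvgn Wn.
have [a [b [hpq h0 Da Db]]] := boundary_curves u00 v00 D.
have [G [phi' [M E]]] := wave_map_mild u00 v00 D hpq h0 W.
have [[La Lb] [a0 b0]] := (conj (conj (is_vprimitive_L1 hpq.1) (is_vprimitive_L1 hpq.2)) h0).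
have [C C0 HC] := mild_wave_stability u0 v0 M.
have Sn n : exists x : R, [/\ 0 <= x,
    maxe (enorm (phipn n 0 - phip 0))%:E
     (maxe (L1norm u0 (fun u => derive1 (phipn n) u - derive1 phip u))
           (L1norm v0 (fun v => derive1 (phimn n) v - derive1 phim v))) = x%:E,
    {ae leb2 R, forall p : R * R, rect u0 v0 p ->
       has_d_u_d_v (fun u v => phin n u v - phi u v) p.1 p.2} /\
     vec_in_L1 (rect u0 v0) (d_u (d_v (fun u v => phin n u v - phi u v))) &
    d.+1%:R * x <= 1 ->
    (L1norm2 u0 v0 (d_u (d_v (fun u v => phin n u v - phi u v)))%R <= (C * (d.+1%:R * x))%R%:E)%E].
  have [an [bn [hpqn h0n Dan Dbn]]] := boundary_curves u00 v00 (Dn n).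
  have [Gn [phin' [Mn En]]] := wave_map_mild u00 v00 (Dn n) hpqn h0n (Wn n).
  have Lan := is_vprimitive_L1 hpqn.1; have Lbn := is_vprimitive_L1 hpqn.2.
  rewrite (L1norm_derive_sub Lan La Dan Da) (L1norm_derive_sub Lbn Lb Dbn Db) -!EFin_max.
  set s := primitive _ u0; set t := primitive _ v0; set e := enorm _; set x := Num.max e _.
  have ex : e <= x by rewrite le_max lexx.
  have sx : s <= x by rewrite !le_max lexx orbT.
  have tx : t <= x by rewrite !le_max lexx !orbT.
  have x0 : 0 <= x by apply: le_trans ex; exact: enorm_ge0.
  exists x; split => //.
    split; last exact: (vec_in_L1_diff Mn M En E).
    by move: (has_d_u_d_v_diff Mn M En E); apply: aeS => p h /h[].
  move=> x1; apply: le_trans (L1norm2_diff_le Mn M En E) _; rewrite lee_fin.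
  have N0 : 0 <= d.+1%:R :> R by exact: ler0n.
  apply: (HC _ _ _ _ _ _ _ Mn).
  - by rewrite x1 mulr_ge0.
  - rewrite /= !clamp_id ?lexx ?(ltW u00)//.
    by apply: le_trans (l1_le_enorm _) _; rewrite ler_wpM2l.
  - by apply: le_trans (total_l1_le Lan La h0n.1 a0) _; rewrite ler_wpM2l.
  - by apply: le_trans (total_l1_le Lbn Lb h0n.2 b0) _; rewrite ler_wpM2l.
split; first by move=> n; have [x [_ _ + _]] := Sn n.
have /choice[x xP] := Sn.
have xcvg : x @ \oo --> (0 : R).
  apply: cvg_trans (fine_cvg cvgn); apply: near_eq_cvg; apply: nearW => n /=.
  by have [_ -> _ _] := xP n.
have xN : (fun n => C * (d.+1%:R * x n)) @ \oo --> (0 : R).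
  rewrite -(mulr0 C) -(mulr0 d.+1%:R).
  by apply: cvgM; [exact: cvg_cst|apply: cvgM => //; exact: cvg_cst].
apply: (@squeeze_cvge _ _ _ _ (cst 0%E) _ (fun n => (C * (d.+1%:R * x n))%:E)); last 2 first.
- exact: cvg_cst.
- by apply: cvg_EFin; [near=> n|].
have N0 : 0 < d.+1%:R :> R by rewrite ltr0n.
near=> n; apply/andP; split.
  by apply: integral_ge0 => p _; rewrite lee_fin enorm_ge0.
have [x0 _ _] := xP n; apply.
rewrite mulrC -ler_pdivlMr// mul1r -[x n]subr0 -[leLHS]ger0_norm ?subr0//.
near: n; move/cvgrPdist_le : xcvg => /(_ (d.+1%:R^-1)); rewrite invr_gt0 => /(_ N0).
by apply: filterS => n; rewrite sub0r normrN.
Unshelve. all: by end_near. Qed.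

End waves.

Theorem theorem2p5 (R : realType) (d : nat) (hd : (1 <= d)%N)
    (u0 v0 : R) (hu0 : 0 < u0) (hv0 : 0 < v0)
    (phip phim : R -> 'rV[R]_d.+1)
    (hdata : boundary_data u0 v0 phip phim) :
  (* (i) existence and uniqueness *)
  ((exists phi : R -> R -> 'rV[R]_d.+1, wave_map u0 v0 phip phim phi) /\
   (forall phi psi : R -> R -> 'rV[R]_d.+1,
      wave_map u0 v0 phip phim phi -> wave_map u0 v0 phip phim psi ->
      forall u v : R, 0 <= u <= u0 -> 0 <= v <= v0 -> phi u v = psi u v)) /\
  (forall phi : R -> R -> 'rV[R]_d.+1, wave_map u0 v0 phip phim phi ->
   (* (ii) continuous dependence *)
   (forall (phipn phimn : nat -> R -> 'rV[R]_d.+1)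
           (phin : nat -> R -> R -> 'rV[R]_d.+1),
      (forall n : nat, boundary_data u0 v0 (phipn n) (phimn n)) ->
      (fun n : nat => maxe (enorm (phipn n 0 - phip 0))%:E
         (maxe (L1norm u0 (fun u => derive1 (phipn n) u - derive1 phip u))
               (L1norm v0 (fun v => derive1 (phimn n) v - derive1 phim v))))
        @ \oo --> 0%E ->
      (forall n : nat, wave_map u0 v0 (phipn n) (phimn n) (phin n)) ->
      (forall n : nat,
         let psi := fun u v => phin n u v - phi u v in
         {ae leb2 R, forall p, rect u0 v0 p -> has_d_u_d_v psi p.1 p.2} /\
         vec_in_L1 (rect u0 v0) (d_u (d_v psi))) /\
      (fun n : nat =>
         L1norm2 u0 v0 (d_u (d_v (fun u v => phin n u v - phi u v))))
        @ \oo --> 0%E) /\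
   (* (iii) conservation laws *)
   ({ae leb R, forall u : R, 0 <= u <= u0 -> has_d_u phi u v0} /\
    {ae leb R, forall v : R, 0 <= v <= v0 -> has_d_v phi u0 v} /\
    L1norm u0 (fun u => d_u phi u v0) = L1norm u0 (derive1 phip) /\
    L1norm v0 (fun v => d_v phi u0 v) = L1norm v0 (derive1 phim))).
Proof.
have [a [b [hpq h0 Da Db]]] := boundary_curves hu0 hv0 hdata.
split; first split.
- exact: wave_map_exists.
- move=> phi psi W1 W2 u v uu vv.
  have [G1 [phi1 [M1 E1]]] := wave_map_mild hu0 hv0 hdata hpq h0 W1.
  have [G2 [phi2 [M2 E2]]] := wave_map_mild hu0 hv0 hdata hpq h0 W2.
  by rewrite E1// E2//; exact: mild_wave_unique M1 M2.
move=> phi W; split.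
  by move=> phipn phimn phin; exact: wave_map_continuous.
have [G [phi' [M E]]] := wave_map_mild hu0 hv0 hdata hpq h0 W.
have [du ru] := conservation_law (ltW hv0) M E Da.
have [dv rv] := conservation_law (phi := fun v u => phi u v) (ltW hu0) (mild_wave_swap M)
  (fun v u vv uu => E u v uu vv) Db.
split; first exact: du.
split; first exact: dv.
by split; [exact: ru|exact: rv].
Qed.
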